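(* Let $G$ be a group of order $36$ and let $J\in kG\otimes kG$ be a twist such that $(kG)^J$ is simple as a Hopf algebra. Then $G\cong D_3\times D_3$ and $(kG)^J\cong(k(D_3\times D_3))^{J_1}$, where $J_1$ is the twist lifted from a subgroup $H_1\cong\mathbb Z_2\times\mathbb Z_2$ of $D_3\times D_3$ associated with a 2-cocycle on $\widehat{H_1}$ with nontrivial cohomology class.
   Context: $k$ is an algebraically closed field of characteristic zero. $D_3$ denotes the dihedral group of order $6$. For a twist $J$ in a Hopf algebra $A$, $A^J$ is the Hopf algebra with the same algebra and counit, comultiplication $\Delta^J(h)=J^{-1}\Delta(h)J$ and twisted antipode. For an abelian subgroup $H$ of a finite group $G$, $\widehat H$ is its character group and $e_\chi=\frac{1}{|H|}\sum_{h\in H}\chi(h^{-1})h$; the twist lifted from $H$ associated with a 2-cocycle $\omega$ on $\widehat H$ is $J=\sum_{\alpha,\beta\in\widehat H}\omega(\alpha,\beta)e_\alpha\otimes e_\beta$. A Hopf algebra is simple if it has no normal Hopf subalgebras (stable under ${}^hx=\sum h_1xS(h_2)$) other than $k$ and itself. *)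

(* Defs.v *)
(* Group algebras kG are modelled concretely as {ffun gT -> k}
   (coefficient functions on the basis G), with convolution product [gmul].
   kG (x) kG is identified with k[G x G] = {ffun gT * gT -> k}, and
   kG (x) kG (x) kG with k[(G x G) x G]. *)
From HB Require Import structures.
From mathcomp Require Import all_boot all_order all_algebra all_fingroup all_solvable.
From Stdlib Require Import ClassicalEpsilon.
Set Implicit Arguments. Unset Strict Implicit. Unset Printing Implicit Defensive.
Import Order.TTheory GRing.Theory.
Local Open Scope ring_scope.

Section GroupAlgebra.
Variable k : fieldType.

Section OneGroup.
Variable gT : finGroupType.
Implicit Types (a b x h : {ffun gT -> k}).

Definition gdelta (g : gT) : {ffun gT -> k} := [ffun x => (x == g)%:R].
Definition gone : {ffun gT -> k} := gdelta 1%g.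
Definition gmul a b : {ffun gT -> k} :=
  [ffun g => \sum_(x : gT) a x * b ((x^-1)%g * g)%g].
Definition gunit a := exists b, gmul a b = gone /\ gmul b a = gone.
(* the inverse of an invertible element (unspecified otherwise) *)
Definition ginv a : {ffun gT -> k} :=
  epsilon (inhabits a) (fun b => gmul a b = gone /\ gmul b a = gone).
Definition gcounit a : k := \sum_(g : gT) a g.
Definition gantipode a : {ffun gT -> k} := [ffun g => a (g^-1)%g].
End OneGroup.

Definition gscale (T : finType) (c : k) (a : {ffun T -> k}) : {ffun T -> k} :=
  [ffun g => c * a g].

Definition gtens (gT1 gT2 : finGroupType) (a : {ffun gT1 -> k}) (b : {ffun gT2 -> k})
  : {ffun (gT1 * gT2)%type -> k} := [ffun p => a p.1 * b p.2].

Section Twist.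
Variable gT : finGroupType.
Implicit Types (a b x h : {ffun gT -> k}) (J : {ffun (gT * gT)%type -> k}).

(* comultiplication of kG : Delta(g) = g (x) g *)
Definition gcoprod a : {ffun (gT * gT)%type -> k} :=
  [ffun p => if p.1 == p.2 then a p.1 else 0].

Definition comul_id J : {ffun ((gT * gT) * gT)%type -> k} :=
  [ffun p => if p.1.1 == p.1.2 then J (p.1.1, p.2) else 0].
Definition id_comul J : {ffun ((gT * gT) * gT)%type -> k} :=
  [ffun p => if p.1.2 == p.2 then J p.1 else 0].
Definition tens_one J : {ffun ((gT * gT) * gT)%type -> k} := gtens J (gone gT).
Definition one_tens J : {ffun ((gT * gT) * gT)%type -> k} :=
  [ffun p => (p.1.1 == 1%g)%:R * J (p.1.2, p.2)].

Definition is_twist J :=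
  [/\ gunit J,
      gmul (comul_id J) (tens_one J) = gmul (id_comul J) (one_tens J),
      [ffun h : gT => \sum_(g : gT) J (g, h)] = gone gT
    & [ffun g : gT => \sum_(h : gT) J (g, h)] = gone gT].

Definition tcomul J a : {ffun (gT * gT)%type -> k} :=
  gmul (ginv J) (gmul (gcoprod a) J).
(* ... and antipode Q^-1 S(a) Q with Q = m (S (x) id)(J) *)
Definition tQ J : {ffun gT -> k} :=
  [ffun x => \sum_(p : gT * gT | ((p.1)^-1 * p.2)%g == x) J p].
Definition tantipode J a : {ffun gT -> k} :=
  gmul (ginv (tQ J)) (gmul (gantipode a) (tQ J)).

Definition hopf_subalg J (P : {ffun gT -> k} -> Prop) :=
  [/\ P 0,
      (forall a b, P a -> P b -> P (a + b)),
      (forall (c : k) a, P a -> P (gscale c a)),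
      P (gone gT)
    & (forall a b, P a -> P b -> P (gmul a b))] /\
  [/\
      (forall a, P a -> exists s : seq ({ffun gT -> k} * {ffun gT -> k}),
          (forall u, u \in s -> P u.1 /\ P u.2) /\
          tcomul J a = \sum_(u <- s) gtens u.1 u.2)
    & (forall a, P a -> P (tantipode J a))].

(* left adjoint action  h . x = sum h_1 x S(h_2)  in (kG)^J *)
Definition tadj J h x : {ffun gT -> k} :=
  \sum_(p : gT * gT)
     gscale (tcomul J h p) (gmul (gmul (gdelta p.1) x) (tantipode J (gdelta p.2))).

Definition normal_sub J (P : {ffun gT -> k} -> Prop) :=
  forall h x, P x -> P (tadj J h x).

Definition simple_twisted J :=
  forall P, hopf_subalg J P -> normal_sub J P ->
    (forall x, P x <-> exists c : k, x = gscale c (gone gT)) \/ (forall x, P x).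

End Twist.

Definition hopf_iso (gT1 gT2 : finGroupType)
    (J1 : {ffun (gT1 * gT1)%type -> k}) (J2 : {ffun (gT2 * gT2)%type -> k})
    (f : {ffun gT1 -> k} -> {ffun gT2 -> k}) :=
  [/\ (forall (c : k) a b, f (gscale c a + b) = gscale c (f a) + f b),
      bijective f,
      f (gone gT1) = gone gT2
    & (forall a b, f (gmul a b) = gmul (f a) (f b))] /\
  [/\ (forall a, gcounit (f a) = gcounit a)
    & (forall a, tcomul J2 (f a) =
         \sum_(p : gT1 * gT1) gscale (tcomul J1 a p) (gtens (f (gdelta p.1)) (f (gdelta p.2))))].

Section Lifted.
Variables (gT : finGroupType) (H : {group gT}).
Implicit Types (al be ga : {ffun gT -> k}).

Definition is_char al :=
  [/\ al 1%g = 1,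
      (forall x y, x \in H -> y \in H -> al (x * y)%g = al x * al y)
    & (forall x, x \notin H -> al x = 0)].
Definition char_enum (chs : seq {ffun gT -> k}) :=
  uniq chs /\ (forall al, al \in chs <-> is_char al).
Definition cmul al be : {ffun gT -> k} := [ffun x => al x * be x].
Definition char1 : {ffun gT -> k} := [ffun x => (x \in H)%:R].

Definition is_2cocycle (chs : seq {ffun gT -> k}) (om : {ffun gT -> k} -> {ffun gT -> k} -> k) :=
  [/\ (forall al be, al \in chs -> be \in chs -> om al be != 0),
      (forall al be ga, al \in chs -> be \in chs -> ga \in chs ->
         om al be * om (cmul al be) ga = om be ga * om al (cmul be ga)),
      (forall be, be \in chs -> om char1 be = 1)
    & (forall al, al \in chs -> om al char1 = 1)].
Definition is_2coboundary (chs : seq {ffun gT -> k}) (om : {ffun gT -> k} -> {ffun gT -> k} -> k) :=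
  exists mu : {ffun gT -> k} -> k,
    (forall al, al \in chs -> mu al != 0) /\
    (forall al be, al \in chs -> be \in chs ->
        om al be = mu al * mu be / mu (cmul al be)).

Definition idem al : {ffun gT -> k} := [ffun g => (#|H|%:R)^-1 * al (g^-1)%g].
Definition lifted_twist (chs : seq {ffun gT -> k}) (om : {ffun gT -> k} -> {ffun gT -> k} -> k)
  : {ffun (gT * gT)%type -> k} :=
  \sum_(al <- chs) \sum_(be <- chs) gscale (om al be) (gtens (idem al) (idem be)).
End Lifted.

End GroupAlgebra.

(* Main.v *)
Require Import Defs.
From HB Require Import structures.
From mathcomp Require Import all_boot all_order all_algebra all_fingroup all_solvable.
From mathcomp Require Import ring.
From Stdlib Require Import ClassicalEpsilon.
Set Implicit Arguments. Unset Strict Implicit. Unset Printing Implicit Defensive.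
Import GRing.Theory.

(* Central elements of G span a central Hopf subalgebra of (kG)^J, so simplicity gives
   Z(G) = 1, and then G = P ><| Q with #|P| = 9 and #|Q| = 4.

   For a linear character psi of G put t_psi = ((id (x) psi) J)^-1 ((psi (x) id) J).  These
   elements are grouplike in (kG)^J and multiplicative in psi.  If psi^2 = 1, psi != 1 and
   t_psi = 1, then the elements fixed by h |-> j^-1 (h <| psi) j, with j = (id (x) psi) J,
   form a proper normal Hopf subalgebra.  A trace computation on k[G/Q], whose dimension 9
   is odd, shows that t_psi = 1 as soon as psi^2 = 1 and every character of G/P takes the
   value 1 on t_psi.  Hence Q is a Klein group, G is S_3 x S_3, and
   psi_2(t_psi_1) = -1 for the two characters psi_1, psi_2 dual to the generators of Q.

   The functions on G with the product (f f')(x) = sum J(a, b) f(xa) f'(xb) form an algebra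
   on which G acts by left translation.  The inflated characters psi_1, psi_2 span
   a copy of M_2(k) there, so that the algebra is the tensor product of M_2(k) with
   its centralizer, and the eigenvectors of P in the centralizer generate a copy of k^9.
   A Q-invariant primitive idempotent of this copy yields an invertible v in kG with
   Delta(v) J_1 = J (v (x) v), where J_1 is the image of J under (p (x) p) for the
   projection p : G -> Q; and a twist supported on the Klein group Q is lifted from a
   cocycle on its dual, whose class is nontrivial because psi_2(t_psi_1) = -1. *)

(** * Groups of order 36 *)

(** A linear map of functions on G that commutes with left translations is right translation by some
    v in kG, and it is multiplicative from the J_1-product to the J-product exactly when Delta(v)
    J_1 = J (v (x) v). So a gauge equivalence is found by comparing two algebras with G-action, and
    no classification of twists enters: an idempotent whose P-translates are orthogonal with sum 1
    already provides the map.

    The number psi_2(t_psi_1) is w(psi_1, psi_2) / w(psi_2, psi_1), where w is the 2-cocycle that J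
    induces on linear characters. If it is -1, then psi_1 and psi_2 anticommute in the twisted
    function algebra. The case to be excluded is the value 1. If t_psi = 1, then psi is a central
    grouplike element of the dual of (kG)^J, and the normal Hopf subalgebra is the dual of the
    quotient that identifies psi with 1. The difficulty is to reach t_psi = 1: a grouplike element
    of (kG)^J need not lie in G, so orders of elements say nothing about it. What remains available
    is that traces of idempotents are integers and that class functions do not see conjugation by
    slices of J. *)

Section Order36.
Local Open Scope group_scope.
Variable gT : finGroupType.
Hypotheses (cardG : #|gT| = 36) (Z1 : 'Z([set: gT]) = 1).

Let cardT : #|[set: gT]| = 36. Proof. by rewrite cardsT. Qed.

Lemma central_eq1 (x : gT) : (forall y, commute x y) -> x = 1.
Proof.
move=> cx; apply/eqP; have : x \in 'Z([set: gT]) by apply/centerP; split; rewrite ?inE.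
by rewrite Z1 inE.
Qed.

Lemma card_Syl3 (P : {group gT}) : P \in 'Syl_3([set: gT]) -> #|P| = 9.
Proof. by rewrite inE => /card_Hall ->; rewrite cardT p_part. Qed.

Lemma abelian_Syl3 (P : {group gT}) : P \in 'Syl_3([set: gT]) -> abelian P.
Proof.
move=> sP; have cP := card_Syl3 sP; move: sP; rewrite inE => /pHall_pgroup pP.
by apply: (p2group_abelian pP); rewrite cP.
Qed.

(** The intersection D has order 1, 3 or 9. Order 1 would give a product set of 81 elements. Order 3
    gives one of 27, so P1 and P2 generate G; both are abelian, so D would be central. *)
Lemma Syl3_unique (P1 P2 : {group gT}) :
  P1 \in 'Syl_3([set: gT]) -> P2 \in 'Syl_3([set: gT]) -> P1 :=: P2.
Proof.
move=> sP1 sP2; have [c1 c2] := (card_Syl3 sP1, card_Syl3 sP2).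
have [a1 a2] := (abelian_Syl3 sP1, abelian_Syl3 sP2).
set D := P1 :&: P2.
have dD : #|D| %| 9 by rewrite -c1 cardSg ?subsetIl.
have cM := mul_cardG P1 P2; rewrite c1 c2 -/D in cM.
have M36 : #|P1 * P2| <= 36 by rewrite -cardT subset_leq_card ?subsetT.
have D9 : #|D| = 9 -> P1 :=: P2.
  move=> cD; have /eqP DP1 : D == P1 by rewrite eqEcard subsetIl c1 cD.
  by apply/eqP; rewrite eqEcard c1 c2 -DP1 subsetIr.
have : #|D| \in divisors 9 by rewrite -dvdn_divisors.
rewrite (_ : divisors 9 = [:: 1%N; 3; 9]) // !inE => /or3P[] /eqP cD.
- by rewrite cD muln1 in cM; move: M36; rewrite -cM.
- have cM' : #|P1 * P2| = 27.
    by move: cM; rewrite cD => cM; apply/eqP; rewrite -(eqn_pmul2r (isT : 0 < 3)) -cM.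
  have cJ : #|P1 <*> P2| = 36.
    have le27 : 27 <= #|P1 <*> P2| by rewrite -cM' subset_leq_card ?mulG_subG ?mul_subG ?joing_subl ?joing_subr.
    have : #|P1 <*> P2| %| 36 by rewrite -cardT cardSg ?subsetT.
    rewrite dvdn_divisors // (_ : divisors 36 = [:: 1%N; 2; 3; 4; 6; 9; 12; 18; 36]) // !inE.
    by do 8![case/orP => [/eqP e|]; first by move: le27; rewrite e]; move/eqP.
  have JT : P1 <*> P2 = [set: gT].
    by apply/eqP; rewrite eqEcard subsetT cardT cJ.
  have : D \subset 'Z([set: gT]).
    rewrite subsetI subsetT -JT centY subsetI.
    by rewrite (subset_trans (subsetIl _ _) a1) (subset_trans (subsetIr _ _) a2).
  by rewrite Z1 => /subset_leq_card; rewrite cD cards1.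
- exact: D9.
Qed.

Lemma exists_sdprod_Syl : exists P Q : {group gT},
  [/\ P <| [set: gT], #|P| = 9, #|Q| = 4, P :&: Q = 1 & P * Q = [set: gT]].
Proof.
have [P sP] := Sylow_exists 3 [set: gT]; have [Q sQ] := Sylow_exists 2 [set: gT].
have cQ : #|Q| = 4 by rewrite (card_Hall sQ) cardT p_part.
have sP' : P \in 'Syl_3([set: gT]) by rewrite inE.
have cP := card_Syl3 sP'.
have tPQ : P :&: Q = 1 by apply: coprime_TIg; rewrite cP cQ.
exists P, Q; split=> //.
  rewrite /normal subsetT; apply/subsetP=> x _; rewrite inE.
  have sPx : (P :^ x)%G \in 'Syl_3([set: gT]).
    by rewrite inE pHallJ ?inE.
  by rewrite -{2}(Syl3_unique sPx sP').
by apply/eqP; rewrite eqEcard subsetT cardT TI_cardMg // cP cQ.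
Qed.

Section Klein.
Variables P Q : {group gT}.
Hypotheses (nP : P <| [set: gT]) (cP : #|P| = 9) (cQ : #|Q| = 4)
  (tPQ : P :&: Q = 1) (PQ : P * Q = [set: gT]) (ncQ : ~~ cyclic Q).

Let aP : abelian P.
Proof. by apply: (@p2group_abelian _ 3); rewrite /pgroup cP. Qed.
Let aQ : abelian Q.
Proof. by apply: (@p2group_abelian _ 2); rewrite /pgroup cQ. Qed.

Let Q2 x : x \in Q -> x * x = 1.
Proof.
move=> xQ; have : #[x] %| 4 by rewrite -cQ order_dvdG.
rewrite dvdn_divisors // (_ : divisors 4 = [:: 1%N; 2; 4]) // !inE.
case/or3P => /eqP ox; first by move/eqP: ox; rewrite order_eq1 => /eqP ->; rewrite mulg1.
  by rewrite -[x * x]/(x ^+ 2) -ox expg_order.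
case/negP: ncQ; apply/cyclicP; exists x; apply/eqP.
by rewrite eq_sym eqEcard cycle_subG xQ cQ -ox leqnn.
Qed.

Let PJ x y : x \in P -> x ^ y \in P.
Proof. by move=> xP; rewrite memJ_norm // (subsetP (normal_norm nP)) ?inE. Qed.

Let PC x y : x \in P -> y \in P -> commute x y.
Proof. by move=> xP yP; apply: (centsP aP). Qed.
Let QC x y : x \in Q -> y \in Q -> commute x y.
Proof. by move=> xP yP; apply: (centsP aQ). Qed.

Let PQ_decomp g : exists x y, [/\ x \in P, y \in Q & g = x * y].
Proof.
have : g \in P * Q by rewrite PQ inE.
by case/mulsgP=> x y xP yQ ->; exists x, y.
Qed.

Let centralQ s : s \in Q -> (forall x, x \in P -> x ^ s = x) -> s = 1.
Proof.
move=> sQ sx; apply: central_eq1 => g; have [x [y [xP yQ ->]]] := PQ_decomp g.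
apply: commuteM; last exact: QC.
by apply/commute_sym/commgP/conjg_fixP; exact: sx.
Qed.
Let centralP x : x \in P -> (forall s, s \in Q -> x ^ s = x) -> x = 1.
Proof.
move=> xP sx; apply: central_eq1 => g; have [y [s [yP sQ ->]]] := PQ_decomp g.
apply: commuteM; first exact: PC.
by apply/commgP/conjg_fixP; exact: sx.
Qed.

Let QJJ s x : s \in Q -> (x ^ s) ^ s = x.
Proof. by move=> sQ; rewrite -conjgM Q2 // conjg1. Qed.

(** Otherwise each [x * x ^ s], being fixed by [s], is trivial, so every involution of Q inverts P;
    a product of two distinct involutions then centralizes P, hence is central. *)
Lemma exists_fixing_involution : exists s a,
  [/\ s \in Q, s != 1, a \in P, a != 1 & a ^ s = a].
Proof.
case: (boolP [exists s in Q, (s != 1) && [exists a in P, (a != 1) && (a ^ s == a)]]).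
  case/exists_inP=> s sQ /andP[s1 /exists_inP[a aP' /andP[a1 /eqP e]]].
  by exists s, a.
move/exists_inPn => no.
have inv s x : s \in Q -> s != 1 -> x \in P -> x ^ s = x^-1.
  move=> sQ s1 xP; have := no s sQ; rewrite s1 /= => /exists_inPn.
  move/(_ (x * x ^ s)); rewrite groupM ?PJ // => /(_ isT).
  rewrite conjMg QJJ // (PC (PJ s xP) xP) eqxx andbT negbK => /eqP e.
  by apply/eqP; rewrite eq_sym eq_invg_mul e.
have [s sQ s1] : exists2 s, s \in Q & s != 1.
  by apply/trivgPn; rewrite trivg_card1 cQ.
have [t tQ ts] : exists2 t, t \in Q & t \notin <[s]>.
  have /subsetPn[t tQ tns] : ~~ (Q \subset <[s]>); last by exists t.
  apply: contra ncQ => sub; apply/cyclicP; exists s; apply/eqP.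
  by rewrite eqEsubset sub cycle_subG.
have t1 : t != 1 by apply: contraNneq ts => ->; exact: group1.
have st1 : s * t = 1.
  apply: centralQ; first by rewrite groupM.
  by move=> x xP; rewrite conjgM (inv s) // (inv t) ?groupV // invgK.
case/negP: ts; rewrite (_ : t = s^-1) ?groupV ?cycle_id //.
by apply/eqP; rewrite eq_sym eq_invg_mul st1.
Qed.

(** An involution [s] with a nontrivial fixed point splits P into a fixed and an inverted part, both
    of order 3. The rest of Q commutes with [s] and so preserves this splitting. *)
Lemma Klein_generators : exists a1 a2 s1 s2,
  [/\ [/\ #[a1] = 3, #[a2] = 3, #[s1] = 2 & #[s2] = 2],
     [/\ a1 ^ s1 = a1^-1, a1 ^ s2 = a1, a2 ^ s1 = a2 & a2 ^ s2 = a2^-1],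
     commute a1 a2 /\ commute s1 s2, <[a1]> * <[a2]> = P & <[s1]> * <[s2]> = Q].
Proof.
have [s [a [sQ s1 aP' a1 as_]]] := exists_fixing_involution.
have order2 x : x \in Q -> x != 1 -> #[x] = 2.
  by move=> xQ x1; apply: nt_prime_order => //; exact: Q2.
have [t tQ ts] : exists2 t, t \in Q & t \notin <[s]>.
  have /subsetPn[t tQ tns] : ~~ (Q \subset <[s]>); last by exists t.
  apply: contra ncQ => sub; apply/cyclicP; exists s; apply/eqP.
  by rewrite eqEsubset sub cycle_subG.
have t1 : t != 1 by apply: contraNneq ts => ->; exact: group1.
have Qgen u : u \in Q -> u \notin <[s]> -> <[u]> * <[s]> = Q.
  move=> uQ us; have u1 : u != 1 by apply: contraNneq us => ->; exact: group1.
  apply/eqP; rewrite eqEcard mul_subG ?cycle_subG //= TI_cardMg.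
    by rewrite -!orderE !order2 ?cQ.
  apply: prime_TIg; rewrite -?orderE ?order2 //.
  by apply: contra us; rewrite cycle_subG.
have [b bP bs] : exists2 b, b \in P & b ^ s != b.
  apply/exists_inP; apply: contraNT s1 => /exists_inPn bs.
  by apply/eqP/centralQ => // x /bs; rewrite negbK => /eqP.
have order9 x : x \in P -> x != 1 -> #[x] = 3 \/ <[x]> = P.
  move=> xP x1; have : #[x] %| 9 by rewrite -cP order_dvdG.
  rewrite dvdn_divisors // (_ : divisors 9 = [:: 1%N; 3; 9]) // !inE order_eq1 (negPf x1) /=.
  case/orP=> /eqP ox; [by left|right].
  by apply/eqP; rewrite eqEcard cycle_subG xP cP -orderE ox.
have sq1 x : x \in P -> x * x = 1 -> x = 1.
  move=> xP xx; apply/eqP; rewrite -order_eq1 -dvdn1 -(_ : gcdn 2 9 = 1%N) // dvdn_gcd.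
  by rewrite order_dvdn -[x ^+ 2]/(x * x) xx eqxx -cP order_dvdG.
have oa : #[a] = 3.
  case: (order9 a aP' a1) => // aPe; case/negP: s1; apply/eqP/centralQ => // x.
  by rewrite -aPe => /cycleP[i ->]; rewrite conjXg as_.
(* A commutator with an involution is inverted by it. *)
pose c := b^-1 * b ^ s.
have cPP : c \in P by rewrite groupM ?groupV ?PJ.
have c1 : c != 1 by rewrite -eq_invg_mul invgK eq_sym.
have cs : c ^ s = c^-1.
  by rewrite conjMg QJJ // invMg invgK conjVg.
have oc : #[c] = 3.
  case: (order9 c cPP c1) => // cPe; case/negP: a1; apply/eqP/sq1 => //.
  apply/eqP; rewrite -eq_invg_mul -{2}as_; move: aP'; rewrite -cPe => /cycleP[i ->].
  by rewrite conjXg cs expgVn.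
have cna : c \notin <[a]>.
  apply: contra c1 => /cycleP[i ci]; apply/eqP/sq1 => //; apply/eqP.
  by rewrite -eq_invg_mul -cs {1}ci conjXg as_ -ci.
have acP : <[a]> * <[c]> = P.
  apply/eqP; rewrite eqEcard mul_subG ?cycle_subG //= -(normC _); last first.
    by rewrite cents_norm // cycle_subG; apply/centP => x /cycleP[i ->]; apply: commuteX; apply: PC.
  rewrite TI_cardMg -?orderE ?oa ?oc ?cP //.
  by apply: prime_TIg; rewrite -?orderE ?oc // cycle_subG.
have decomp x : x \in P -> exists i j, x = a ^+ i * c ^+ j.
  rewrite -{1}acP => /mulsgP[y z /cycleP[i ->] /cycleP[j ->] ->]; by exists i, j.
have sJ i j : (a ^+ i * c ^+ j) ^ s = a ^+ i * (c ^+ j)^-1.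
  by rewrite conjMg !conjXg as_ cs expgVn.
have stJ x : (x ^ t) ^ s = (x ^ s) ^ t by rewrite -!conjgM (QC tQ sQ).
have cyc3 (x y : gT) : #[x] = 3 -> y \in <[x]> -> [\/ y = 1, y = x | y = x^-1].
  move=> ox /cycleP[i ->]; rewrite -(expg_mod_order x i) ox.
  case: (i %% 3) (ltn_mod i 3) => [|[|[|//]]] _; [by constructor 1|by constructor 2|].
  by constructor 3; rewrite invg_expg ox.
(* [a ^ t] is fixed by [s], so its [c]-part is its own inverse and vanishes. If [a ^ t] were [a],
   then [a] would be central. *)
have at_ : a ^ t = a^-1.
  have [i [j e]] := decomp _ (PJ t aP').
  have cj1 : c ^+ j = 1.
    apply: sq1; first by rewrite groupX.
    have := stJ a; rewrite as_ e sJ => /mulgI/eqP; rewrite eq_invg_mul => /eqP //.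
  rewrite cj1 mulg1 in e.
  have := cyc3 a (a ^ t) oa; rewrite e mem_cycle -e => /(_ isT) [e1|e1|//].
    by move/eqP: e1; rewrite conjg_eq1 (negPf a1).
  case/negP: a1; apply/eqP/centralP => // u.
  rewrite -(Qgen t tQ ts) => /mulsgP[x y /cycleP[m ->] /cycleP[n ->] ->].
  have fixX g n' : a ^ g = a -> a ^ (g ^+ n') = a.
    by move=> ag; apply/conjg_fixP/commgP/commuteX/commgP/conjg_fixP.
  by rewrite conjgM !fixX.
have ct : c ^ t = c \/ c ^ t = c^-1.
  have [i [j e]] := decomp _ (PJ t cPP).
  have ai1 : a ^+ i = 1.
    apply: sq1; first by rewrite groupX.
    have := stJ c; rewrite cs conjVg e sJ invMg (PC _ _) ?groupV ?groupX // => /mulgI e'.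
    by rewrite {1}e' mulVg.
  rewrite ai1 mul1g in e.
  have := cyc3 c (c ^ t) oc; rewrite e mem_cycle -e => /(_ isT) [e1|e1|e1]; [|by left|by right].
  by move/eqP: e1; rewrite conjg_eq1 (negPf c1).
have ac : commute a c by apply: PC.
(* If [t] inverts [c] as well, then [t * s] inverts [a] and fixes [c]. *)
case: ct => ct.
  exists a, c, t, s; split=> //; last by apply: Qgen.
    by split=> //; exact: order2.
  by split=> //; exact: QC.
have tsn : t * s \notin <[s]> by rewrite groupMr ?cycle_id.
have tsQ : t * s \in Q by rewrite groupM.
exists a, c, (t * s), s; split=> //; last by apply: Qgen.
- by split=> //; apply: order2 => //; apply: contraNneq tsn => ->; exact: group1.
- by split=> //; rewrite conjgM ?at_ ?ct conjVg ?as_ ?cs ?invgK.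
- by split=> //; exact: QC.
Qed.

End Klein.
End Order36.

(** * Recognition of D_3 x D_3 from generators *)

Section DihedralSquare.
Local Open Scope group_scope.

(** Dihedral groups are indexed here by their order, so ['D_6] is D_3. Its presentation gives a
    surjection, and equality of orders makes it an isomorphism. *)
Lemma D6_of_generators (gT : finGroupType) (a s : gT) :
  #[a] = 3 -> #[s] = 2 -> a ^ s = a^-1 ->
  #|<[a]> <*> <[s]>| = 6 /\ <[a]> <*> <[s]> \isog [set: 'D_6].
Proof.
move=> oa os as_.
have nas : <[s]> \subset 'N(<[a]>).
  by rewrite cycle_subG; apply/normP; rewrite -cycleJ as_ cycleV.
have cD : #|<[a]> <*> <[s]>| = 6.
  rewrite norm_joinEr // TI_cardMg -?orderE ?oa ?os //.
  by apply: coprime_TIg; rewrite -!orderE oa os.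
split=> //; rewrite isogEcard cD (@card_dihedral 3) // andbT.
rewrite (@Grp_dihedral 3) //; apply/existsP; exists (a, s).
by rewrite /= !xpair_eqE as_ -order_dvdn oa -order_dvdn os !eqxx.
Qed.

Section Isog.
Variables (gT : finGroupType) (a1 a2 s1 s2 : gT).
Hypotheses (cardG : #|gT| = 36)
  (o1 : #[a1] = 3) (o2 : #[a2] = 3) (q1 : #[s1] = 2) (q2 : #[s2] = 2)
  (a1s1 : a1 ^ s1 = a1^-1) (a1s2 : a1 ^ s2 = a1) (a2s1 : a2 ^ s1 = a2)
  (a2s2 : a2 ^ s2 = a2^-1) (ca : commute a1 a2) (cs : commute s1 s2)
  (gen : (<[a1]> * <[a2]>) * (<[s1]> * <[s2]>) = [set: gT]).

Lemma isog_D6D6 : [set: gT] \isog [set: ('D_6 * 'D_6)%type].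
Proof.
have [c1 i1] := D6_of_generators o1 q1 a1s1.
have [c2 i2] := D6_of_generators o2 q2 a2s2.
set D1 := <[a1]> <*> <[s1]> in c1 i1; set D2 := <[a2]> <*> <[s2]> in c2 i2.
have com (x y : gT) : x ^ y = x -> commute x y.
  by move=> e; apply/commgP/conjg_fixP.
have cD : D2 \subset 'C(D1).
  rewrite /D1 join_subG !cycle_subG /= !centY !cent_cycle !in_setI.
  have cent1 (x y : gT) : commute x y -> x \in 'C[y] by move=> e; apply/cent1P.
  rewrite (cent1 _ _ (commute_sym ca)) (cent1 _ _ (com _ _ a2s1)).
  by rewrite (cent1 _ _ (commute_sym (com _ _ a1s2))) (cent1 _ _ (commute_sym cs)).
have J : D1 * D2 = [set: gT].
  rewrite -cent_joinEr //; apply/eqP; rewrite eqEsubset subsetT -gen /=.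
  have A1 : <[a1]> \subset D1 <*> D2 := subset_trans (joing_subl _ _) (joing_subl _ _).
  have A2 : <[a2]> \subset D1 <*> D2 := subset_trans (joing_subl _ _) (joing_subr _ _).
  have S1 : <[s1]> \subset D1 <*> D2 := subset_trans (joing_subr _ _) (joing_subl _ _).
  have S2 : <[s2]> \subset D1 <*> D2 := subset_trans (joing_subr _ _) (joing_subr _ _).
  by rewrite !mul_subG.
have tD : D1 :&: D2 = 1.
  apply/eqP; rewrite trivg_card1 -(eqn_pmul2l (isT : 0 < 36)).
  by have := mul_cardG D1 D2; rewrite /= J c1 c2 cardsT cardG => <-.
apply: (@isog_dprod _ _ D1 D2 _ (setX [set: 'D_6] 1) (setX 1 [set: 'D_6])).
- by rewrite dprodE.
- rewrite setX_dprod; apply/setP => x; by rewrite !inE.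
- exact: isog_trans i1 (isog_setX1 _ _).
- exact: isog_trans i2 (isog_set1X _ _).
Qed.
End Isog.

End DihedralSquare.

Local Open Scope ring_scope.

(** * The group algebra and its linear maps *)

(** A separate name on which the ring structure is convolution. *)
Definition galg (k : fieldType) (gT : finGroupType) := {ffun gT -> k}.

Section GroupAlgebraRing.
Variables (k : fieldType) (gT : finGroupType).

HB.instance Definition _ := GRing.Zmodule.copy (galg k gT) {ffun gT -> k}.

Implicit Types a b c : galg k gT.

Lemma gmulE a b g : gmul a b g = \sum_x a x * b (x^-1 * g)%g.
Proof. by rewrite ffunE. Qed.

Lemma gmulA : associative (@gmul k gT).
Proof.
move=> a b c; apply/ffunP=> g; rewrite !gmulE.
transitivity (\sum_x \sum_y a x * (b (x^-1 * y)%g * c (y^-1 * g)%g)).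
  apply: eq_bigr => x _; rewrite gmulE mulr_sumr.
  rewrite (reindex_inj (mulgI x^-1%g)) /=; apply: eq_bigr => y _.
  by rewrite invMg invgK -!mulgA mulKVg.
rewrite exchange_big /=; apply: eq_bigr => y _.
by rewrite gmulE mulr_suml; apply: eq_bigr => x _; rewrite mulrA.
Qed.

Lemma gmul1l : left_id (gone k gT) (@gmul k gT).
Proof.
move=> a; apply/ffunP=> g; rewrite gmulE (bigD1 1%g) //= big1 ?addr0.
  by rewrite ffunE eqxx mul1r invg1 mul1g.
by move=> x /negPf x1; rewrite ffunE x1 mul0r.
Qed.

Lemma gmul1r : right_id (gone k gT) (@gmul k gT).
Proof.
move=> a; apply/ffunP=> g; rewrite gmulE (bigD1 g) //= big1 ?addr0.
  by rewrite ffunE mulVg eqxx mulr1.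
move=> x xg; rewrite ffunE -(inj_eq (mulgI x)) mulKVg mulg1 eq_sym.
by rewrite (negPf xg) mulr0.
Qed.

Lemma gmulDl : left_distributive (@gmul k gT) (+%R : galg k gT -> _).
Proof.
move=> a b c; apply/ffunP=> g; rewrite [RHS]ffunE !gmulE -big_split /=.
by apply: eq_bigr => x _; rewrite ffunE mulrDl.
Qed.

Lemma gmulDr : right_distributive (@gmul k gT) (+%R : galg k gT -> _).
Proof.
move=> a b c; apply/ffunP=> g; rewrite [RHS]ffunE !gmulE -big_split /=.
by apply: eq_bigr => x _; rewrite ffunE mulrDr.
Qed.

Lemma gone_neq0 : (gone k gT : galg k gT) != 0.
Proof.
apply/eqP=> /ffunP/(_ 1%g); rewrite !ffunE eqxx => /eqP; by rewrite oner_eq0.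
Qed.

HB.instance Definition _ := GRing.Zmodule_isNzRing.Build (galg k gT)
  gmulA gmul1l gmul1r gmulDl gmulDr gone_neq0.

Lemma gscaleA (c d : k) a : gscale c (gscale d a) = gscale (c * d) a.
Proof. by apply/ffunP=> g; rewrite !ffunE mulrA. Qed.
Lemma gscale1 : left_id (1 : k) (@gscale k gT).
Proof. by move=> a; apply/ffunP=> g; rewrite !ffunE mul1r. Qed.
Lemma gscaleDr : right_distributive (@gscale k gT) (+%R : galg k gT -> _).
Proof. by move=> c a b; apply/ffunP=> g; rewrite !ffunE mulrDr. Qed.
Lemma gscaleDl a : {morph (@gscale k gT)^~ a : c d / c + d >-> (c + d : galg k gT)}.
Proof. by move=> c d; apply/ffunP=> g; rewrite !ffunE mulrDl. Qed.

HB.instance Definition _ := GRing.Zmodule_isLmodule.Build k (galg k gT)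
  gscaleA gscale1 gscaleDr gscaleDl.

Lemma gscaleAl (c : k) a b : c *: (a * b) = (c *: a) * b.
Proof.
apply/ffunP=> g; rewrite ffunE [in RHS]ffunE [in LHS]ffunE mulr_sumr.
by apply: eq_bigr => x _; rewrite ffunE mulrA.
Qed.
Lemma gscaleAr (c : k) a b : c *: (a * b) = a * (c *: b).
Proof.
apply/ffunP=> g; rewrite ffunE [in RHS]ffunE [in LHS]ffunE mulr_sumr.
by apply: eq_bigr => x _; rewrite ffunE mulrCA.
Qed.

HB.instance Definition _ := GRing.Lmodule_isLalgebra.Build k (galg k gT) gscaleAl.
HB.instance Definition _ := GRing.Lalgebra_isAlgebra.Build k (galg k gT) gscaleAr.

Definition gb (g : gT) : galg k gT := gdelta k g.

Lemma galgD a b g : (a + b) g = a g + b g. Proof. exact: ffunE. Qed.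
Lemma galgN a g : (- a) g = - a g. Proof. exact: ffunE. Qed.
Lemma galgZ (c : k) a g : (c *: a) g = c * a g. Proof. exact: ffunE. Qed.
Lemma galg_sum (I : Type) (r : seq I) (P : pred I) (F : I -> galg k gT) g :
  (\sum_(i <- r | P i) F i) g = \sum_(i <- r | P i) F i g.
Proof. exact: sum_ffunE. Qed.
Lemma gbE g h : gb g h = (h == g)%:R. Proof. exact: ffunE. Qed.

Lemma galg_expand a : a = \sum_g a g *: gb g.
Proof.
apply/ffunP=> h; rewrite galg_sum (bigD1 h) //= galgZ gbE eqxx mulr1.
by rewrite big1 ?addr0 // => g gh; rewrite galgZ gbE eq_sym (negPf gh) mulr0.
Qed.

Lemma gbM g h : gb (g * h) = gb g * gb h.
Proof.
apply/ffunP=> x; rewrite [in RHS]ffunE (bigD1 g) //= big1 ?addr0.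
  by rewrite !ffunE eqxx mul1r -[in RHS](inj_eq (mulgI g)) mulKVg.
by move=> y yg; rewrite ffunE (negPf yg) mul0r.
Qed.

Lemma gb1 : gb 1 = 1. Proof. by []. Qed.

End GroupAlgebraRing.

Section LinearExtension.
Variables (k : fieldType) (gT : finGroupType) (V : lmodType k).
Implicit Types (F : gT -> V) (a b : galg k gT).

(** All linear maps out of kG are put in this form, so that identities between them are checked on
    group elements by [eq_glin]. *)
Definition glin F a : V := \sum_g a g *: F g.

Lemma glin_is_linear F : linear (glin F).
Proof.
move=> c a b; rewrite /glin scaler_sumr -big_split /=.
by apply: eq_bigr => g _; rewrite galgD galgZ scalerDl scalerA.
Qed.
HB.instance Definition _ F :=
  GRing.isLinear.Build k (galg k gT) V _ (glin F) (glin_is_linear F).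

Lemma glin_gb F g : glin F (gb k g) = F g.
Proof.
rewrite /glin (bigD1 g) //= gbE eqxx scale1r big1 ?addr0 // => h hg.
by rewrite gbE (negPf hg) scale0r.
Qed.

Lemma eq_glin F F' : F =1 F' -> glin F =1 glin F'.
Proof. by move=> eF a; apply: eq_bigr => g _; rewrite eF. Qed.

Lemma glinM F a b : glin F (a * b) = \sum_g a g *: glin (fun h => F (g * h)%g) b.
Proof.
rewrite {1}(galg_expand a) mulr_suml linear_sum; apply: eq_bigr => g _.
rewrite -scalerAl linearZ /=; congr (_ *: _).
rewrite {1}(galg_expand b) mulr_sumr linear_sum; apply: eq_bigr => h _.
by rewrite -scalerAr linearZ /= -gbM glin_gb.
Qed.

Lemma glinMr F a b : glin F (a * b) = \sum_h b h *: glin (fun g => F (g * h)%g) a.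
Proof.
rewrite glinM /glin; under eq_bigr do rewrite scaler_sumr.
rewrite exchange_big /=; apply: eq_bigr => h _; rewrite scaler_sumr.
by apply: eq_bigr => g _; rewrite !scalerA mulrC.
Qed.

Lemma glin_sumF (I : Type) (r : seq I) (P : pred I) (F : I -> gT -> V) a :
  glin (fun g => \sum_(i <- r | P i) F i g) a = \sum_(i <- r | P i) glin (F i) a.
Proof.
rewrite /glin exchange_big /=; apply: eq_bigr => g _; exact: scaler_sumr.
Qed.

Lemma glinD F F' a : glin (fun g => F g + F' g) a = glin F a + glin F' a.
Proof. by rewrite /glin -big_split; apply: eq_bigr => g _; rewrite scalerDr. Qed.

Lemma glin_scale (c : k) F a : glin (fun g => c *: F g) a = c *: glin F a.
Proof.
by rewrite /glin scaler_sumr; apply: eq_bigr => g _; rewrite !scalerA mulrC.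
Qed.

End LinearExtension.

Lemma linear_glin (k : fieldType) (gT : finGroupType) (V W : lmodType k)
    (f : {linear V -> W}) (F : gT -> V) (a : galg k gT) :
  f (glin F a) = glin (fun g => f (F g)) a.
Proof. by rewrite linear_sum; apply: eq_bigr => g _; rewrite linearZ. Qed.

Lemma glin_id (k : fieldType) (gT : finGroupType) (a : galg k gT) : glin (@gb k gT) a = a.
Proof. by rewrite [RHS]galg_expand. Qed.

Section Multiplicative.
Variables (k : fieldType) (gT : finGroupType) (A : algType k) (F : gT -> A).
Hypotheses (F1 : F 1%g = 1) (FM : {morph F : x y / (x * y)%g >-> x * y}).

Lemma glin1 : glin F 1 = 1. Proof. by rewrite -gb1 glin_gb. Qed.

Lemma glin_mul : {morph glin F : a b / a * b}.
Proof.
move=> a b; rewrite glinM {2}/glin mulr_suml; apply: eq_bigr => g _.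
rewrite -scalerAl; congr (_ *: _); rewrite mulr_sumr.
by apply: eq_bigr => h _; rewrite FM scalerAr.
Qed.
End Multiplicative.

Section Push.
Variables (k : fieldType).
(** [f] need not be a homomorphism: the antipode and the contractions m(S (x) id) are push-forwards
    too. *)
Definition gmap (gT1 gT2 : finGroupType) (f : gT1 -> gT2) : galg k gT1 -> galg k gT2 :=
  glin (fun g => gb k (f g)).
HB.instance Definition _ (gT1 gT2 : finGroupType) (f : gT1 -> gT2) :=
  GRing.Linear.copy (gmap f) (glin (fun g => gb k (f g))).

Variables (gT1 gT2 : finGroupType).
Implicit Types (f : gT1 -> gT2).

Lemma gmapE f a y : gmap f a y = \sum_(x | f x == y) a x.
Proof.
rewrite galg_sum [RHS]big_mkcond; apply: eq_bigr => x _.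
by rewrite galgZ gbE eq_sym; case: eqP; rewrite ?mulr1 ?mulr0.
Qed.
Lemma glin_gmap (V : lmodType k) (F : gT2 -> V) f a : glin F (gmap f a) = glin (F \o f) a.
Proof. by rewrite linear_glin; apply: eq_glin => g /=; rewrite glin_gb. Qed.
Lemma gmap_gb f g : gmap f (gb k g) = gb k (f g). Proof. exact: glin_gb. Qed.
Lemma gmapM f : {morph f : x y / (x * y)%g} -> {morph gmap f : a b / a * b}.
Proof. by move=> fM; apply: glin_mul => x y; rewrite fM gbM. Qed.
Lemma gmap1 f : f 1%g = 1%g -> gmap f 1 = 1.
Proof. by move=> f1; rewrite -gb1 gmap_gb f1. Qed.
End Push.

(** * Twists and slices along linear characters *)

Section PushProducts.
Variable k : fieldType.
Variables gT1 gT2 gT : finGroupType.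

Lemma glin_gmapM (V : lmodType k) (F : gT -> V) (f : gT1 -> gT) (g : gT2 -> gT)
    (a : galg k gT1) (b : galg k gT2) :
  glin F (gmap f a * gmap g b) =
  glin (fun x => glin (fun y => F (f x * g y)%g) b) a.
Proof.
rewrite [gmap f a]/gmap [X in X * _]/glin mulr_suml linear_sum; apply: eq_bigr => x _.
rewrite -scalerAl linearZ; congr (_ *: _).
rewrite [gmap g b]/gmap [X in _ * X]/glin mulr_sumr linear_sum; apply: eq_bigr => y _.
by rewrite -scalerAr linearZ /= -gbM glin_gb.
Qed.

Lemma gmap_mulE (f : gT1 -> gT) (g : gT2 -> gT) (a : galg k gT1) (b : galg k gT2) :
  gmap f a * gmap g b = glin (fun x => glin (fun y => gb k (f x * g y)%g) b) a.
Proof. by rewrite -glin_gmapM glin_id. Qed.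

Lemma glin_exchange (V : lmodType k) (F : gT1 -> gT2 -> V)
    (a : galg k gT1) (b : galg k gT2) :
  glin (fun x => glin (F x) b) a = glin (fun y => glin (F^~ y) a) b.
Proof.
rewrite /glin; under eq_bigr do rewrite scaler_sumr.
rewrite exchange_big; apply: eq_bigr => y _; rewrite scaler_sumr.
by apply: eq_bigr => x _; rewrite !scalerA mulrC.
Qed.

Lemma gmap_comp (f : gT1 -> gT2) (g : gT2 -> gT) (a : galg k gT1) :
  gmap g (gmap f a) = gmap (g \o f) a.
Proof. exact: glin_gmap. Qed.

Lemma eq_gmap (f f' : gT1 -> gT2) : f =1 f' -> @gmap k gT1 gT2 f =1 gmap f'.
Proof. by move=> ff' a; apply: eq_glin => x; rewrite ff'. Qed.
End PushProducts.

Lemma glin_mulr (k : fieldType) (gT : finGroupType) (A : algType k) (F : gT -> A) b a :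
  glin (fun g => F g * b) a = glin F a * b :> A.
Proof. by rewrite /glin mulr_suml; apply: eq_bigr => g _; rewrite scalerAl. Qed.
Lemma glin_mull (k : fieldType) (gT : finGroupType) (A : algType k) (F : gT -> A) b a :
  glin (fun g => b * F g) a = b * glin F a :> A.
Proof. by rewrite /glin mulr_sumr; apply: eq_bigr => g _; rewrite scalerAr. Qed.

Section Characters.
Variables (k : fieldType) (gT : finGroupType).
Implicit Types (psi : gT -> k) (a b : galg k gT).

Definition linear_char psi :=
  psi 1%g = 1 /\ {morph psi : x y / (x * y)%g >-> x * y}.

Definition aug psi : galg k gT -> k := @glin k gT k^o psi.
HB.instance Definition _ psi :=
  GRing.Linear.copy (aug psi : galg k gT -> k^o) (@glin k gT k^o psi).

Lemma augE psi a : aug psi a = \sum_g a g * psi g. Proof. by []. Qed.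
Lemma aug_gb psi g : aug psi (gb k g) = psi g.
Proof. exact: (@glin_gb k gT k^o). Qed.

(** The map (id (x) psi) Delta for the untwisted coproduct, an algebra automorphism when [psi] is a
    linear character. *)
Definition gtwist psi : galg k gT -> galg k gT := glin (fun g => psi g *: gb k g).
HB.instance Definition _ psi :=
  GRing.Linear.copy (gtwist psi) (glin (fun g => psi g *: gb k g)).
Lemma gtwist_gb psi g : gtwist psi (gb k g) = psi g *: gb k g.
Proof. exact: glin_gb. Qed.

Section Char.
Variable (psi : gT -> k).
Hypothesis psiP : linear_char psi.
Let psi1 := psiP.1.
Let psiM := psiP.2.

Lemma char_neq0 g : psi g != 0.
Proof.
apply/eqP=> pg; have /eqP := psiM g g^-1%g; rewrite mulgV psi1 pg mul0r.
by rewrite oner_eq0.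
Qed.
Lemma charV g : psi g^-1%g = (psi g)^-1.
Proof.
by apply: (mulfI (char_neq0 g)); rewrite -psiM mulgV psi1 divff ?char_neq0.
Qed.
Lemma augM : {morph aug psi : a b / a * b}.
Proof. exact: (@glin_mul k gT k^o). Qed.
Lemma aug1 : aug psi 1 = 1.
Proof. exact: (@glin1 k gT k^o). Qed.
Lemma gtwistM : {morph gtwist psi : a b / a * b}.
Proof.
by apply: glin_mul => x y; rewrite psiM gbM -scalerAl -scalerAr scalerA.
Qed.
Lemma gtwist1 : gtwist psi 1 = 1.
Proof. by apply: glin1; rewrite psi1 scale1r. Qed.
End Char.

Lemma eq_gtwist psi psi' : psi =1 psi' -> gtwist psi =1 gtwist psi'.
Proof. by move=> e a; apply: eq_glin => g; rewrite e. Qed.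
Lemma gtwist_comp psi psi' a :
  gtwist psi (gtwist psi' a) = gtwist (fun g => psi g * psi' g) a.
Proof.
by rewrite linear_glin; apply: eq_glin => g; rewrite linearZ /= gtwist_gb scalerA mulrC.
Qed.
Lemma gtwist_one a : gtwist (fun=> 1) a = a.
Proof. by rewrite -[RHS]glin_id; apply: eq_glin => g; rewrite scale1r. Qed.
Lemma linear_char1 : linear_char (fun=> 1).
Proof. by split=> // x y; rewrite mulr1. Qed.
Lemma linear_charM psi psi' : linear_char psi -> linear_char psi' ->
  linear_char (fun g => psi g * psi' g).
Proof.
move=> [p1 pM] [q1 qM]; split; first by rewrite p1 q1 mulr1.
by move=> x y; rewrite pM qM mulrACA.
Qed.
End Characters.

Lemma linear_char_comp (k : fieldType) (gT gT' : finGroupType) (psi : gT -> k) (f : gT' -> gT) :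
  f 1%g = 1%g -> {morph f : x y / (x * y)%g} ->
  linear_char psi -> linear_char (psi \o f).
Proof. by move=> f1 fM [p1 pM]; split=> [|x y] /=; rewrite ?f1 ?fM. Qed.

Section Antipode.
Variables (k : fieldType) (gT : finGroupType).
Implicit Types (a b : galg k gT).
Definition gS : galg k gT -> galg k gT := gmap (fun g => g^-1%g).
HB.instance Definition _ := GRing.Linear.copy gS (gmap (fun g : gT => g^-1%g)).
Lemma gantipodeE a : gantipode a = gS a.
Proof.
apply/ffunP=> g; rewrite gmapE ffunE (bigD1 g^-1%g) ?invgK //= big1 ?addr0 //.
by move=> h /andP[/eqP <-]; rewrite invgK eqxx.
Qed.
Lemma gS_gb g : gS (gb k g) = gb k g^-1%g. Proof. exact: gmap_gb. Qed.
Lemma gSM a b : gS (a * b) = gS b * gS a.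
Proof.
rewrite [RHS]gmap_mulE glin_exchange.
have idE (c : galg k gT) : gmap id c = c by exact: glin_id.
rewrite -{1}[a]idE -{1}[b]idE /gS [LHS]glin_gmapM; apply: eq_glin => x; apply: eq_glin => y; by rewrite invMg.
Qed.
Lemma gS1 : gS 1 = 1. Proof. by apply: gmap1; rewrite invg1. Qed.
Lemma gtwist_gS (psi : gT -> k) a : linear_char psi ->
  gtwist psi (gS a) = gS (gtwist (fun g => (psi g)^-1) a).
Proof.
move=> psiP; rewrite /gtwist glin_gmap linear_glin; apply: eq_glin => g /=.
by rewrite linearZ /= gS_gb charV.
Qed.
End Antipode.

Section TwistTheory.
Variables (k : fieldType) (gT : finGroupType).
Implicit Types (a b h x : galg k gT) (X Y : galg k (gT * gT)%type).

Definition cop : galg k gT -> galg k (gT * gT)%type := gmap (fun g => (g, g)).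
HB.instance Definition _ := GRing.Linear.copy cop (gmap (fun g : gT => (g, g))).
Definition inl1 : galg k gT -> galg k (gT * gT)%type := gmap (fun g => (g, 1%g)).
HB.instance Definition _ := GRing.Linear.copy inl1 (gmap (fun g : gT => (g, 1%g : gT))).
Definition inr1 : galg k gT -> galg k (gT * gT)%type := gmap (fun g => (1%g, g)).
HB.instance Definition _ := GRing.Linear.copy inr1 (gmap (fun g : gT => (1%g : gT, g))).

Lemma gcoprodE a : gcoprod a = cop a.
Proof.
apply/ffunP=> -[g h]; rewrite gmapE ffunE /=; case: eqP => [<-|gh].
  by rewrite (bigD1 g) //= big1 ?addr0 // => x /andP[/eqP[->]]; rewrite eqxx.
by rewrite big1 // => x /eqP[xg xh]; case: gh; rewrite -xg.
Qed.
Lemma copM : {morph cop : a b / a * b}. Proof. exact: gmapM. Qed.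
Lemma cop1 : cop 1 = 1. Proof. exact: gmap1. Qed.
Lemma inl1M : {morph inl1 : a b / a * b}.
Proof. by apply: gmapM => x y; congr pair; rewrite mulg1. Qed.
Lemma inr1M : {morph inr1 : a b / a * b}.
Proof. by apply: gmapM => x y; congr pair; rewrite mulg1. Qed.
Lemma inl11 : inl1 1 = 1. Proof. exact: gmap1. Qed.
Lemma inr11 : inr1 1 = 1. Proof. exact: gmap1. Qed.

Definition slice1 (psi : gT -> k) : galg k (gT * gT)%type -> galg k gT :=
  glin (fun p => psi p.1 *: gb k p.2).
HB.instance Definition _ psi :=
  GRing.Linear.copy (slice1 psi) (glin (fun p : gT * gT => psi p.1 *: gb k p.2)).
Definition slice2 (psi : gT -> k) : galg k (gT * gT)%type -> galg k gT :=
  glin (fun p => psi p.2 *: gb k p.1).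
HB.instance Definition _ psi :=
  GRing.Linear.copy (slice2 psi) (glin (fun p : gT * gT => psi p.2 *: gb k p.1)).

Lemma slice1M psi : linear_char psi -> {morph slice1 psi : X Y / X * Y}.
Proof.
by case=> _ pM; apply: glin_mul => x y; rewrite pM gbM -scalerAl -scalerAr scalerA.
Qed.
Lemma slice2M psi : linear_char psi -> {morph slice2 psi : X Y / X * Y}.
Proof.
by case=> _ pM; apply: glin_mul => x y; rewrite pM gbM -scalerAl -scalerAr scalerA.
Qed.
Lemma slice21 psi : linear_char psi -> slice2 psi 1 = 1.
Proof. by case=> p1 _; apply: glin1; rewrite p1 scale1r. Qed.

Variables (J K : galg k (gT * gT)%type).
Hypotheses (JK : J * K = 1) (KJ : K * J = 1).

Lemma ginvE (hT : finGroupType) (a b : galg k hT) : a * b = 1 -> b * a = 1 -> ginv a = b.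
Proof.
move=> ab ba; rewrite /ginv.
have [|e1 e2] := epsilon_spec (inhabits a)
  (fun b : galg k hT => gmul a b = gone k hT /\ gmul b a = gone k hT).
  by exists b.
rewrite -/galg; set c := epsilon _ _ in e1 e2 *.
by rewrite -[c]mulr1 -ab mulrA [c * a]e2 mul1r.
Qed.

(** An explicit inverse [K] replaces the [epsilon]-chosen [ginv J]. *)
Definition tco a : galg k (gT * gT)%type := K * (cop a * J).
Lemma tco_is_linear : linear tco.
Proof.
by move=> c a b; rewrite /tco linearP mulrDl -scalerAl mulrDr -scalerAr.
Qed.
HB.instance Definition _ :=
  GRing.isLinear.Build k (galg k gT) (galg k (gT * gT)%type) _ tco tco_is_linear.

Lemma tcomulE a : tcomul J a = tco a.
Proof. by rewrite /tcomul (ginvE JK KJ) gcoprodE. Qed.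

Hypothesis cocyc :
  gmap (fun p : gT * gT => ((p.1, p.1), p.2)) J * gmap (fun p => (p, 1%g)) J =
  gmap (fun p : gT * gT => ((p.1, p.2), p.2)) J * gmap (fun p => ((1%g, p.1), p.2)) J.
Hypotheses (counit1 : gmap snd J = 1) (counit2 : gmap fst J = 1).

Let jl psi := slice1 psi J.
Let jr psi := slice2 psi J.

Section CharCocycle.
Variables (psi : gT -> k).
Hypothesis psiP : linear_char psi.
Let psi1 := psiP.1.
Let psiM := psiP.2.

(** Evaluates [psi] on one leg of the twist equation: [f] selects the leg and [g] the two that
    remain. The third, first and second legs yield the three slice identities that follow. *)
Lemma cocycle_contract (f : (gT * gT) * gT -> gT) (g : (gT * gT) * gT -> gT * gT) :
  {morph f : x y / (x * y)%g} -> {morph g : x y / (x * y)%g} ->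
  let F q := psi (f q) *: gb k (g q) in
  glin (fun p => F ((p.1, p.1), p.2)) J * glin (fun p => F (p, 1%g)) J =
  glin (fun p => F ((p.1, p.2), p.2)) J * glin (fun p => F ((1%g, p.1), p.2)) J.
Proof.
move=> fM gM F.
have FM : {morph F : x y / (x * y)%g >-> x * y}.
  by move=> x y; rewrite /F fM gM psiM gbM -scalerAl -scalerAr scalerA.
by have := congr1 (glin F) cocyc; rewrite !(glin_mul FM) !glin_gmap.
Qed.

Lemma cop_slice2 : cop (jr psi) * J = gtwist (psi \o snd) J * inr1 (jr psi).
Proof.
have /= e := @cocycle_contract snd fst (fun _ _ => erefl) (fun _ _ => erefl).
rewrite /cop /inr1 /gmap ![glin _ (jr _)]linear_glin.
transitivity (glin (fun p => psi p.2 *: gb k (p.1, p.1)) J *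
    glin (fun p => psi 1%g *: gb k p) J).
  congr (_ * _); first by apply: eq_glin => p; rewrite linearZ /= glin_gb.
  by rewrite -[LHS]glin_id; apply: eq_glin => p; rewrite psi1 scale1r.
rewrite e; congr (_ * _); apply: eq_glin => -[x y] /=; by rewrite ?linearZ /= ?glin_gb.
Qed.

Lemma cop_slice1 : gtwist (psi \o fst) J * inl1 (jl psi) = cop (jl psi) * J.
Proof.
have /= e := @cocycle_contract (fun q => q.1.1) (fun q => (q.1.2, q.2))
   (fun _ _ => erefl) (fun _ _ => erefl).
rewrite /cop /inl1 /gmap ![glin _ (jl _)]linear_glin.
transitivity (glin (fun p => psi p.1 *: gb k (p.2, p.2)) J *
    glin (fun p => psi 1%g *: gb k (p.1, p.2)) J).
  rewrite -e; congr (_ * _); apply: eq_glin => -[x y] //=.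
  by rewrite linearZ /= glin_gb.
congr (_ * _); first by apply: eq_glin => p; rewrite linearZ /= glin_gb.
by rewrite -[RHS]glin_id; apply: eq_glin => -[x y]; rewrite psi1 scale1r.
Qed.

Lemma slice_middle : gtwist (psi \o fst) J * inl1 (jr psi) =
  gtwist (psi \o snd) J * inr1 (jl psi).
Proof.
have /= e := @cocycle_contract (fun q => q.1.2) (fun q => (q.1.1, q.2))
   (fun _ _ => erefl) (fun _ _ => erefl).
rewrite /inr1 /inl1 /gmap [glin _ (jl _)]linear_glin [glin _ (jr _)]linear_glin.
transitivity (glin (fun p => psi p.1 *: gb k (p.1, p.2)) J *
    glin (fun p => psi p.2 *: gb k (p.1, 1%g)) J).
  by congr (_ * _); apply: eq_glin => -[x y] //=; rewrite linearZ /= glin_gb.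
rewrite e; congr (_ * _); apply: eq_glin => -[x y] //=.
by rewrite linearZ /= glin_gb.
Qed.
End CharCocycle.

Definition tq : galg k gT := gmap (fun p : gT * gT => (p.1^-1 * p.2)%g) J.
Definition tw : galg k gT := gmap (fun p : gT * gT => (p.1 * p.2^-1)%g) K.

Lemma tQE : tQ J = tq.
Proof. by apply/ffunP=> g; rewrite gmapE ffunE. Qed.

Let gmapJK (gT' : finGroupType) (f : gT * gT -> gT') :
  f 1%g = 1%g -> {morph f : x y / (x * y)%g} -> gmap f J * gmap f K = 1.
Proof. by move=> f1 fM; rewrite -gmapM // JK gmap1. Qed.
Let gmapKJ (gT' : finGroupType) (f : gT * gT -> gT') :
  f 1%g = 1%g -> {morph f : x y / (x * y)%g} -> gmap f K * gmap f J = 1.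
Proof. by move=> f1 fM; rewrite -gmapM // KJ gmap1. Qed.

Lemma counit1K : gmap snd K = 1.
Proof. by rewrite -[LHS]mulr1 -{1}counit1 gmapKJ. Qed.
Lemma counit2K : gmap fst K = 1.
Proof. by rewrite -[LHS]mulr1 -{1}counit2 gmapKJ. Qed.

(** The twist equation is rearranged to (J (x) 1)(1 (x) K) = (Delta (x) id)(K) (id (x) Delta)(J) and
    contracted by x (x) y (x) z |-> S(x) y S(z). The left side becomes [tq * tw]; on the right a leg
    cancels in each factor, and the counit conditions give 1. *)
Lemma tq_tw : tq * tw = 1.
Proof.
have e : gmap (fun p => (p, 1%g)) J * gmap (fun p => ((1%g, p.1), p.2)) K =
    gmap (fun p : gT * gT => ((p.1, p.1), p.2)) K *
    gmap (fun p : gT * gT => ((p.1, p.2), p.2)) J.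
  have m : {morph (fun p : gT * gT => ((1%g : gT, p.1), p.2)) : x y / (x * y)%g}.
    by move=> x y; congr (_, _); congr (_, _); rewrite mulg1.
  rewrite -[RHS]mulr1 -(gmapJK _ m) // mulrA -(mulrA _ _ (gmap _ J)) -cocyc.
  by rewrite mulrA gmapKJ // mul1r.
have /= := congr1 (gmap (fun q : (gT * gT) * gT => q.1.1^-1 * q.1.2 * q.2^-1)%g) e.
rewrite /gmap !glin_gmapM /=.
rewrite gmap_mulE => e'; transitivity (glin (fun p => glin (fun q : gT * gT =>
    gb k ((p.1 * 1)^-1 * (p.2 * q.1) * (1 * q.2)^-1)%g) K) J).
  apply: eq_glin => p; apply: eq_glin => q; by rewrite mulg1 mul1g !mulgA.
rewrite e'.
transitivity (glin (fun p : gT * gT => gb k p.2^-1%g) K); last first.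
  by have := congr1 (@gS k gT) counit1K; rewrite gS1 /gS gmap_comp.
apply: eq_glin => p.
transitivity (glin (fun q : gT * gT => gb k q.1^-1%g * gb k p.2^-1%g) J).
  apply: eq_glin => q; rewrite -gbM; congr gb.
  by rewrite !invMg !mulgA mulgKV mulgK.
rewrite glin_mulr -[RHS]mul1r; congr (_ * _).
by have := congr1 (@gS k gT) counit2; rewrite gS1 /gS gmap_comp.
Qed.

(** The mirror argument, with contraction x (x) y (x) z |-> x S(y) z. *)
Lemma tw_tq : tw * tq = 1.
Proof.
have e : gmap (fun p => ((1%g, p.1), p.2)) J * gmap (fun p => (p, 1%g)) K =
    gmap (fun p : gT * gT => ((p.1, p.2), p.2)) K *
    gmap (fun p : gT * gT => ((p.1, p.1), p.2)) J.
  have m : {morph (fun p : gT * gT => (p, 1%g : gT)) : x y / (x * y)%g}.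
    by move=> x y; congr (_, _); rewrite mulg1.
  rewrite -[RHS]mulr1 -(gmapJK _ m) // mulrA -(mulrA _ _ (gmap _ J)) cocyc.
  by rewrite mulrA gmapKJ // mul1r.
have /= := congr1 (gmap (fun q : (gT * gT) * gT => q.1.1 * q.1.2^-1 * q.2)%g) e.
rewrite /gmap !glin_gmapM /=.
rewrite gmap_mulE glin_exchange => e'; transitivity (glin (fun p => glin (fun q : gT * gT =>
    gb k (1 * q.1 * (p.1 * q.2)^-1 * (p.2 * 1))%g) K) J).
  apply: eq_glin => p; apply: eq_glin => q.
  by rewrite mulg1 mul1g invMg !mulgA.
rewrite e'.
transitivity (glin (fun p : gT * gT => gb k p.1 * 1) K); last first.
  by rewrite glin_mulr mulr1; exact: counit2K.
apply: eq_glin => p.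
transitivity (glin (fun q : gT * gT => gb k p.1 * gb k q.2) J).
  apply: eq_glin => q; rewrite -gbM; congr gb.
  by rewrite !invMg !mulgA mulgK mulgKV.
by rewrite glin_mull; congr (_ * _).
Qed.

End TwistTheory.

Section SliceLemmas.
Variables (k : fieldType) (gT : finGroupType).
Implicit Types (psi : gT -> k) (a b h : galg k gT) (X : galg k (gT * gT)%type).

Lemma slice1_gb psi p : slice1 psi (gb k p) = psi p.1 *: gb k p.2.
Proof. exact: glin_gb. Qed.
Lemma slice2_gb psi p : slice2 psi (gb k p) = psi p.2 *: gb k p.1.
Proof. exact: glin_gb. Qed.
Lemma slice1_cop psi h : slice1 psi (cop h) = gtwist psi h.
Proof. exact: glin_gmap. Qed.
Lemma slice2_cop psi h : slice2 psi (cop h) = gtwist psi h.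
Proof. exact: glin_gmap. Qed.
Lemma slice1_inl1 psi h : slice1 psi (inl1 h) = aug psi h *: 1.
Proof.
rewrite /slice1 glin_gmap /aug /glin scaler_suml.
by apply: eq_bigr => g _; rewrite /= scalerA.
Qed.
Lemma slice2_inr1 psi h : slice2 psi (inr1 h) = aug psi h *: 1.
Proof.
rewrite /slice2 glin_gmap /aug /glin scaler_suml.
by apply: eq_bigr => g _; rewrite /= scalerA.
Qed.
Lemma slice1_inr1 psi h : psi 1%g = 1 -> slice1 psi (inr1 h) = h.
Proof.
move=> p1; rewrite /slice1 glin_gmap -[RHS]glin_id; apply: eq_glin => g /=.
by rewrite p1 scale1r.
Qed.
Lemma slice2_inl1 psi h : psi 1%g = 1 -> slice2 psi (inl1 h) = h.
Proof.
move=> p1; rewrite /slice2 glin_gmap -[RHS]glin_id; apply: eq_glin => g /=.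
by rewrite p1 scale1r.
Qed.
Lemma slice1_twist1 psi psi' X :
  slice1 psi (gtwist (psi' \o fst) X) = slice1 (fun g => psi g * psi' g) X.
Proof.
rewrite linear_glin; apply: eq_glin => p; rewrite linearZ /= slice1_gb scalerA.
by rewrite mulrC.
Qed.
Lemma slice2_twist2 psi psi' X :
  slice2 psi (gtwist (psi' \o snd) X) = slice2 (fun g => psi g * psi' g) X.
Proof.
rewrite linear_glin; apply: eq_glin => p; rewrite linearZ /= slice2_gb scalerA.
by rewrite mulrC.
Qed.
Lemma slice1_twist2 psi psi' X :
  slice1 psi (gtwist (psi' \o snd) X) = gtwist psi' (slice1 psi X).
Proof.
rewrite [LHS]linear_glin [RHS]linear_glin; apply: eq_glin => p.
by rewrite !linearZ /= slice1_gb gtwist_gb !scalerA mulrC.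
Qed.
Lemma eq_slice1 psi psi' : psi =1 psi' -> slice1 psi =1 slice1 psi'.
Proof. by move=> e X; apply: eq_glin => p; rewrite e. Qed.
Lemma eq_slice2 psi psi' : psi =1 psi' -> slice2 psi =1 slice2 psi'.
Proof. by move=> e X; apply: eq_glin => p; rewrite e. Qed.
Lemma slice1_one X : slice1 (fun=> 1) X = gmap snd X.
Proof. by apply: eq_glin => p; rewrite scale1r. Qed.
Lemma slice2_one X : slice2 (fun=> 1) X = gmap fst X.
Proof. by apply: eq_glin => p; rewrite scale1r. Qed.

Lemma pair_mul1 (x y : gT) : ((x, 1) * (1, y) = (x, y) :> gT * gT)%g.
Proof. by congr pair; rewrite /= ?mulg1 ?mul1g. Qed.
Lemma pair_mul2 (x y : gT) : ((1, y) * (x, 1) = (x, y) :> gT * gT)%g.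
Proof. by congr pair; rewrite /= ?mulg1 ?mul1g. Qed.
Lemma inlrC a b : inl1 a * inr1 b = inr1 b * inl1 a.
Proof.
rewrite !gmap_mulE glin_exchange; apply: eq_glin => x; apply: eq_glin => y.
by rewrite /= pair_mul1 pair_mul2.
Qed.

Lemma gtensE a b : gtens a b = inl1 a * inr1 b :> galg k (gT * gT)%type.
Proof.
apply/ffunP=> -[x y]; rewrite ffunE /= gmap_mulE galg_sum (bigD1 x) //= big1 ?addr0.
  rewrite galgZ galg_sum (bigD1 y) //= big1 ?addr0.
    by rewrite galgZ gbE pair_mul1 eqxx mulr1.
  move=> z zy; rewrite galgZ gbE pair_mul1 xpair_eqE (eq_sym y) (negPf zy).
  by rewrite andbF mulr0.
move=> z zx; rewrite galgZ galg_sum big1 ?mulr0 // => u _.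
by rewrite galgZ gbE pair_mul1 xpair_eqE (eq_sym x) (negPf zx) mulr0.
Qed.

Lemma gb_pair x y : gb k (x, y) = gtens (gb k x) (gb k y) :> galg k (gT * gT)%type.
Proof.
by rewrite gtensE /inl1 /inr1 !gmap_gb -gbM pair_mul1.
Qed.
End SliceLemmas.

Section TwistCharacters.
Variables (k : fieldType) (gT : finGroupType).
Implicit Types (psi : gT -> k) (a b h x : galg k gT) (X Y : galg k (gT * gT)%type).
Variables (J K : galg k (gT * gT)%type).

(** A twist with its inverse as data; the four legs of the twist equation are push-forwards, so
    linear functionals pass through them by [glin_gmap]. *)
Definition twist_pair :=
  [/\ J * K = 1, K * J = 1,
  gmap (fun p : gT * gT => ((p.1, p.1), p.2)) J * gmap (fun p => (p, 1%g)) J =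
  gmap (fun p : gT * gT => ((p.1, p.2), p.2)) J * gmap (fun p => ((1%g, p.1), p.2)) J,
  gmap snd J = 1 & gmap fst J = 1].

Hypothesis JP : twist_pair.
Let JK : J * K = 1. Proof. by case: JP. Qed.
Let KJ : K * J = 1. Proof. by case: JP. Qed.
Let cocyc : gmap (fun p : gT * gT => ((p.1, p.1), p.2)) J * gmap (fun p => (p, 1%g)) J =
  gmap (fun p : gT * gT => ((p.1, p.2), p.2)) J * gmap (fun p => ((1%g, p.1), p.2)) J.
Proof. by case: JP. Qed.
Let counit1 : gmap snd J = 1. Proof. by case: JP. Qed.
Let counit2 : gmap fst J = 1. Proof. by case: JP. Qed.

Definition jl psi := slice1 psi J.
Definition jr psi := slice2 psi J.
Definition jri psi := slice2 psi K.
(** The 2-cocycle that J induces on the group of linear characters of G. *)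
Definition wJ (psi psi' : gT -> k) : k := aug (fun p => psi p.1 * psi' p.2) J.

Lemma jr_jri psi : linear_char psi -> jr psi * jri psi = 1.
Proof. by move=> pP; rewrite -slice2M // JK slice21. Qed.
Lemma jri_jr psi : linear_char psi -> jri psi * jr psi = 1.
Proof. by move=> pP; rewrite -slice2M // KJ slice21. Qed.

Lemma aug_jr psi psi' : aug psi (jr psi') = wJ psi psi'.
Proof.
rewrite [LHS]linear_glin; apply: (@eq_glin k _ k^o) => p.
by rewrite linearZ /= aug_gb /GRing.scale /= mulrC.
Qed.
Lemma aug_jl psi psi' : aug psi (jl psi') = wJ psi' psi.
Proof.
rewrite [LHS]linear_glin; apply: (@eq_glin k _ k^o) => p.
by rewrite linearZ /= aug_gb /GRing.scale.
Qed.

Lemma wJ_neq0 psi psi' : linear_char psi -> linear_char psi' -> wJ psi psi' != 0.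
Proof.
move=> pP pP'; apply/eqP => w0; have := congr1 (aug psi) (jr_jri pP').
by rewrite augM // aug_jr w0 mul0r aug1 // => /eqP; rewrite eq_sym oner_eq0.
Qed.

Lemma jr_mul psi psi' : linear_char psi -> linear_char psi' ->
  gtwist psi (jr psi') * jr psi = wJ psi psi' *: jr (fun g => psi g * psi' g).
Proof.
move=> pP pP'; have := congr1 (slice2 psi) (cop_slice2 cocyc pP').
rewrite !slice2M // slice2_cop slice2_twist2 slice2_inr1 -[slice2 psi' J]/(jr _) aug_jr => ->.
by rewrite -scalerAr mulr1.
Qed.
Lemma jl_mul psi psi' : linear_char psi -> linear_char psi' ->
  gtwist psi (jl psi') * jl psi = wJ psi' psi *: jl (fun g => psi g * psi' g).
Proof.
move=> pP pP'; have := congr1 (slice1 psi) (cop_slice1 cocyc pP').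
rewrite !slice1M // slice1_cop slice1_twist1 slice1_inl1 -[slice1 psi' J]/(jl _) aug_jl => <-.
by rewrite -scalerAr mulr1.
Qed.
Lemma jlr_mul psi psi' : linear_char psi -> linear_char psi' ->
  gtwist psi (jr psi') * jl psi = gtwist psi' (jl psi) * jr psi'.
Proof.
move=> pP pP'; have := congr1 (slice1 psi) (cop_slice2 cocyc pP').
by rewrite !slice1M // slice1_cop slice1_twist2 slice1_inr1 //; case: pP.
Qed.

Definition tch psi := jri psi * jl psi.

(** Each of the three slice identities involves J with one leg twisted by [psi]; eliminating these
    twisted copies of J between them leaves the grouplike equation. *)
Lemma tch_grouplike psi : linear_char psi ->
  cop (tch psi) * J = J * (inl1 (tch psi) * inr1 (tch psi)).
Proof.
move=> pP.
have e1 : cop (jr psi) * J = gtwist (psi \o snd) J * inr1 (jr psi) := cop_slice2 cocyc pP.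
have e2 : gtwist (psi \o fst) J * inl1 (jl psi) = cop (jl psi) * J := cop_slice1 cocyc pP.
have e3 : gtwist (psi \o fst) J * inl1 (jr psi) =
    gtwist (psi \o snd) J * inr1 (jl psi) := slice_middle cocyc pP.
rewrite /tch copM -mulrA -e2.
have -> : gtwist (psi \o fst) J =
  cop (jr psi) * J * inr1 (jri psi) * inr1 (jl psi) * inl1 (jri psi).
  rewrite e1 -(mulrA _ (inr1 (jr psi))) -inr1M jr_jri // inr11 mulr1.
  by rewrite -e3 -(mulrA _ (inl1 (jr psi))) -inl1M jr_jri // inl11 mulr1.
rewrite !mulrA -copM jri_jr // cop1 mul1r -!mulrA; congr (_ * _).
by rewrite -inl1M mulrA -inr1M inlrC.
Qed.

(** Right slices and left slices multiply with the same scalar [wJ psi psi'], which cancels in the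
    quotient; [jlr_mul] exchanges the two kinds. *)
Lemma tch_mul psi psi' : linear_char psi -> linear_char psi' ->
  tch (fun g => psi g * psi' g) = tch psi * tch psi'.
Proof.
move=> pP pP'; have pQ := linear_charM pP pP'.
have e1 := jr_mul pP pP'; have e2 := jl_mul pP' pP; have e3 := jlr_mul pP pP'.
have w0 := wJ_neq0 pP pP'.
suff e : jr (fun g => psi g * psi' g) * (tch psi * tch psi') =
    jl (fun g => psi g * psi' g).
  by rewrite {1}/tch -e mulrA jri_jr // mul1r.
apply: (scalerI w0); rewrite scalerAl -e1.
rewrite -[jl _](eq_slice1 (fun g => mulrC (psi' g) (psi g))) -/(jl _) -e2 /tch.
rewrite !mulrA -(mulrA _ (jr psi)) jr_jri // mulr1 e3.
by rewrite -(mulrA _ (jr psi')) jr_jri // mulr1.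
Qed.

(** The alternating bicharacter of the cocycle [wJ]: it is 1 on the diagonal and is inverted when
    its arguments are exchanged. *)
Lemma aug_tch psi psi' : linear_char psi -> linear_char psi' ->
  aug psi' (tch psi) = wJ psi psi' / wJ psi' psi.
Proof.
move=> pP pP'; have w0 := wJ_neq0 pP' pP; rewrite augM // aug_jl mulrC; congr (_ * _).
apply: (mulfI w0); rewrite divff // -aug_jr -augM // jr_jri //; exact: aug1.
Qed.

Lemma eq_tch psi psi' : psi =1 psi' -> tch psi = tch psi'.
Proof. by move=> e; rewrite /tch /jri /jl (eq_slice1 e) (eq_slice2 e). Qed.

Lemma tch_one : tch (fun=> 1) = 1.
Proof. by rewrite /tch /jri /jl slice1_one slice2_one counit1 mulr1 (counit2K KJ). Qed.

Definition tant h := tw K * gS h * tq J.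

Lemma tantipodeE h : tantipode J h = tant h.
Proof.
rewrite /tantipode tQE (ginvE (tq_tw JK KJ cocyc counit1 counit2) (tw_tq JK KJ cocyc counit1 counit2)).
by rewrite gantipodeE /tant -mulrA.
Qed.

Definition adx x : galg k (gT * gT)%type -> galg k gT :=
  glin (fun p => gb k p.1 * x * tant (gb k p.2)).
HB.instance Definition _ x := GRing.Linear.copy (adx x)
  (glin (fun p : gT * gT => gb k p.1 * x * tant (gb k p.2))).

Lemma tadjE h x : tadj J h x = adx x (tco J K h).
Proof.
rewrite /tadj (tcomulE JK KJ); apply: eq_bigr => p _.
by rewrite tantipodeE.
Qed.

Lemma tant_is_linear : linear tant.
Proof.
by move=> c a b; rewrite /tant linearP mulrDr mulrDl -scalerAr -scalerAl.
Qed.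
HB.instance Definition _ := GRing.isLinear.Build k (galg k gT) (galg k gT) _ tant tant_is_linear.

Lemma adx_gtens x a b : adx x (gtens a b) = a * x * tant b.
Proof.
rewrite gtensE /adx glin_gmapM /=.
transitivity (glin (fun y => gb k y * (x * tant b)) a); last first.
  by rewrite glin_mulr glin_id mulrA.
apply: eq_glin => y; rewrite -[b in RHS]glin_id linear_glin mulrA -glin_mull.
by apply: eq_glin => z; rewrite mul1g mulg1.
Qed.

(** The antipode axiom h_1 S(h_2) = epsilon(h) in (kG)^J. *)
Lemma adx1_tco h : adx 1 (tco J K h) = aug (fun=> 1) h *: 1.
Proof.
have tqw := tq_tw JK KJ cocyc counit1 counit2.
have twq := tw_tq JK KJ cocyc counit1 counit2.
(* With [tw K] inserted in the middle, [M J] is m(id (x) S)(J K) = 1, and [adx 1] is [M] followed by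
   right multiplication by [tq J]. *)
pose M := glin (fun p : gT * gT => gb k p.1 * tw K * gb k p.2^-1%g).
have ME X Y : M (X * Y) = glin (fun p : gT * gT => gb k p.1 * M Y * gb k p.2^-1%g) X.
  rewrite /M glinM /glin; apply: eq_bigr => p _; congr (_ *: _).
  rewrite mulr_sumr mulr_suml; apply: eq_bigr => q _.
  by rewrite -scalerAr -scalerAl /= gbM invMg gbM !mulrA.
have MJ : M J = 1.
  have <- : gmap (fun p : gT * gT => (p.1 * p.2^-1)%g) (J * K) = 1.
    by rewrite JK gmap1 //= mul1g invg1.
  rewrite /gmap glinM /M /glin; apply: eq_bigr => p _; congr (_ *: _).
  rewrite mulr_sumr mulr_suml; apply: eq_bigr => q _.
  by rewrite -scalerAr -scalerAl -!gbM /= invMg !mulgA.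
have -> : adx 1 (tco J K h) = M (tco J K h) * tq J.
  rewrite /M /adx -glin_mulr; apply: eq_glin => p.
  by rewrite /tant gS_gb mulr1 !mulrA.
have MC : M (cop h * J) = aug (fun=> 1) h *: 1.
  rewrite ME MJ /aug /cop glin_gmap /glin scaler_suml; apply: eq_bigr => g _ /=.
  by rewrite mulr1 -gbM mulgV gb1 /GRing.scale /= mulr1.
rewrite /tco ME MC.
transitivity (glin (fun p : gT * gT => aug (fun=> 1) h *: gb k (p.1 * p.2^-1)%g) K * tq J).
  congr (_ * _); apply: eq_glin => p; by rewrite -scalerAr mulr1 -scalerAl -gbM.
by rewrite glin_scale -scalerAl [glin _ K * _]twq.
Qed.

End TwistCharacters.

Lemma is_twistP (k : fieldType) (gT : finGroupType) (J : {ffun (gT * gT)%type -> k}) :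
  is_twist J -> exists K, twist_pair J K.
Proof.
case=> -[K [JK KJ]] cocyc c1 c2; exists K; split=> //.
- have mulE (hT : finGroupType) (a b : galg k hT) : a * b = gmul a b by [].
  rewrite !mulE; transitivity (gmul (comul_id J) (tens_one J)); last rewrite cocyc.
  1,2: congr gmul; apply/ffunP=> -[[x y] z]; rewrite gmapE ffunE /=.
  + case: eqP => [<-|xy].
      rewrite (bigD1 (x, z)) //= big1 ?addr0 // => -[u v] /andP[/eqP[-> _ ->]].
      by rewrite eqxx.
    by rewrite big1 // => -[u v] /eqP[ux uy _]; case: xy; rewrite -ux.
  + rewrite ffunE /=; case: (eqVneq z 1%g) => [->|z1].
      rewrite mulr1 (bigD1 (x, y)) //= big1 ?addr0 // => p /andP[/eqP[<-]].
      by rewrite eqxx.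
    by rewrite mulr0 big1 // => p /eqP[_ /esym/eqP]; rewrite (negPf z1).
  + case: eqP => [<-|xy].
      rewrite (bigD1 (x, y)) //= big1 ?addr0 // => -[u v] /andP[/eqP[-> -> _]].
      by rewrite eqxx.
    by rewrite big1 // => -[u v] /eqP[_ ux uy]; case: xy; rewrite -ux.
  + case: (eqVneq x 1%g) => [->|x1].
      rewrite mul1r (bigD1 (y, z)) //= big1 ?addr0 // => -[u v] /andP[/eqP[-> ->]].
      by rewrite eqxx.
    by rewrite mul0r big1 // => p /eqP[/esym/eqP]; rewrite (negPf x1).
- rewrite -[RHS]c1; apply/ffunP=> h; rewrite gmapE ffunE.
  rewrite (reindex (fun g => (g, h))) /=; last first.
    by exists fst => // -[u v]; rewrite inE => /eqP /= ->.
  by apply: eq_bigl => g; rewrite eqxx.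
- rewrite -[RHS]c2; apply/ffunP=> h; rewrite gmapE ffunE.
  rewrite (reindex (fun g => (h, g))) /=; last first.
    by exists snd => // -[u v]; rewrite inE => /eqP /= ->.
  by apply: eq_bigl => g; rewrite eqxx.
Qed.

Section CentralSubgroup.
Variables (k : fieldType) (gT : finGroupType).
Variables (J K : galg k (gT * gT)%type).
Hypothesis JP : twist_pair J K.
Variable N : {group gT}.
Hypothesis NZ : (N \subset 'Z([set: gT]))%g.

Definition supported (a : galg k gT) := forall g, g \notin N -> a g = 0.

Lemma supported_expand a : supported a -> a = \sum_(g in N) a g *: gb k g.
Proof.
move=> aN; rewrite {1}[a]galg_expand (bigID (mem N)) /= [X in _ + X]big1 ?addr0 //.
by move=> g /aN ->; rewrite scale0r.
Qed.
Lemma supported_gb g : g \in N -> supported (gb k g).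
Proof. by move=> gN h hN; rewrite gbE; case: eqP => // hg; rewrite hg gN in hN. Qed.
Lemma supported_sum (I : Type) (r : seq I) (P : pred I) (F : I -> galg k gT) :
  (forall i, P i -> supported (F i)) -> supported (\sum_(i <- r | P i) F i).
Proof. by move=> FN g gN; rewrite galg_sum big1 // => i Pi; exact: FN. Qed.
Lemma supportedZ c a : supported a -> supported (c *: a).
Proof. by move=> aN g gN; rewrite galgZ aN // mulr0. Qed.
Lemma supportedM a b : supported a -> supported b -> supported (a * b).
Proof.
move=> aN bN; rewrite (supported_expand aN) (supported_expand bN) mulr_suml.
apply: supported_sum => g gN; rewrite mulr_sumr; apply: supported_sum => h hN.
rewrite -scalerAl -scalerAr -gbM; do 2!apply: supportedZ.
by apply: supported_gb; rewrite groupM.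
Qed.

Let comm_gN g : g \in N -> forall h, commute g h.
Proof.
by move=> gN h; have /centerP[_] := subsetP NZ _ gN; apply; rewrite inE.
Qed.

Lemma gb_central (hT : finGroupType) (g : hT) : (forall h, commute g h) ->
  forall a, gb k g * a = a * gb k g.
Proof.
move=> cg a; rewrite -[a]glin_id -glin_mull -glin_mulr; apply: eq_glin => h.
by rewrite -!gbM cg.
Qed.

(** A central g keeps Delta(g) = g (x) g and S(g) = g^-1 after twisting. It also moves out of h_1 g
    S(h_2), so by the antipode axiom the adjoint action on kN is through the counit. *)
Lemma central_not_simple : (N :!=: 1)%g -> (N :!=: [set: gT])%g -> ~ simple_twisted J.
Proof.
have [JK KJ cocyc c1 c2] := JP.
move=> N1 NG simpJ; have [||PC|PT] := simpJ supported.
- split; split.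
  + by move=> g _; rewrite ffunE.
  + by move=> a b aN bN g gN; rewrite ffunE aN ?bN ?addr0.
  + by move=> c a; exact: supportedZ.
  + by apply: supported_gb; exact: group1.
  + exact: supportedM.
  + move=> a aN; exists [seq (a g *: gb k g : {ffun gT -> k}, gb k g : {ffun gT -> k}) | g <- enum N].
    split.
      move=> u /mapP[g]; rewrite mem_enum => gN -> /=.
      by split; [apply: supportedZ|]; exact: supported_gb.
    rewrite big_map big_enum /= (tcomulE JK KJ) [in LHS](supported_expand aN) linear_sum.
    apply: eq_bigr => g gN; rewrite linearZ /= gtensE linearZ -scalerAl -gtensE -gb_pair.
    suff -> : tco J K (gb k g) = gb k (g, g) by [].
    rewrite /tco [cop _]gmap_gb gb_central; first by rewrite mulrA KJ mul1r.
    by move=> -[x y]; congr (_, _); exact: comm_gN.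
  + move=> a aN; rewrite (tantipodeE JP) (supported_expand aN) linear_sum.
    apply: supported_sum => g gN; rewrite linearZ; apply: supportedZ.
    rewrite -[X in supported X]/(tw K * gS (gb k g) * tq J) gS_gb -mulrA gb_central; last by apply: comm_gN; rewrite groupV.
    rewrite mulrA (tw_tq JK KJ cocyc c1 c2) mul1r; apply: supported_gb.
    by rewrite groupV.
- move=> h x xN; rewrite (tadjE JP) (supported_expand xN).
  have -> : adx J K (\sum_(g in N) x g *: gb k g) (tco J K h) =
      \sum_(g in N) (x g * aug (fun=> 1) h) *: gb k g.
    transitivity (\sum_(g in N) x g *: (gb k g * adx J K 1 (tco J K h))).
      under [RHS]eq_bigr do rewrite -glin_mull -glin_scale.
      rewrite -glin_sumF; apply: eq_glin => p; rewrite mulr_sumr mulr_suml.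
      apply: eq_bigr => g gN; rewrite -scalerAr -scalerAl mulr1 !mulrA.
      by rewrite (gb_central (comm_gN gN)).
    apply: eq_bigr => g _; rewrite (adx1_tco JP) -scalerAr mulr1 scalerA //.
  by apply: supported_sum => g gN; apply: supportedZ; exact: supported_gb.
- have /trivgPn[g gN g1] := N1.
  have [c e] := (PC (gb k g)).1 (supported_gb gN).
  have /ffunP/(_ g) := e; rewrite !ffunE eqxx (negPf g1) mulr0 => /eqP.
  by rewrite oner_eq0.
- move/negP: NG; apply; rewrite eqEsubset subsetT /=; apply/subsetP=> g _.
  apply/negPn/negP => gN; have := PT (gb k g) g gN; rewrite gbE eqxx => /eqP.
  by rewrite oner_eq0.
Qed.

End CentralSubgroup.

(** * Characters acting by twisted automorphisms *)

Section TensorMap.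
Variables (k : fieldType) (gT : finGroupType).
Implicit Types (f g : {linear galg k gT -> galg k gT}) (a b : galg k gT).

Lemma gtensM a b a' b' :
  (gtens a b : galg k (gT * gT)%type) * gtens a' b' = gtens (a * a') (b * b').
Proof.
by rewrite !gtensE inl1M inr1M !mulrA -(mulrA (inl1 a)) -inlrC mulrA.
Qed.

Definition tensmap f g : galg k (gT * gT)%type -> galg k (gT * gT)%type :=
  glin (fun p => gtens (f (gb k p.1)) (g (gb k p.2)) : galg k (gT * gT)%type).
HB.instance Definition _ f g := GRing.Linear.copy (tensmap f g)
  (glin (fun p => gtens (f (gb k p.1)) (g (gb k p.2)) : galg k (gT * gT)%type)).

Lemma glin_gtens (V : lmodType k) (F : gT * gT -> V) a b :
  glin F (gtens a b) = glin (fun x => glin (fun y => F (x, y)) b) a.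
Proof.
rewrite gtensE glin_gmapM; apply: eq_glin => x; apply: eq_glin => y.
by rewrite pair_mul1.
Qed.

Lemma tensmap_gtens f g a b : tensmap f g (gtens a b) = gtens (f a) (g b).
Proof.
rewrite /tensmap glin_gtens -[a in RHS]glin_id -[b in RHS]glin_id.
rewrite (linear_glin f) (linear_glin g) /=.
transitivity (glin (fun x => gtens (f (gb k x)) (glin (fun y => g (gb k y)) b)
    : galg k (gT * gT)%type) a).
  apply: eq_glin => x; rewrite /glin gtensE linear_sum mulr_sumr.
  by apply: eq_bigr => y _; rewrite gtensE linearZ scalerAr.
rewrite /glin [RHS]gtensE [in RHS]linear_sum mulr_suml.
by apply: eq_bigr => x _; rewrite gtensE linearZ scalerAl.
Qed.

Lemma tensmap_comp f g f' g' f2 g2 X :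
  f2 =1 f \o f' -> g2 =1 g \o g' ->
  tensmap f g (tensmap f' g' X) = tensmap f2 g2 X.
Proof.
move=> ef eg; rewrite [X in tensmap f g X]/tensmap (linear_glin (tensmap f g)).
apply: eq_glin => p; rewrite /= tensmap_gtens.
by congr gtens; rewrite ?ef ?eg.
Qed.

Lemma tensmap_id f g X : f =1 id -> g =1 id -> tensmap f g X = X.
Proof.
move=> ef eg; rewrite -[RHS]glin_id; apply: eq_glin => -[x y] /=.
by rewrite ef eg gb_pair.
Qed.
End TensorMap.

Section CentralCharacter.
Variables (k : fieldType) (gT : finGroupType).
Hypothesis two_neq0 : 2%:R != 0 :> k.
Variables (J K : galg k (gT * gT)%type).
Hypothesis JP : twist_pair J K.
Variable psi : gT -> k.
Hypothesis psiP : linear_char psi.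
Hypothesis psi_sq : forall g, psi g * psi g = 1.
Hypothesis slices_eq : jl J psi = jr J psi.

Let j := jr J psi.
Let ji := jri K psi.
Let jji : j * ji = 1. Proof. exact: jr_jri. Qed.
Let jij : ji * j = 1. Proof. exact: jri_jr. Qed.
Let JK : J * K = 1. Proof. by case: JP. Qed.
Let KJ : K * J = 1. Proof. by case: JP. Qed.
Let psi1 : psi 1%g = 1. Proof. by case: psiP. Qed.

(** This is (id (x) psi) Delta^J(h), the action on (kG)^J of [psi] as a grouplike element of the
    dual. The hypothesis [slices_eq] makes it equal to (psi (x) id) Delta^J(h) as well: [psi] is
    central in the dual. *)
Definition theta (h : galg k gT) : galg k gT := jri K psi * gtwist psi h * jr J psi.
Lemma theta_is_linear : linear theta.
Proof. by move=> c a b; rewrite /theta linearP mulrDr mulrDl -scalerAr -scalerAl. Qed.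
HB.instance Definition _ :=
  GRing.isLinear.Build k (galg k gT) (galg k gT) _ theta theta_is_linear.

Lemma thetaM : {morph theta : a b / a * b}.
Proof.
move=> a b; rewrite /theta gtwistM // !mulrA -(mulrA _ (jr J psi)) jji.
by rewrite mulr1.
Qed.
Lemma theta1 : theta 1 = 1.
Proof. by rewrite /theta gtwist1 // mulr1 jij. Qed.

Let c := wJ J psi psi.
Let c0 : c != 0. Proof. exact: wJ_neq0 JP _ _ psiP psiP. Qed.
Lemma jtwj : gtwist psi j * j = c *: 1.
Proof.
rewrite (jr_mul JP) // (_ : jr J _ = 1) //.
have [_ _ _ _ c2] := JP.
by rewrite /jr (eq_slice2 psi_sq) slice2_one.
Qed.
Lemma jitwji : ji * gtwist psi ji = c^-1 *: 1.
Proof.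
apply: (scalerI c0); rewrite scalerA divff // scale1r -[LHS]mulr1.
rewrite -scalerAl scalerAr -jtwj mulrA -(mulrA ji) -gtwistM //.
by rewrite (_ : ji * j = 1) // gtwist1 // mulr1.
Qed.
Lemma gtwist_sq h : gtwist psi (gtwist psi h) = h.
Proof. by rewrite gtwist_comp (eq_gtwist psi_sq) gtwist_one. Qed.
Lemma thetaK : involutive theta.
Proof.
move=> h; rewrite /theta !(gtwistM psiP) gtwist_sq -/j -/ji !mulrA jitwji.
by rewrite -!mulrA jtwj -scalerAl mul1r -scalerAr mulr1 scalerA mulVf // scale1r.
Qed.

Let idl : {linear galg k gT -> galg k gT} := idfun.

Lemma tensmap_theta2 Y :
  tensmap idl theta Y = inr1 ji * gtwist (psi \o snd) Y * inr1 j.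
Proof.
transitivity (glin (fun p => inr1 ji * gtwist (psi \o snd) (gb k p) * inr1 j) Y).
  apply: eq_glin => -[x y].
  rewrite /theta !gtwist_gb /= gb_pair !gtensE !inr1M gtwist_gb linearZ /=.
  rewrite -!(scalerAr, scalerAl) !mulrA; congr (_ *: _).
  by rewrite inlrC.
rewrite (glin_mulr (fun p => inr1 ji * gtwist (psi \o snd) (gb k p))) glin_mull.
by rewrite -(linear_glin (gtwist (psi \o snd))) glin_id.
Qed.
Lemma tensmap_theta1 Y :
  tensmap theta idl Y = inl1 ji * gtwist (psi \o fst) Y * inl1 j.
Proof.
transitivity (glin (fun p => inl1 ji * gtwist (psi \o fst) (gb k p) * inl1 j) Y).
  apply: eq_glin => -[x y].
  rewrite /theta !gtwist_gb /= gb_pair !gtensE !inl1M gtwist_gb linearZ /=.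
  rewrite -!(scalerAr, scalerAl) !mulrA; congr (_ *: _).
  by rewrite -!mulrA inlrC.
rewrite (glin_mulr (fun p => inl1 ji * gtwist (psi \o fst) (gb k p))) glin_mull.
by rewrite -(linear_glin (gtwist (psi \o fst))) glin_id.
Qed.

Lemma gtwist_snd_cop h : gtwist (psi \o snd) (cop h) = cop (gtwist psi h).
Proof.
rewrite /gtwist glin_gmap [RHS]linear_glin; apply: eq_glin => g.
by rewrite linearZ /= [cop _]gmap_gb.
Qed.
Lemma gtwist_fst_cop h : gtwist (psi \o fst) (cop h) = cop (gtwist psi h).
Proof.
rewrite /gtwist glin_gmap [RHS]linear_glin; apply: eq_glin => g.
by rewrite linearZ /= [cop _]gmap_gb.
Qed.

Let psi1P : linear_char (psi \o (fst : gT * gT -> gT)).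
Proof. exact: linear_char_comp. Qed.
Let psi2P : linear_char (psi \o (snd : gT * gT -> gT)).
Proof. exact: linear_char_comp. Qed.

Let cop2 : gtwist (psi \o snd) J = cop j * J * inr1 ji.
Proof.
have [_ _ cocyc _ _] := JP.
rewrite [cop j * J](cop_slice2 cocyc psiP) -[inr1 (slice2 _ _)]/(inr1 j).
by rewrite -mulrA -inr1M jji inr11 mulr1.
Qed.
Let cop1 : gtwist (psi \o fst) J = cop j * J * inl1 ji.
Proof.
have [_ _ cocyc _ _] := JP; have := cop_slice1 cocyc psiP.
rewrite -[slice1 _ _]/(jl J psi) slices_eq -/j => <-.
by rewrite -mulrA -inl1M jji inl11 mulr1.
Qed.
Let right_inv_unique (A : pzRingType) (x y z : A) : x * y = 1 -> z * x = 1 -> z = y.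
Proof. by move=> xy zx; rewrite -[z]mulr1 -xy mulrA zx mul1r. Qed.

Let cop2K : gtwist (psi \o snd) K = inr1 j * K * cop ji.
Proof.
apply: (right_inv_unique (x := gtwist (psi \o snd) J)); last first.
  by rewrite -gtwistM // KJ gtwist1.
rewrite cop2 !mulrA -(mulrA _ (inr1 ji)) -inr1M jij inr11 mulr1.
by rewrite -(mulrA _ J) JK mulr1 -copM jji [cop 1]gmap1.
Qed.
Let cop1K : gtwist (psi \o fst) K = inl1 j * K * cop ji.
Proof.
apply: (right_inv_unique (x := gtwist (psi \o fst) J)); last first.
  by rewrite -gtwistM // KJ gtwist1.
rewrite cop1 !mulrA -(mulrA _ (inl1 ji)) -inl1M jij inl11 mulr1.
by rewrite -(mulrA _ J) JK mulr1 -copM jji [cop _]gmap1.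
Qed.

Lemma tensmap_theta2_tco h : tensmap idl theta (tco J K h) = tco J K (theta h).
Proof.
rewrite tensmap_theta2 /tco !(gtwistM psi2P) gtwist_snd_cop cop2 cop2K.
rewrite !mulrA -inr1M jij inr11 mul1r -!mulrA -inr1M jij inr11 mulr1.
by rewrite /theta !copM !mulrA.
Qed.
(** Coassociativity alone handles the second leg; for the first leg [slices_eq] is used, through
    [cop1]. *)
Lemma tensmap_theta1_tco h : tensmap theta idl (tco J K h) = tco J K (theta h).
Proof.
rewrite tensmap_theta1 /tco !(gtwistM psi1P) gtwist_fst_cop cop1 cop1K.
rewrite !mulrA -inl1M jij inl11 mul1r -!mulrA -inl1M jij inl11 mulr1.
by rewrite /theta !copM !mulrA.
Qed.

Lemma gtwist_tq : gtwist psi (tq J) = c *: (gS ji * tq J * ji).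
Proof.
pose Lf (p : gT * gT) := gb k (p.1^-1 * p.2)%g.
pose L := glin Lf : galg k _ -> galg k gT.
have idE (X : galg k (gT * gT)%type) : gmap id X = X by exact: glin_id.
have Lcop a X : L (cop a * X) = aug (fun=> 1) a *: L X.
  rewrite -[in LHS](idE X) [LHS]glin_gmapM /aug /glin scaler_suml.
  apply: eq_bigr => g _; rewrite -[_ *: 1]/(_ * 1) mulr1; congr (_ *: _).
  by apply: eq_bigr => p _; rewrite /Lf /= invMg mulgA mulgKV.
have Lr X b : L (X * inr1 b) = L X * b.
  rewrite -[in LHS](idE X) [LHS]glin_gmapM -glin_mulr; apply: eq_glin => p.
  rewrite -[b in RHS]glin_id -glin_mull; apply: eq_glin => g.
  by rewrite /Lf -gbM /= mulg1 mulgA.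
have Ll X b : L (X * inl1 b) = gS b * L X.
  rewrite -[in LHS](idE X) [LHS]glin_gmapM -glin_mull; apply: eq_glin => p.
  rewrite -[b in RHS]glin_id (linear_glin (@gS k gT)) -glin_mulr; apply: eq_glin => g.
  by rewrite /Lf /= gS_gb -gbM /= mulg1 invMg mulgA.
(* As psi^2 = 1, the inverse on the first leg of [tq J] is not seen by [psi], and both legs of J are
   twisted by the same character. *)
have -> : gtwist psi (tq J) = L (gtwist (psi \o fst) (gtwist (psi \o snd) J)).
  rewrite gtwist_comp [LHS]linear_glin [RHS](linear_glin L); apply: eq_glin => p /=.
  rewrite gtwist_gb linearZ /= /L glin_gb psiP.2 charV //.
  congr (_ * _ *: _); apply: (mulfI (char_neq0 psiP p.1)).
  by rewrite divff ?char_neq0 // psi_sq.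
rewrite cop2 !(gtwistM psi1P) gtwist_fst_cop cop1.
have -> : gtwist (psi \o fst) (inr1 ji) = inr1 ji.
  rewrite /gtwist glin_gmap; apply: eq_glin => g /=; by rewrite psi1 scale1r.
rewrite !mulrA -copM jtwj Lr Ll -mulrA.
have -> : cop (c *: 1) = c *: (1 : galg k (gT * gT)%type).
  by rewrite linearZ; congr (_ *: _); exact: gmap1.
by rewrite -scalerAl mul1r /L linearZ /= -scalerAl -scalerAr mulrA.
Qed.

Lemma gtwist_tw : gtwist psi (tw K) = c^-1 *: (j * tw K * gS j).
Proof.
have [_ _ cocyc c1 c2] := JP.
have qw := tq_tw JK KJ cocyc c1 c2.
apply: (right_inv_unique (x := gtwist psi (tq J))); last first.
  by rewrite -gtwistM // (tw_tq JK KJ cocyc c1 c2) gtwist1.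
rewrite gtwist_tq -scalerAl -scalerAr scalerA mulfV // scale1r.
rewrite !mulrA -(mulrA _ ji) jij mulr1 -(mulrA _ (tq J)) qw mulr1.
by rewrite -gSM jji gS1.
Qed.

Lemma theta_tant h : theta (tant J K h) = tant J K (theta h).
Proof.
rewrite /theta /tant !(gtwistM psiP) gtwist_tq gtwist_tw gtwist_gS //.
rewrite -!(scalerAl, scalerAr) scalerA mulfV // scale1r.
have psiV : (fun g => (psi g)^-1) =1 psi.
  by move=> g; apply: (mulfI (char_neq0 psiP g)); rewrite divff ?char_neq0 // psi_sq.
rewrite (eq_gtwist psiV) !gSM !mulrA jij mul1r -!mulrA jij mulr1.
by rewrite -/ji -/j !mulrA.
Qed.

Lemma theta_adx x X : theta (adx J K x X) = adx J K (theta x) (tensmap theta theta X).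
Proof.
rewrite [LHS]linear_glin [RHS]linear_glin; apply: eq_glin => p.
by rewrite /= adx_gtens -theta_tant -!thetaM.
Qed.

(** The fixed points of the involutive algebra automorphism [theta] form a normal Hopf subalgebra.
    It misses [g0], because epsilon(theta h) = psi(h), and [g1] shows that it is larger than k. *)
Lemma central_character_not_simple g0 g1 :
  psi g0 != 1 -> psi g1 = 1 -> g1 != 1%g -> ~ simple_twisted J.
Proof.
move=> psi_g0 psi_g1 g1n1 simpJ.
pose P (h : {ffun gT -> k}) := theta h = h.
have ttE h : tensmap theta theta (tco J K h) = tco J K h.
  rewrite -[LHS](@tensmap_comp _ _ theta idl idl theta) //.
  by rewrite tensmap_theta2_tco tensmap_theta1_tco thetaK.
have half (V : lmodType k) (v : V) : 2%:R^-1 *: (v + v) = v.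
  by rewrite -mulr2n -scaler_nat scalerA mulVf // scale1r.
(* [pr (x) pr] averages four maps built from [id] and [theta], each of which fixes Delta^J(h) when h
   is fixed; this writes Delta^J(h) with both legs in P. *)
pose pr (h : galg k gT) : galg k gT := 2%:R^-1 *: (h + theta h).
have prP h : P (pr h).
  by rewrite /P /pr linearZ linearD /= thetaK addrC.
have prE h : P h -> tco J K h =
    glin (fun p => gtens (pr (gb k p.1)) (pr (gb k p.2)) : galg k (gT * gT)%type) (tco J K h).
  move=> Ph; have Ph' : theta h = h by [].
  transitivity (2%:R^-1 *: (2%:R^-1 *: (tensmap idl idl (tco J K h) +
        tensmap theta idl (tco J K h)) +
      2%:R^-1 *: (tensmap idl theta (tco J K h) +
        tensmap theta theta (tco J K h))) : galg k (gT * gT)%type).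
    by rewrite tensmap_theta1_tco tensmap_theta2_tco ttE Ph' tensmap_id // !half.
  rewrite -!glinD -!glin_scale -glinD -glin_scale; apply: eq_glin => p.
  rewrite /pr !gtensE [in RHS]linearZ [inr1 (_ *: _)]linearZ /= [inl1 (_ + _)]linearD [inr1 (_ + _)]linearD /=.
  rewrite -scalerAl -scalerAr.
  by rewrite mulrDl !mulrDr !scalerDr !addrA; congr (_ + _); rewrite addrAC.
have aug_theta h : aug (fun=> 1) (theta h) = aug psi h.
  have o1 := linear_char1 k gT.
  rewrite /theta !augM // mulrAC -augM // jij aug1 // mul1r.
  rewrite /gtwist linear_glin; apply: (@eq_glin k _ k^o) => g.
  by rewrite linearZ /= aug_gb /GRing.scale /= mulr1.
have [||PC|PT] := simpJ P.
- split; split.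
  + exact: linear0.
  + by move=> a b Pa Pb; rewrite /P linearD /= Pa Pb.
  + by move=> d a Pa; rewrite /P -[gscale d a]/(d *: (a : galg k gT)) linearZ /= Pa.
  + exact: theta1.
  + by move=> a b Pa Pb; rewrite /P -[gmul a b]/((a : galg k gT) * b) thetaM Pa Pb.
  + move=> a Pa; pose X := tco J K a.
    exists [seq (X p *: pr (gb k p.1) : {ffun gT -> k}, pr (gb k p.2) : {ffun gT -> k})
           | p <- index_enum (gT * gT)%type].
    split.
      move=> u /mapP[p _ ->] /=; split; last exact: prP.
      by rewrite /P linearZ /= prP.
    rewrite big_map (tcomulE JK KJ) [LHS](prE a Pa); apply: eq_bigr => p _.
    by rewrite [RHS]gtensE linearZ /= -scalerAl -gtensE.
  + by move=> a Pa; rewrite /P (tantipodeE JP) theta_tant Pa.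
- by move=> h x Px; rewrite /P (tadjE JP) theta_adx ttE Px.
(* If all fixed points were scalars, then theta(g1) = d - g1 with d = 2 by the counit. As g1^2 +
   theta(g1)^2 is also a scalar, its coefficient -2d at [g1] would vanish. *)
- have scal h : exists d, h + theta h = d *: (1 : galg k gT).
    apply/(PC (h + theta h)).1; by rewrite /P linearD /= thetaK addrC.
  have [d e1] := scal (gb k g1); have [d2 e2] := scal (gb k (g1 * g1)%g).
  have th : theta (gb k g1) = d *: 1 - gb k g1 by rewrite -e1 addrC addKr.
  move: e2; rewrite gbM thetaM th => e2.
  have d0 : d != 0.
    apply: contra_neq two_neq0 => d0; have := congr1 (aug (fun=> 1)) e1.
    rewrite d0 scale0r linear0 linearD /= aug_theta !aug_gb psi_g1 => <-.
    by rewrite mulr2n.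
  have gn : (g1 == g1 * g1)%g = false.
    by rewrite -{1}[g1]mulg1 (inj_eq (mulgI g1)) eq_sym; exact: negPf.
  have := congr1 (fun h : galg k gT => h g1) e2.
  have -> : (d *: 1 - gb k g1) * (d *: 1 - gb k g1) =
      (d * d) *: 1 - (2%:R * d) *: gb k g1 + gb k (g1 * g1)%g.
    rewrite mulrBl !mulrBr -!scalerAl !mul1r -scalerAr mulr1 -gbM scalerA opprB.
    by rewrite addrA addrAC -[X in X + _]addrA -opprD -scalerDl -mulr2n mulr_natl.
  rewrite -gbM !galgD !galgZ -gb1 !gbE (negPf g1n1) gn !mulr0 add0r addr0.
  rewrite ffunE galgZ gbE eqxx mulr1 sub0r => /eqP; rewrite oppr_eq0 mulf_eq0.
  by rewrite (negPf two_neq0) (negPf d0).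
- have := congr1 (aug (fun=> 1)) (PT (gb k g0)); rewrite aug_theta !aug_gb => /eqP.
  by rewrite (negPf psi_g0).
Qed.

End CentralCharacter.

(** * Traces of idempotents and grouplike involutions *)

Lemma mxtrace_idem (k : fieldType) n (E : 'M[k]_n) : E *m E = E -> \tr E = (\rank E)%:R.
Proof.
move=> EE; rewrite -[X in \tr X](mulmx_base E) mxtrace_mulC.
suff -> : row_base E *m col_base E = 1%:M by rewrite mxtrace1.
have /row_freeP[B bB] := row_base_free E.
have /row_fullP[C cC] := col_base_full E.
move: (col_base E) (row_base E) (mulmx_base E) bB cC => U V UV bB cC.
have : C *m (U *m V *m (U *m V)) *m B = C *m (U *m V) *m B by rewrite UV EE.
by rewrite !mulmxA cC mul1mx -!mulmxA bB !mulmx1.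
Qed.

Lemma natr_inj_char0 (k : fieldType) : [pchar k] =i pred0 ->
  injective (fun n : nat => n%:R : k).
Proof.
move=> /pcharf0P char0 m n /=; wlog le_mn : m n / (m <= n)%N.
  by move=> IH e; case/orP: (leq_total m n) => /IH // ->.
move=> /eqP e; apply/eqP; rewrite eqn_leq le_mn /= -subn_eq0 -char0 natrB //.
by rewrite subr_eq0 eq_sym.
Qed.

Section Traces.
Variables (k : fieldType) (hT : finGroupType) (n : nat) (F : hT -> 'M[k]_n).
Hypothesis FM : forall x y, F (x * y)%g = F x *m F y.

Lemma glin_mulmx (a b : galg k hT) : glin F (a * b) = glin F a *m glin F b.
Proof.
rewrite glinM {2}/glin mulmx_suml; apply: eq_bigr => g _.
rewrite -scalemxAl; congr (_ *: _); rewrite mulmx_sumr.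
by apply: eq_bigr => h _; rewrite FM scalemxAr.
Qed.

Lemma trace_glin (a : galg k hT) : \tr (glin F a) = aug (fun x => \tr (F x)) a.
Proof. by rewrite linear_sum; apply: eq_bigr => g _; rewrite linearZ. Qed.

Lemma trace_idem (f : galg k hT) : f * f = f ->
  aug (fun x => \tr (F x)) f = (\rank (glin F f))%:R.
Proof. by move=> ff; rewrite -trace_glin mxtrace_idem // -glin_mulmx ff. Qed.
End Traces.

Section BiregularRepresentation.
Variables (k : fieldType) (gT : finGroupType).

(** Left and right multiplications on kG as one representation of G x G. Applying an idempotent of
    kQ on the right cuts out k[G/Q], so a single trace formula serves kG and k[G/Q]. *)
Definition bireg (p : gT * gT) : 'M[k]_#|gT| :=
  \matrix_(i, j) (enum_val i == p.1 * enum_val j * p.2^-1)%g%:R.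

Lemma biregM x y : bireg (x * y)%g = bireg x *m bireg y.
Proof.
apply/matrixP=> i j; rewrite !mxE (bigD1 (enum_rank (y.1 * enum_val j * y.2^-1)%g)) //=.
rewrite !mxE enum_rankK eqxx mulr1 big1 ?addr0 => [|l li].
  by congr (_ == _)%:R; rewrite /= invMg !mulgA.
rewrite !mxE; case: (enum_val l =P _) => [e|_]; last by rewrite mulr0.
by rewrite -e enum_valK eqxx in li.
Qed.

Definition nfix (p : gT * gT) : nat := #|[pred x | x == p.1 * x * p.2^-1]%g|.

Lemma bireg_trace p : \tr (bireg p) = (nfix p)%:R.
Proof.
rewrite /mxtrace /nfix -[in RHS]sum1_card natr_sum [RHS]big_mkcond /=.
rewrite [RHS](reindex (@enum_val gT predT)) /=; last exact: (onW_bij _ (@enum_val_bij gT)).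
by apply: eq_bigr => i _; rewrite mxE inE; case: eqP.
Qed.

Lemma bireg_inj (a : galg k gT) : glin bireg (gtens a (1 : galg k gT)) = 0 -> a = 0.
Proof.
move=> e; apply/ffunP=> g; rewrite ffunE.
have /matrixP/(_ (enum_rank g) (enum_rank 1%g)) := e; rewrite mxE => <-.
rewrite glin_gtens summxE (bigD1 g) //= big1 ?addr0 => [|x xg].
  by rewrite -gb1 glin_gb !mxE /= !enum_rankK mulg1 invg1 mulg1 eqxx mulr1.
by rewrite -gb1 glin_gb !mxE /= !enum_rankK mulg1 invg1 mulg1 eq_sym (negPf xg) mulr0.
Qed.
End BiregularRepresentation.

Lemma aug_class (k : fieldType) (gT : finGroupType) (f : gT -> k) (a b : galg k gT) :
  (forall x y, f (x * y)%g = f (y * x)%g) -> aug f (a * b) = aug f (b * a).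
Proof.
move=> fC; transitivity (\sum_x a x * aug (fun y => f (x * y)%g) b).
  exact: (@glinM k gT k^o).
rewrite [RHS](@glinMr k gT k^o); apply: eq_bigr => x _.
by congr (_ * _); apply: (@eq_glin k _ k^o) => y.
Qed.

Section GrouplikeInvolution.
Variables (k : fieldType) (char0 : [pchar k] =i pred0) (gT : finGroupType).
Variables (J K : galg k (gT * gT)%type).
Hypotheses (JK : J * K = 1) (KJ : K * J = 1).
Variables (P Q : {group gT}) (m : nat) (chars : 'I_m -> gT -> k).
Hypotheses (odd_index : odd (#|gT| %/ #|Q|)) (PQ : (P :&: Q = 1)%g)
  (Pnormal : (P <| [set: gT])%g).
Hypothesis chars_lin : forall i, linear_char (chars i).
Hypothesis chars_sum : forall g,
  \sum_i chars i g = if g \in P then #|Q|%:R else 0.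
Variable t : galg k gT.
Hypotheses (tJ : cop t * J = J * (inl1 t * inr1 t)) (tt : t * t = 1).
Hypothesis t_chars : forall i, aug (chars i) t = 1.

Let natr_eq0 n : (n%:R == 0 :> k) = (n == 0%N).
Proof. by move: n; apply/pcharf0P. Qed.

Let Q0 : #|Q|%:R != 0 :> k. Proof. by rewrite natr_eq0 -lt0n cardG_gt0. Qed.

Definition avg : galg k gT := #|Q|%:R^-1 *: \sum_(q in Q) gb k q.

Lemma avg_idem : avg * avg = avg.
Proof.
rewrite {1}/avg -scalerAl mulr_suml; transitivity (#|Q|%:R^-1 *: (#|Q|%:R *: avg)).
  congr (_ *: _); rewrite scaler_nat -sumr_const; apply: eq_bigr => q qQ.
  rewrite /avg -scalerAr; congr (_ *: _); rewrite mulr_sumr.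
  rewrite [RHS](reindex_inj (mulgI q)) /=; apply: eq_big => [x|x _].
    by rewrite groupMl.
  by rewrite gbM.
by rewrite scalerA mulVf // scale1r.
Qed.

(* the trace of g on k[G/Q] *)
Definition quotient_char (g : gT) : k := #|Q|%:R^-1 * \sum_(q in Q) (nfix (g, q))%:R.

Lemma quotient_charE a :
  aug quotient_char a = aug (fun p => \tr (bireg k p)) (gtens a avg).
Proof.
rewrite [RHS]/aug glin_gtens; apply: (@eq_glin k _ k^o) => g.
rewrite /avg linearZ linear_sum /= /quotient_char; congr (_ * _).
by apply: eq_bigr => q _; rewrite (@glin_gb k gT k^o) bireg_trace.
Qed.

Lemma nfix_class (x y q : gT) : nfix (x * y, q)%g = nfix (y * x, q)%g.
Proof.
rewrite /nfix /= -(card_imset [pred z | z == (x * y) * z * q^-1]%g (mulgI y)).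
apply: eq_card => z; apply/imsetP/idP => [[u]|]; rewrite !inE /=.
  by move=> /eqP e ->; rewrite {1}e !mulgA.
move=> /eqP e; exists (y^-1 * z)%g; last by rewrite mulKVg.
by rewrite inE /= {1}e !mulgA mulVg mul1g mulgK.
Qed.

(** The regular character of G/P vanishes off P, while a nontrivial element of P fixes no coset of
    Q, its conjugates lying in P and P meeting Q trivially. The product is therefore the regular
    character of G. *)
Lemma quotient_char_sum g :
  quotient_char g * \sum_i chars i g = #|gT|%:R * (g == 1%g)%:R.
Proof.
rewrite chars_sum; case: (boolP (g \in P)) => gP; last first.
  rewrite mulr0; case: eqP => [g1|]; last by rewrite mulr0.
  by rewrite g1 group1 in gP.
rewrite /quotient_char mulrAC mulVf // mul1r.
rewrite (bigD1 1%g) //= big1 ?addr0 => [|q /andP[qQ q1]].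
  rewrite -natrM; congr _%:R; rewrite /nfix /= invg1.
  case: (eqVneq g 1%g) => [->|g1].
    by rewrite muln1; apply: eq_card => x; rewrite !inE mulg1 mul1g eqxx.
  rewrite muln0; apply: eq_card0 => x; rewrite !inE mulg1.
  by rewrite -{1}[x]mul1g (inj_eq (mulIg x)) eq_sym (negPf g1).
apply/eqP; rewrite natr_eq0; apply/eqP; apply: eq_card0 => x; rewrite !inE /=.
apply/negP => /eqP e; have qE : q = (g ^ x)%g.
  by apply: (mulgI x); rewrite conjgE mulKVg {1}e mulgKV.
have : q \in P :&: Q by rewrite inE qQ andbT qE memJ_norm // (subsetP (normal_norm Pnormal)) ?inE.
by rewrite PQ inE (negPf q1).
Qed.

Let half2 : 2%:R != 0 :> k. Proof. by rewrite natr_eq0. Qed.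

Lemma involution_idem : (2%:R^-1 *: (1 - t)) * (2%:R^-1 *: (1 - t)) = 2%:R^-1 *: (1 - t).
Proof.
rewrite -scalerAl -scalerAr; congr (_ *: _).
have -> : (1 - t) * (1 - t) = 2%:R *: (1 - t).
  by rewrite mulrBl mul1r mulrBr mulr1 tt opprB scaler_nat mulr2n.
by rewrite scalerA mulVf // scale1r.
Qed.

Lemma gtens_natr_mult (a b : galg k gT) : a * a = a -> b * b = b ->
  exists r : nat, aug (fun p => \tr (bireg k p)) (gtens a b) = r%:R /\
    (r = 0%N -> glin (@bireg k gT) (gtens a b) = 0).
Proof.
move=> aa bb; exists (\rank (glin (@bireg k gT) (gtens a b))); split.
  by apply: (trace_idem (@biregM k gT)); rewrite gtensM aa bb.
by move/eqP; rewrite mxrank_eq0 => /eqP.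
Qed.

(** If the trace of t on k[G/Q] were 0, the idempotent (1 - t)/2 would have trace half the odd index
    of Q, which is not an integer. *)
Lemma quotient_char_t_neq0 : aug quotient_char t != 0.
Proof.
have [r [er _]] := gtens_natr_mult involution_idem avg_idem.
have e1 : aug quotient_char 1 = (#|gT| %/ #|Q|)%:R.
  rewrite -gb1 aug_gb /quotient_char (bigD1 1%g) //= big1 ?addr0.
    apply: (mulfI Q0); rewrite mulVKf // -natrM mulnC divnK; last first.
      by rewrite -cardsT cardSg ?subsetT.
    by congr _%:R; apply: eq_card => x; rewrite !inE invg1 mulg1 mul1g eqxx.
  move=> q /andP[qQ q1]; apply/eqP; rewrite natr_eq0; apply/eqP; apply: eq_card0 => x.
  rewrite !inE /= mul1g -{1}[x]mulg1 (inj_eq (mulgI x)) eq_sym.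
  by rewrite -(inj_eq invg_inj) invgK invg1 (negPf q1).
move: er; rewrite -quotient_charE linearZ linearB /= e1 => er.
apply/eqP => e0; move: er; rewrite e0 subr0 => er.
have : (#|gT| %/ #|Q|)%:R = (2 * r)%:R :> k.
  by rewrite natrM -er /GRing.scale /= mulrA mulfV // mul1r.
by move/(natr_inj_char0 char0) => e; move: odd_index; rewrite e oddM.
Qed.

(** Slicing the grouplike equation by [psi] shows that [gtwist psi t] is conjugate to t, and
    [quotient_char] is a class function. *)
Lemma quotient_char_twist (psi : gT -> k) : linear_char psi -> aug psi t = 1 ->
  aug quotient_char (gtwist psi t) = aug quotient_char t.
Proof.
move=> psiP t1; have psi1 := psiP.1.
have := congr1 (slice2 psi) tJ.
rewrite !slice2M // slice2_cop slice2_inl1 // slice2_inr1 t1 scale1r mulr1 => e.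
have jk : slice2 psi J * slice2 psi K = 1 by rewrite -slice2M // JK slice21.
have kj : slice2 psi K * slice2 psi J = 1 by rewrite -slice2M // KJ slice21.
have -> : gtwist psi t = slice2 psi J * (t * slice2 psi K).
  by rewrite mulrA -e -mulrA jk mulr1.
rewrite aug_class; first by rewrite -mulrA kj mulr1.
move=> x y; rewrite /quotient_char; congr (_ * _); apply: eq_bigr => q _.
by rewrite nfix_class.
Qed.

(** The coefficient at 1 is a trace form on k[G x G]. Delta(t) and t (x) t are conjugate by J, so
    t(1) = t(1)^2. *)
Lemma grouplike_coef1 : t 1%g = 0 \/ t 1%g = 1.
Proof.
pose tau (p : gT * gT) : k := (p == 1%g)%:R.
have tauC x y : tau (x * y)%g = tau (y * x)%g.
  rewrite /tau; congr (nat_of_bool _)%:R; apply/eqP/eqP => /eqP.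
    by rewrite -eq_invg_mul => /eqP <-; rewrite mulVg.
  by rewrite -eq_invg_mul => /eqP <-; rewrite mulVg.
have coef1 (a : galg k gT) : aug (fun g => (g == 1%g)%:R) a = a 1%g.
  rewrite augE (bigD1 1%g) //= eqxx mulr1 big1 ?addr0 // => g /negPf ->.
  by rewrite mulr0.
have e : t 1%g = t 1%g * t 1%g.
  transitivity (aug tau (cop t)).
    rewrite -coef1 [RHS]glin_gmap; apply: (@eq_glin k _ k^o) => g /=.
    by rewrite /tau xpair_eqE andbb.
  have -> : cop t = J * (inl1 t * inr1 t * K) by rewrite mulrA -tJ -mulrA JK mulr1.
  rewrite aug_class // -(mulrA (inl1 t * inr1 t)) KJ mulr1 -gtensE /aug glin_gtens.
  transitivity (aug (fun x => (x == 1%g)%:R * t 1%g) t).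
    apply: (@eq_glin k _ k^o) => x; rewrite -coef1 augE mulr_sumr; apply: eq_bigr => y _.
    by rewrite /tau xpair_eqE /GRing.scale /= mulrCA -natrM mulnb.
  by rewrite -coef1 augE mulr_suml; apply: eq_bigr => x _; rewrite mulrA.
case: (eqVneq (t 1%g) 0) => [|t0]; [by left|right].
by apply: (mulfI t0); rewrite -e mulr1.
Qed.

(** Summing [quotient_char_twist] over the characters of G/P and using [quotient_char_sum] gives |Q|
    times the trace of t on k[G/Q] as |G| t(1). Hence t(1) is nonzero, so it is 1; the idempotent (1
    - t)/2 then has trace 0 in the regular representation and vanishes. *)
Lemma grouplike_involution_trivial : t = 1.
Proof.
have t1 : t 1%g = 1.
  have [t0|//] := grouplike_coef1.
  have mQ : m%:R = #|Q|%:R :> k.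
    have := chars_sum 1%g; rewrite group1 => <-.
    rewrite -[LHS]mulr1 mulr_natl -[in LHS](card_ord m) -sumr_const.
    by apply: eq_bigr => i _; rewrite (chars_lin i).1.
  have : m%:R * aug quotient_char t = #|gT|%:R * t 1%g.
    rewrite mulr_natl -[in LHS](card_ord m) -sumr_const.
    transitivity (\sum_(i in 'I_m) \sum_g t g * (quotient_char g * chars i g)).
      apply: eq_bigr => i _; rewrite -(quotient_char_twist (chars_lin i) (t_chars i)).
      rewrite [LHS]linear_glin; apply: eq_bigr => g _.
      by rewrite linearZ /= aug_gb /GRing.scale /= [chars _ _ * _]mulrC.
    have sg g : \sum_(i in 'I_m) t g * (quotient_char g * chars i g) =
        t g * (#|gT|%:R * (g == 1%g)%:R).
      rewrite -quotient_char_sum mulrA mulr_sumr.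
      by apply: eq_bigr => i _; rewrite mulrA.
    rewrite exchange_big /= (eq_bigr _ (fun g _ => sg g)) (bigD1 1%g) //= big1 ?addr0.
      by rewrite eqxx mulr1 mulrC.
    by move=> g /negPf ->; rewrite !mulr0.
  rewrite t0 mulr0 mQ => /eqP; rewrite mulf_eq0 (negPf Q0).
  by rewrite (negPf quotient_char_t_neq0).
have [r [er r0]] := @gtens_natr_mult _ 1 involution_idem (mulr1 1).
have : r = 0%N.
  apply/eqP; rewrite -natr_eq0 -er augE big1 // => -[x y] _.
  rewrite bireg_trace [gtens _ _ _]ffunE /= [X in _ * X * _](_ : _ = (y == 1%g)%:R); last exact: ffunE.
  case: (eqVneq y 1%g) => [->|]; last by rewrite mulr0 mul0r.
  rewrite mulr1; case: (eqVneq x 1%g) => [->|x1].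
    by rewrite galgZ galgD -gb1 gbE eqxx ffunE t1 subrr mulr0 mul0r.
  rewrite [nfix _](_ : _ = 0%N) ?mulr0 //; apply: eq_card0 => z.
  by rewrite !inE /= invg1 mulg1 -{1}[z]mul1g (inj_eq (mulIg z)) eq_sym (negPf x1).
move/r0/bireg_inj/eqP; rewrite scaler_eq0 invr_eq0 (negPf half2) subr_eq0.
by move/eqP.
Qed.

End GrouplikeInvolution.

(** * The centralizer of a quaternion pair *)

Lemma exists_nth_root (k : closedFieldType) n (a : k) : (0 < n)%N -> exists r, r ^+ n = a.
Proof.
case: n => // n _; have [r er] := @solve_monicpoly k n.+1 (nth 0 [:: a]) isT.
exists r; rewrite er big_ord_recl big1 ?addr0 ?expr0 ?mulr1 // => i _.
by rewrite lift0 /= nth_nil mul0r.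
Qed.

Section QuaternionCentralizer.
Variables (k : closedFieldType) (A : algType k).
Hypotheses (two0 : 2%:R != 0 :> k).
Variables (u v : A).
Hypotheses (uu : u * u = 1) (vv : v * v = 1) (uv : u * v = - (v * u)).

Definition incent (x : A) := x * u = u * x /\ x * v = v * x.

Let su x := u * x * u.
Let sv x := v * x * v.
Let suK x : su (su x) = x.
Proof. by rewrite /su !mulrA uu mul1r -mulrA uu mulr1. Qed.
Let svK x : sv (sv x) = x.
Proof. by rewrite /sv !mulrA vv mul1r -mulrA vv mulr1. Qed.
Let suv x : su (sv x) = sv (su x).
Proof.
have vu : v * u = - (u * v) by rewrite uv opprK.
by rewrite /su /sv !mulrA uv !mulNr -!mulrA vu !mulrN opprK.
Qed.
Let suD x y : su (x + y) = su x + su y. Proof. by rewrite /su mulrDr mulrDl. Qed.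
Let svD x y : sv (x + y) = sv x + sv y. Proof. by rewrite /sv mulrDr mulrDl. Qed.
Let suZ c x : su (c *: x) = c *: su x.
Proof. by rewrite /su -scalerAr -scalerAl. Qed.
Let svZ c x : sv (c *: x) = c *: sv x.
Proof. by rewrite /sv -scalerAr -scalerAl. Qed.

(** Conjugations by u and v are commuting involutions although u and v anticommute; this averages
    over the Klein group that they generate. *)
Definition cproj x : A := (2%:R^-1 * 2%:R^-1) *: (x + su x + (sv x + sv (su x))).

Let incentP x : su x = x -> sv x = x -> incent x.
Proof.
move=> ux vx; split; first by rewrite -{2}ux /su !mulrA uu mul1r.
by rewrite -{2}vx /sv !mulrA vv mul1r.
Qed.

Lemma cproj_incent x : incent (cproj x).
Proof.
apply: incentP; rewrite /cproj ?suZ ?svZ; congr (_ *: _).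
  by rewrite !suD suK !suv suK [su x + x]addrC [sv (su x) + _]addrC.
by rewrite !svD !svK [LHS]addrC.
Qed.

Lemma cproj_eigen (f : {lrmorphism A -> A}) c x :
  f u = u -> f v = v -> f x = c *: x -> f (cproj x) = c *: cproj x.
Proof.
move=> fu fv fx; rewrite /cproj; set q : k := _ * _.
rewrite linearZ /= [RHS]scalerA [c * q]mulrC -[RHS]scalerA; congr (_ *: _).
have fsu y : f (su y) = su (f y) by rewrite /su !rmorphM /= fu.
have fsv y : f (sv y) = sv (f y) by rewrite /sv !rmorphM /= fv.
by rewrite !linearD /= !fsv !fsu fx !(suZ, svZ) ?scalerDr.
Qed.

(** The decomposition of A as M_2(k) tensored with the centralizer. The four summands are the
    components of x in the joint sign eigenspaces of [su] and [sv]. *)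
Lemma cproj_decomp x :
  x = cproj x + u * cproj (u * x) + (v * cproj (v * x) + u * (v * cproj (v * (u * x)))).
Proof.
pose q := 2%:R^-1 * 2%:R^-1 : k.
have vu : v * u = - (u * v) by rewrite uv opprK.
have uuA y : u * (u * y) = y by rewrite mulrA uu mul1r.
have vvA y : v * (v * y) = y by rewrite mulrA vv mul1r.
have uvA y : u * (v * y) = - (v * (u * y)) by rewrite !mulrA uv mulNr.
have e1 : u * cproj (u * x) = q *: (x + su x - (sv x + sv (su x))).
  rewrite /cproj -scalerAr; congr (_ *: _); rewrite /su /sv !mulrDr opprD -!mulrA.
  by rewrite !(uuA, vvA, uvA, uv, mulrN, mulNr, opprK).
have e2 : v * cproj (v * x) = q *: (x - su x + (sv x - sv (su x))).
  rewrite /cproj -scalerAr; congr (_ *: _); rewrite /su /sv !mulrDr -!mulrA.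
  by rewrite !(uuA, vvA, uvA, uv, mulrN, mulNr, opprK).
have e3 : u * (v * cproj (v * (u * x))) = q *: (x - su x - (sv x - sv (su x))).
  rewrite /cproj -!scalerAr; congr (_ *: _); rewrite /su /sv !mulrDr opprD -!mulrA.
  by rewrite !(uuA, vvA, uvA, uv, mulrN, mulNr, opprK).
have dbl (s t : A) : s + t + (s - t) = s + s by rewrite addrACA subrr addr0.
rewrite e1 e2 e3 -!scalerDr dbl dbl addrACA dbl -!mulr2n -mulrnA -scaler_nat scalerA.
by rewrite natrM /q mulrACA mulVf // mulr1 scale1r.
Qed.

Variables (al be : {lrmorphism A -> A}).
Hypotheses (al_u : al u = u) (al_v : al v = v) (be_u : be u = u) (be_v : be v = v).
Hypothesis fixB : forall x, al x = x -> be x = x ->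
  exists c0 c1 c2 c3 : k, x = c0 *: 1 + c1 *: u + c2 *: v + c3 *: (u * v).

(** By [fixB] such an x lies in the span M_2(k) of 1, u, v, uv, whose center is k: [su] negates v
    and uv, and [sv] negates u. *)
Lemma fixed_central_scalar x : incent x -> al x = x -> be x = x ->
  exists c : k, x = c *: 1.
Proof.
move=> [xu xv] ax bx; have [c0 [c1 [c2 [c3 e]]]] := fixB ax bx.
have sux : su x = x by rewrite /su -mulrA xu mulrA uu mul1r.
have svx : sv x = x by rewrite /sv -mulrA xv mulrA vv mul1r.
have su1 : su 1 = 1 by rewrite /su mulr1 uu.
have sv1 : sv 1 = 1 by rewrite /sv mulr1 vv.
have suu : su u = u by rewrite /su uu mul1r.
have svv : sv v = v by rewrite /sv vv mul1r.
have suv' : su v = - v by rewrite /su uv mulNr -mulrA uu mulr1.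
have svu : sv u = - u by rewrite /sv -[v * u]opprK -uv mulNr -mulrA vv mulr1.
have suuv : su (u * v) = - (u * v).
  by rewrite /su mulrA uu mul1r -[v * u]opprK -uv.
have half (y z : A) : x = y + z -> x = y - z -> x = y.
  move=> e1 e2; apply: (scalerI two0); rewrite !scaler_nat !mulr2n {1}e1 e2.
  by rewrite addrACA subrr addr0.
have e1 : x = c0 *: 1 + c1 *: u.
  apply: (half _ (c2 *: v + c3 *: (u * v))); first by rewrite e !addrA.
  by rewrite -{1}sux e !suD !suZ su1 suu suv' suuv !scalerN opprD !addrA.
exists c0; apply: (half _ (c1 *: u)) => //.
by rewrite -{1}svx e1 svD !svZ sv1 svu scalerN.
Qed.

Lemma incentM x y : incent x -> incent y -> incent (x * y).
Proof.
move=> [xu xv] [yu yv]; split; first by rewrite -mulrA yu mulrA xu mulrA.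
by rewrite -mulrA yv mulrA xv mulrA.
Qed.
Lemma incentZ c x : incent x -> incent (c *: x).
Proof. by move=> [xu xv]; split; rewrite -scalerAl -scalerAr ?xu ?xv. Qed.

Let al_M x y a b : al x = a *: x -> al y = b *: y -> al (x * y) = (a * b) *: (x * y).
Proof. by move=> ax by_; rewrite rmorphM /= ax by_ -scalerAl -scalerAr scalerA. Qed.
Let be_M x y : be x = x -> be y = y -> be (x * y) = x * y.
Proof. by move=> ax by_; rewrite rmorphM /= ax by_. Qed.

(** Moves y into the centralizer with its eigenvalues kept and c * y still nonzero. Here w is one of
    1, u, v, v * u: were all four products zero, [cproj_decomp] would give c * y = 0, since c moves
    past u and v. *)
Lemma exists_cproj_mul c y : incent c -> c * y != 0 ->
  exists w, [/\ c * cproj (w * y) != 0, al w = w & be w = w].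
Proof.
move=> [cu cv] cy0; case: (eqVneq (c * cproj y) 0) => [e0|]; last first.
  by exists 1; rewrite mul1r !rmorph1.
case: (eqVneq (c * cproj (u * y)) 0) => [e1|]; last by exists u.
case: (eqVneq (c * cproj (v * y)) 0) => [e2|]; last by exists v.
case: (eqVneq (c * cproj (v * (u * y))) 0) => [e3|].
  move: cy0; rewrite (cproj_decomp y) !mulrDr !(mulrA c u) !(mulrA c v) cu cv.
  by rewrite -!(mulrA u) !(mulrA c v) cv -!(mulrA v) e0 e1 e2 e3 !mulr0 !addr0 eqxx.
exists (v * u); rewrite -mulrA; split=> //; last exact: be_M.
by rewrite rmorphM /= al_v al_u.
Qed.

Variables (ze : k).
Hypothesis ze3 : ze * ze * ze = 1.
Let ze0 : ze != 0.
Proof. by apply/eqP=> z0; move/eqP: ze3; rewrite z0 !mulr0 eq_sym oner_eq0. Qed.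

(** Since the ys_i xs_i sum to 1, some c * ys_i is nonzero. Projected to the centralizer, ys_i
    yields d with the inverse eigenvalue, so c * d and d * c are scalars, and associativity makes
    them equal. *)
Lemma char_element_inverse (I : finType) (xs ys : I -> A) c :
  \sum_i ys i * xs i = 1 -> (forall i, al (ys i) = ze^-1 *: ys i) ->
  (forall i, be (ys i) = ys i) ->
  c != 0 -> incent c -> al c = ze *: c -> be c = c -> exists d, c * d = 1 /\ d * c = 1.
Proof.
move=> sum1 al_y be_y c0 cin al_c be_c.
have [i ci] : exists i, c * ys i != 0.
  apply/existsP; apply: contraNT c0 => /existsPn all0.
  rewrite -[c]mulr1 -sum1 mulr_sumr big1 // => i _.
  by have := all0 i; rewrite negbK mulrA => /eqP ->; rewrite mul0r.
have [w [w0 aw bw]] := exists_cproj_mul cin ci.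
pose d := cproj (w * ys i); have din : incent d := cproj_incent _.
have al_d : al d = ze^-1 *: d.
  by apply: cproj_eigen => //; rewrite rmorphM /= aw al_y scalerAr.
have be_d : be d = d.
  by rewrite -[RHS]scale1r; apply: cproj_eigen => //; rewrite rmorphM /= bw be_y scale1r.
have [l el] : exists l : k, c * d = l *: 1.
  apply: fixed_central_scalar; [exact: incentM|rewrite (al_M al_c al_d)|exact: be_M].
  by rewrite divff // scale1r.
have l0 : l != 0.
  by apply: contra_neq w0 => l0; rewrite -/d el l0 scale0r.
have cd : c * (l^-1 *: d) = 1 by rewrite -scalerAr el scalerA mulVf // scale1r.
exists (l^-1 *: d); split=> //.
have [m em] : exists m : k, d * c = m *: 1.
  apply: fixed_central_scalar; [exact: incentM|rewrite (al_M al_d al_c)|exact: be_M].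
  by rewrite mulVf // scale1r.
have : c * ((l^-1 *: d) * c) = c by rewrite mulrA cd mul1r.
rewrite -scalerAl em scalerA -scalerAr mulr1 => e.
suff -> : l^-1 * m = 1 by rewrite scale1r.
apply/eqP; rewrite -subr_eq0.
have /eqP : (l^-1 * m - 1) *: c = 0 by rewrite scalerBl e scale1r subrr.
by rewrite scaler_eq0 (negPf c0) orbF.
Qed.

Variables (sg ta : {lrmorphism A -> A}).
Hypotheses (sg_in : forall x, incent x -> incent (sg x))
  (ta_in : forall x, incent x -> incent (ta x))
  (sg_al : forall x, al (sg (al x)) = sg x) (sg_be : forall x, be (sg x) = sg (be x))
  (ta_al : forall x, al (ta x) = ta (al x)) (ta_be : forall x, be (ta (be x)) = ta x)
  (taK : forall x, ta (ta x) = x).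

(* Elements fixed by al and be that commute with u and v are scalars, so the joint
   eigenspaces of al and be among the elements commuting with u and v are lines.  Hence
   sg c is a multiple of c * c and ta c one of c; rescaling c removes the factors. *)
Lemma char_element (I : finType) (xs ys : I -> A) (xs' ys' : I -> A) :
  \sum_i xs i * ys i = 1 -> (forall i, al (xs i) = ze *: xs i) ->
  (forall i, be (xs i) = xs i) ->
  \sum_i ys' i * xs' i = 1 -> (forall i, al (ys' i) = ze^-1 *: ys' i) ->
  (forall i, be (ys' i) = ys' i) ->
  exists c, [/\ incent c, al c = ze *: c, be c = c & [/\ c * c * c = 1, sg c = c * c & ta c = c]].
Proof.
move=> sum1 al_x be_x sum1' al_y be_y.
have [i xi0] : exists i, xs i != 0.
  apply/existsP; apply: contraT => /existsPn all0.
  have : \sum_i xs i * ys i == 0.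
    rewrite big1 // => i _; have := all0 i; rewrite negbK => /eqP ->.
    by rewrite mul0r.
  by rewrite sum1 oner_eq0.
have in1 : incent 1 by split; rewrite mulr1 mul1r.
have x1 : 1 * xs i != 0 by rewrite mul1r.
have [w [w0 aw bw]] := exists_cproj_mul in1 x1; rewrite mul1r in w0.
set c := cproj _ in w0; have cin : incent c := cproj_incent _.
have al_c : al c = ze *: c.
  by apply: cproj_eigen => //; rewrite rmorphM /= aw al_x scalerAr.
have be_c : be c = c.
  by rewrite -[RHS]scale1r; apply: cproj_eigen => //; rewrite rmorphM /= bw be_x scale1r.
have [d [cd dc]] := char_element_inverse sum1' al_y be_y w0 cin al_c be_c.
have [l el] : exists l : k, c * c * c = l *: 1.
  apply: fixed_central_scalar; [exact: (incentM (incentM cin cin) cin)| |exact: (be_M (be_M be_c be_c) be_c)].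
  by rewrite (al_M (al_M al_c al_c) al_c) ze3 scale1r.
have l0 : l != 0.
  apply/eqP => l0; have : c * c * c * d * d * d = 1.
    by rewrite -!mulrA (mulrA c d) cd mul1r (mulrA c d) cd mul1r cd.
  by rewrite el l0 scale0r !mul0r => /eqP; rewrite eq_sym oner_eq0.
have [r er] := exists_nth_root l^-1 (isT : (0 < 3)%N).
have cubeZ m x : (m *: x) * (m *: x) * (m *: x) = m ^+ 3 *: (x * x * x) :> A.
  rewrite -!scalerAl -!scalerAr -!scalerAl !scalerA; congr (_ *: _).
  by rewrite !exprS expr0 mulr1 ?mulrA.
have [lin1 al1 be1 c31] : [/\ incent (r *: c), al (r *: c) = ze *: (r *: c),
    be (r *: c) = r *: c & (r *: c) * (r *: c) * (r *: c) = 1].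
  split; first exact: incentZ.
  - by rewrite [LHS]linearZ /= al_c !scalerA [r * _]mulrC.
  - by rewrite linearZ /= be_c.
  - by rewrite cubeZ el scalerA er mulVf // scale1r.
move: (r *: c) lin1 al1 be1 c31 => {}c {w0} {}cin {}al_c {}be_c c3 {cd dc d el}.
have al_sc : al (sg c) = ze^-1 *: sg c.
  have := sg_al c; rewrite al_c !linearZ /= => e.
  by apply: (scalerI ze0); rewrite e scalerA divff // scale1r.
have be_sc : be (sg c) = sg c by rewrite sg_be be_c.
have [m em] : exists m : k, c * sg c = m *: 1.
  apply: fixed_central_scalar; [exact: incentM cin (sg_in cin)| |exact: be_M].
  by rewrite (al_M al_c al_sc) divff // scale1r.
have esc : sg c = m *: (c * c).
  by rewrite -[LHS]mul1r -c3 -(mulrA (c * c)) em -scalerAr mulr1.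
have c6 : c * c * (c * c) * (c * c) = 1.
  by rewrite !mulrA c3 mul1r c3.
have one_inj (x y : k) : x *: (1 : A) = y *: 1 -> x = y.
  move/eqP; rewrite -subr_eq0 -scalerBl scaler_eq0 oner_eq0 orbF subr_eq0.
  by move/eqP.
(* Replacing c by m c then keeps its cube 1 and absorbs the factor of sg c = m c^2. *)
have m3 : m ^+ 3 = 1.
  have : sg (c * c * c) = sg 1 by rewrite c3.
  rewrite !rmorphM rmorph1 /= esc cubeZ c6 => e.
  by apply: one_inj; rewrite e scale1r.
have [lin1 al1 be1 [c31 sc1]] : [/\ incent (m *: c), al (m *: c) = ze *: (m *: c),
    be (m *: c) = m *: c & (m *: c) * (m *: c) * (m *: c) = 1 /\ sg (m *: c) = (m *: c) * (m *: c)].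
  split; first exact: incentZ.
  - by rewrite [LHS]linearZ /= al_c !scalerA [m * _]mulrC.
  - by rewrite linearZ /= be_c.
  - by rewrite cubeZ c3 m3 scale1r linearZ /= esc -scalerAl -scalerAr !scalerA.
move: (m *: c) lin1 al1 be1 c31 sc1 => {em esc al_sc be_sc c6 c3} {}c {}cin {}al_c {}be_c c3 sc.
exists c; split=> //; split=> //.
have al_tc : al (ta c) = ze *: ta c by rewrite ta_al al_c linearZ.
have be_tc : be (ta c) = ta c by have := ta_be c; rewrite be_c.
have [n en] : exists n : k, c * c * ta c = n *: 1.
  apply: fixed_central_scalar; [exact: incentM (incentM cin cin) (ta_in cin)| |].
    by rewrite (al_M (al_M al_c al_c) al_tc) ze3 scale1r.
  exact: be_M (be_M be_c be_c) be_tc.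
have etc : ta c = n *: c.
  by rewrite -[LHS]mul1r -c3 -!mulrA (mulrA c c (ta c)) en -scalerAr mulr1.
have n3 : n ^+ 3 = 1.
  have : ta (c * c * c) = ta 1 by rewrite c3.
  rewrite !rmorphM rmorph1 /= etc cubeZ c3 => e.
  by apply: one_inj; rewrite e scale1r.
(* [ta] is an involution; together with n^3 = 1 this forces n = 1, with no further rescaling. *)
have n2 : n ^+ 2 = 1.
  have := taK c; rewrite etc linearZ /= etc scalerA -expr2 => e.
  apply: one_inj; rewrite scale1r -c3.
  by rewrite -!mulrA scalerAl e.
by rewrite etc -[n]mulr1 -n2 -exprS n3 scale1r.
Qed.

(** The commutator is fixed by [al] and [be], so c1 c2 = m c2 c1 with m scalar. Applying [sg]
    replaces c1 by c1^2 with the same m, while moving c1 past c2 twice gives m^2. Hence m^2 = m, so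
    m = 1. *)
Lemma char_elements_commute c1 c2 : incent c1 -> incent c2 ->
  al c1 = ze *: c1 -> be c1 = c1 -> al c2 = c2 -> be c2 = ze *: c2 ->
  c1 * c1 * c1 = 1 -> c2 * c2 * c2 = 1 -> sg c1 = c1 * c1 -> sg c2 = c2 ->
  c1 * c2 = c2 * c1.
Proof.
move=> in1 in2 a1 b1 a2 b2 c13 c23 s1 s2.
have [m em] : exists m : k, c1 * c2 * (c1 * c1) * (c2 * c2) = m *: 1.
  apply: fixed_central_scalar.
  - exact: incentM (incentM (incentM in1 in2) (incentM in1 in1)) (incentM in2 in2).
  - by rewrite !rmorphM /= a1 a2 -!scalerAl -!scalerAr -!scalerAl !scalerA ze3 scale1r.
  - by rewrite !rmorphM /= b1 b2 -!scalerAl -!scalerAr -!scalerAl !scalerA ze3 scale1r.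
have e : c1 * c2 = m *: (c2 * c1).
  rewrite -[m *: _]mul1r -scalerAr scalerAl -em -!mulrA (mulrA c2 c2) (mulrA (c2 * c2)) c23.
  by rewrite mul1r (mulrA c1 c1) c13 mulr1.
have e' : c1 * c1 * c2 = m *: (c2 * (c1 * c1)).
  by have := congr1 sg e; rewrite linearZ !rmorphM /= s1 s2.
have e2 : c1 * c1 * c2 = (m * m) *: (c2 * (c1 * c1)).
  by rewrite -mulrA e -scalerAr (mulrA c1 c2) e -scalerAl scalerA -mulrA.
have d0 : c2 * (c1 * c1) != 0.
  apply/eqP => d0; have : c2 * c2 * (c2 * (c1 * c1)) * c1 = 1.
    by rewrite !mulrA c23 mul1r c13.
  by rewrite d0 mulr0 mul0r => /eqP; rewrite eq_sym oner_eq0.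
have mm : m * m = m.
  apply/eqP; rewrite -subr_eq0; have /eqP : (m * m - m) *: (c2 * (c1 * c1)) = 0.
    by rewrite scalerBl -e' -e2 subrr.
  by rewrite scaler_eq0 (negPf d0) orbF.
have m0 : m != 0.
  apply/eqP => m0; move: em; rewrite m0 scale0r.
  move/(congr1 (fun x => x * c2 * c1)); rewrite !mul0r -!mulrA (mulrA c2 c2) (mulrA (c2 * c2)) c23.
  rewrite mul1r (mulrA c1 c1) c13 mulr1 => /(congr1 (fun x => c2 * c2 * (c1 * c1 * x))).
  rewrite !mulr0 !mulrA -(mulrA (c2 * c2)) -(mulrA (c2 * c2)) c13 mulr1 c23 => /eqP.
  by rewrite oner_eq0.
have m1 : m = 1 by apply: (mulfI m0); rewrite mm mulr1.
by rewrite e m1 scale1r.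
Qed.

End QuaternionCentralizer.

(** * Spectral idempotents of an element with cube 1 *)

Section CubicIdempotents.
Variables (k : fieldType) (A : algType k).
Hypothesis three0 : 3%:R != 0 :> k.
Variables (c : A) (ze : k).
Hypotheses (c3 : c * c * c = 1) (ze3 : ze * ze * ze = 1) (ze1 : ze != 1).

(** For w^3 = 1, the projector onto the eigenvalue w^-1 of multiplication by c. *)
Definition cubic_idem (w : k) : A := 3%:R^-1 *: (1 + w *: c + (w * w) *: (c * c)).

Lemma cubic_idem_c : c * cubic_idem 1 = cubic_idem 1.
Proof.
rewrite /cubic_idem -scalerAr; congr (_ *: _).
by rewrite !mulrDr !mulr1 !scale1r mulrA c3 addrC addrA.
Qed.

Lemma cubic_idem_mul w : cubic_idem w * cubic_idem 1 =
  (3%:R^-1 * (1 + w + w * w)) *: cubic_idem 1.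
Proof.
rewrite {1}/cubic_idem -scalerAl -[RHS]scalerA; congr (_ *: _).
rewrite !mulrDl mul1r -!scalerAl -mulrA !cubic_idem_c !scalerDl scale1r.
by [].
Qed.

Lemma cubic_idem_idem : cubic_idem 1 * cubic_idem 1 = cubic_idem 1.
Proof.
by rewrite cubic_idem_mul mulr1 (_ : 1 + 1 + 1 = 3%:R) ?mulVf ?scale1r //; ring.
Qed.

Lemma cubic_idem_ortho w : w * w * w = 1 -> w != 1 -> cubic_idem w * cubic_idem 1 = 0.
Proof.
move=> w3 w1; rewrite cubic_idem_mul (_ : 1 + w + w * w = 0) ?mulr0 ?scale0r //.
have w10 : w - 1 != 0 by rewrite subr_eq0.
by apply: (mulfI w10); rewrite mulr0 -[RHS](subrr 1) -{3}w3; ring.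
Qed.

Lemma cubic_idem_sum : cubic_idem 1 + cubic_idem ze + cubic_idem (ze * ze) = 1.
Proof.
have z10 : ze - 1 != 0 by rewrite subr_eq0.
have s0 : 1 + ze + ze * ze = 0.
  by apply: (mulfI z10); rewrite mulr0 -[RHS](subrr 1) -{3}ze3; ring.
have z4 : ze * ze * (ze * ze) = ze by rewrite mulrA ze3 mul1r.
rewrite /cubic_idem -!scalerDr z4 mulr1 !scale1r.
have sum3 (p q r p' q' r' : A) : p + q + r + (p' + q' + r') = p + p' + (q + q') + (r + r').
  by rewrite addrACA [X in X + _]addrACA.
have e1 (x : A) : x + ze *: x + (ze * ze) *: x = 0.
  by rewrite -{1}[x]scale1r -!scalerDl s0 scale0r.
have e2 (x : A) : x + (ze * ze) *: x + ze *: x = 0 by rewrite addrAC e1.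
rewrite (sum3 1) (sum3 (1 + 1)) e1 e2 !addr0.
have -> : 1 + 1 + 1 = 3%:R *: 1 :> A by rewrite scaler_nat !mulrS mulr0n addr0 addrA.
by rewrite scalerA mulVf // scale1r.
Qed.

End CubicIdempotents.

(** * The twisted function algebra *)

(** The proof [JP] is a parameter of the type so that the algebra structure, which depends on J and
    on the twist equation, can be attached to it. *)
Definition twalg (k : fieldType) (gT : finGroupType) (J K : galg k (gT * gT)%type)
  (JP : twist_pair J K) := {ffun gT -> k}.

Section TwistedFunctions.
Variables (k : fieldType) (gT : finGroupType) (J K : galg k (gT * gT)%type).
Variable JP : twist_pair J K.
Implicit Types f g h : {ffun gT -> k}.

Definition pairing f g (x : gT) (p : gT * gT) : k := f (x * p.1)%g * g (x * p.2)%g.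
Definition tmul f g : {ffun gT -> k} := [ffun x => aug (pairing f g x) J].

HB.instance Definition _ := GRing.Zmodule.copy (twalg JP) {ffun gT -> k}.

Lemma aug_gmapM (hT1 hT2 hT : finGroupType) (F : hT -> k) (r : hT1 -> hT) (s : hT2 -> hT)
    (a : galg k hT1) (b : galg k hT2) :
  aug F (gmap r a * gmap s b) = aug (fun x => aug (fun y => F (r x * s y)%g) b) a.
Proof. exact: (@glin_gmapM k hT1 hT2 hT k^o). Qed.
Lemma aug_gmap (hT1 hT : finGroupType) (F : hT -> k) (r : hT1 -> hT) (a : galg k hT1) :
  aug F (gmap r a) = aug (F \o r) a.
Proof. exact: (@glin_gmap k hT1 hT k^o). Qed.
Lemma augMl (hT : finGroupType) (F : hT -> k) (a b : galg k hT) :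
  aug F (a * b) = aug (fun x => aug (fun y => F (x * y)%g) b) a.
Proof. exact: (@glinM k hT k^o). Qed.
Lemma eq_aug (hT : finGroupType) (F F' : hT -> k) : F =1 F' -> aug F =1 aug F'.
Proof. exact: (@eq_glin k hT k^o). Qed.
Lemma aug_mulr (hT : finGroupType) (F : hT -> k) (c : k) (a : galg k hT) :
  aug F a * c = aug (fun x => F x * c) a.
Proof. by rewrite !augE mulr_suml; apply: eq_bigr => x _; rewrite mulrA. Qed.
Lemma aug_mull (hT : finGroupType) (F : hT -> k) (c : k) (a : galg k hT) :
  c * aug F a = aug (fun x => c * F x) a.
Proof. by rewrite mulrC aug_mulr; apply: eq_aug => x; rewrite mulrC. Qed.

(** Associativity at x is the twist equation paired with the function (a, b, c) |-> f(xa) g(xb)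
    h(xc). *)
Lemma tmulA : associative tmul.
Proof.
have [_ _ cocyc _ _] := JP.
move=> f g h; apply/ffunP=> x; rewrite !ffunE.
pose F (q : gT * gT * gT) : k := f (x * q.1.1)%g * g (x * q.1.2)%g * h (x * q.2)%g.
have := congr1 (aug F) cocyc; rewrite !aug_gmapM => e.
transitivity (aug (fun p => aug (fun q => F ((p.1, p.2, p.2) * (1, q.1, q.2))%g) J) J).
  apply: eq_aug => p; rewrite /pairing ffunE aug_mull; apply: eq_aug => q.
  by rewrite /pairing /F /= mulg1 !mulgA mulrA.
rewrite -e; apply: eq_aug => p; rewrite /pairing ffunE aug_mulr; apply: eq_aug => q.
by rewrite /pairing /F /= mulg1 !mulgA.
Qed.

Definition tunit : {ffun gT -> k} := [ffun=> 1].

Lemma tmul1l : left_id tunit tmul.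
Proof.
have [_ _ _ c1 _] := JP.
move=> f; apply/ffunP=> x; rewrite ffunE.
transitivity (aug (fun y => f (x * y)%g) (gmap snd J)).
  by rewrite aug_gmap; apply: eq_aug => p; rewrite /pairing ffunE mul1r.
by rewrite c1 -gb1 aug_gb mulg1.
Qed.
Lemma tmul1r : right_id tunit tmul.
Proof.
have [_ _ _ _ c2] := JP.
move=> f; apply/ffunP=> x; rewrite ffunE.
transitivity (aug (fun y => f (x * y)%g) (gmap fst J)).
  by rewrite aug_gmap; apply: eq_aug => p; rewrite /pairing ffunE mulr1.
by rewrite c2 -gb1 aug_gb mulg1.
Qed.
Lemma tmulDl : left_distributive tmul (+%R : twalg JP -> _).
Proof.
move=> f g h; apply/ffunP=> x; rewrite [RHS]ffunE !ffunE !augE -big_split.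
by apply: eq_bigr => p _; rewrite /pairing ffunE mulrDl mulrDr.
Qed.
Lemma tmulDr : right_distributive tmul (+%R : twalg JP -> _).
Proof.
move=> f g h; apply/ffunP=> x; rewrite [RHS]ffunE !ffunE !augE -big_split.
by apply: eq_bigr => p _; rewrite /pairing ffunE !mulrDr.
Qed.
Lemma tunit_neq0 : tunit != 0 :> twalg JP.
Proof. by apply/eqP=> /ffunP/(_ 1%g); rewrite !ffunE => /eqP; rewrite oner_eq0. Qed.

HB.instance Definition _ := GRing.Zmodule_isNzRing.Build (twalg JP)
  tmulA tmul1l tmul1r tmulDl tmulDr tunit_neq0.

HB.instance Definition _ := GRing.Zmodule_isLmodule.Build k (twalg JP)
  (@gscaleA k gT) (@gscale1 k gT) (@gscaleDr k gT) (@gscaleDl k gT).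

Lemma tscaleAl (c : k) (f g : twalg JP) : c *: (f * g) = (c *: f) * g.
Proof.
apply/ffunP=> x; rewrite ffunE [in RHS]ffunE [in LHS]ffunE aug_mull.
by apply: eq_aug => p; rewrite /pairing ffunE mulrA.
Qed.
Lemma tscaleAr (c : k) (f g : twalg JP) : c *: (f * g) = f * (c *: g).
Proof.
apply/ffunP=> x; rewrite ffunE [in RHS]ffunE [in LHS]ffunE aug_mull.
by apply: eq_aug => p; rewrite /pairing ffunE mulrCA.
Qed.
HB.instance Definition _ := GRing.Lmodule_isLalgebra.Build k (twalg JP) tscaleAl.
HB.instance Definition _ := GRing.Lalgebra_isAlgebra.Build k (twalg JP) tscaleAr.

Lemma twalgM (f g : twalg JP) x : (f * g) x = aug (pairing f g x) J.
Proof. exact: ffunE. Qed.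
Lemma twalg1 x : (1 : twalg JP) x = 1.
Proof. exact: ffunE. Qed.
Lemma twalgD (f g : twalg JP) x : (f + g) x = f x + g x.
Proof. exact: ffunE. Qed.
Lemma twalgZ c (f : twalg JP) x : (c *: f) x = c * f x.
Proof. exact: ffunE. Qed.
Lemma twalg_sum (I : Type) (r : seq I) (P : pred I) (F : I -> twalg JP) x :
  (\sum_(i <- r | P i) F i) x = \sum_(i <- r | P i) F i x.
Proof. exact: sum_ffunE. Qed.

Definition lact (a : gT) (f : twalg JP) : twalg JP := [ffun x => f (a^-1 * x)%g].
Lemma lactE a (f : twalg JP) x : lact a f x = f (a^-1 * x)%g. Proof. exact: ffunE. Qed.
Lemma lact_linear a : linear (lact a).
Proof. by move=> c f g; apply/ffunP=> x; rewrite !(lactE, twalgD, twalgZ). Qed.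
HB.instance Definition _ a :=
  GRing.isLinear.Build k (twalg JP) (twalg JP) _ (lact a) (lact_linear a).
Lemma lact_monoid a : monoid_morphism (lact a).
Proof.
split=> [|f g]; apply/ffunP=> x; first by rewrite lactE !twalg1.
rewrite lactE !twalgM; apply: eq_aug => p.
by rewrite /pairing !lactE !mulgA.
Qed.
HB.instance Definition _ a :=
  GRing.isMonoidMorphism.Build (twalg JP) (twalg JP) (lact a) (lact_monoid a).
Lemma lactM a b f : lact (a * b)%g f = lact a (lact b f).
Proof. by apply/ffunP=> x; rewrite !lactE invMg mulgA. Qed.
Lemma lact1 f : lact 1%g f = f.
Proof. by apply/ffunP=> x; rewrite !lactE invg1 mul1g. Qed.

Definition rtrans (a : gT) (f : twalg JP) : twalg JP := [ffun x => f (x * a)%g].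
Lemma rtransE a (f : twalg JP) x : rtrans a f x = f (x * a)%g. Proof. exact: ffunE. Qed.
Lemma lact_rtrans a b f : lact a (rtrans b f) = rtrans b (lact a f).
Proof. by apply/ffunP=> x; rewrite !(lactE, rtransE) mulgA. Qed.

(* J is invertible, so that the product of the twisted algebra, precomposed with the
   action of K = J^-1, is the pointwise product. *)
Lemma pointwise_product (f g : twalg JP) : (forall x, f x * g x = 1) ->
  \sum_p (K p *: rtrans p.1 f) * rtrans p.2 g = 1.
Proof.
have [JK _ _ _ _] := JP.
move=> fg; apply/ffunP=> x; rewrite twalg_sum twalg1.
transitivity (aug (pairing f g x) (J * K)); last first.
  by rewrite JK -gb1 aug_gb /pairing mulg1 fg.
rewrite augMl [RHS](@glin_exchange k _ _ k^o); apply: eq_bigr => p _.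
rewrite -scalerAl twalgZ twalgM; congr (_ * _); apply: eq_aug => q.
by rewrite /pairing !rtransE -!mulgA.
Qed.

End TwistedFunctions.

(** Right translation of functions by v is the transpose of right multiplication by v on kG, so its
    injectivity makes the latter invertible. *)
Lemma galg_left_cancel_unit (k : fieldType) (gT : finGroupType) (v : galg k gT) :
  (forall f : gT -> k, (forall x, aug (fun a => f (x * a)%g) v = 0) -> forall x, f x = 0) ->
  exists vi, vi * v = 1 /\ v * vi = 1.
Proof.
move=> inj; pose M : 'M[k]_#|gT| := \matrix_(i, j) v ((enum_val i)^-1 * enum_val j)%g.
pose rv (h : galg k gT) : 'rV[k]_#|gT| := \row_i h (enum_val i).
have rvM h : rv h *m M = rv (h * v).
  apply/rowP=> j; rewrite !mxE gmulE (reindex (@enum_val gT predT)) /=; last first.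
    exact: (onW_bij _ (@enum_val_bij gT)).
  by apply: eq_bigr => i _; rewrite !mxE.
have rv_inj h : rv h = 0 -> h = 0.
  move=> e; apply/ffunP=> g; have /rowP/(_ (enum_rank g)) := e.
  by rewrite !mxE enum_rankK ffunE.
have MTu : M^T \in unitmx.
  rewrite -row_free_unit -kermx_eq0; apply/rowV0P => w /sub_kermxP wM.
  pose f (x : gT) := w 0 (enum_rank x).
  have f0 x : f x = 0.
    apply: inj => {}x; have /rowP/(_ (enum_rank x)) := wM; rewrite !mxE => <-.
    rewrite augE (reindex_inj (mulgI x^-1%g)) (reindex (@enum_val gT predT)) /=; last first.
      exact: (onW_bij _ (@enum_val_bij gT)).
    by apply: eq_bigr => i _; rewrite !mxE /f mulKVg enum_valK enum_rankK mulrC.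
  by apply/rowP=> i; rewrite mxE -(enum_valK i) [LHS]f0.
have Mu : M \in unitmx by rewrite -unitmx_tr.
pose vi : galg k gT := [ffun x => (rv 1 *m invmx M) 0 (enum_rank x)].
have rvi : rv vi = rv 1 *m invmx M.
  by apply/rowP=> i; rewrite mxE ffunE enum_valK.
have viv : vi * v = 1.
  apply/eqP; rewrite -subr_eq0; apply/eqP/rv_inj.
  have -> : rv (vi * v - 1) = rv (vi * v) - rv 1.
    by apply/rowP=> i; rewrite !mxE galgD galgN.
  by rewrite -rvM rvi mulmxKV // subrr.
exists vi; split=> //; apply/eqP; rewrite -subr_eq0; apply/eqP/rv_inj.
have : rv (v * vi - 1) *m M = 0.
  rewrite rvM mulrBl -mulrA viv mulr1 mul1r subrr; apply/rowP=> i.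
  by rewrite !mxE ffunE.
by move/(congr1 (mulmx^~ (invmx M))); rewrite mulmxK // mul0mx.
Qed.

Section CommutingPair.
Variables (k : fieldType) (gT : finGroupType) (a b : gT) (r : k).
Hypotheses (tab : (<[a]> :&: <[b]> = 1)%g) (rn : r ^+ #[a]%g = 1).

Lemma exists_dprod_char : exists chi : gT -> k,
  forall i j, chi (a ^+ i * b ^+ j)%g = r ^+ i.
Proof.
pose chi g := if [pick ij : 'I_#[a]%g * 'I_#[b]%g | g == a ^+ ij.1 * b ^+ ij.2]%g
  is Some ij then r ^+ ij.1 else 1.
exists chi => i j; rewrite /chi; case: pickP => [[i' j'] /= /eqP e|none]; last first.
  have im : (i %% #[a]%g < #[a]%g)%N by rewrite ltn_mod order_gt0.
  have jm : (j %% #[b]%g < #[b]%g)%N by rewrite ltn_mod order_gt0.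
  by have := none (Ordinal im, Ordinal jm); rewrite /= !expg_mod_order eqxx.
have ei : (a ^+ i = a ^+ i')%g.
  have : (a ^- i' * a ^+ i)%g \in (<[a]> :&: <[b]>)%g.
    rewrite inE groupM ?groupV ?mem_cycle //=.
    have -> : (a ^- i' * a ^+ i = b ^+ j' * b ^- j)%g.
      by apply: (mulgI (a ^+ i')%g); rewrite mulKVg mulgA -e mulgK.
    by rewrite groupM ?groupV ?mem_cycle.
  by rewrite tab inE -eq_mulVg1 => /eqP.
have /eqP := ei; rewrite eq_expg_mod_order => /eqP emod.
by rewrite -(expr_mod i rn) emod expr_mod.
Qed.
End CommutingPair.

(** * Gauge equivalence of J and J1 *)

Section Retraction.
Variables (gT : finGroupType) (P Q : {group gT}).
Hypotheses (nP : (P <| [set: gT])%g) (tPQ : (P :&: Q = 1)%g) (PQ : (P * Q = [set: gT])%g).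

Definition retr (x : gT) : gT := remgr P Q x.

Lemma retrM : {morph retr : x y / (x * y)%g}.
Proof.
have cQ : Q \in [complements to P in [set: gT]]%g by apply/complP.
by move=> x y; apply: (remgrM cQ nP); rewrite inE.
Qed.
Lemma retr1 : retr 1%g = 1%g. Proof. exact: remgr1. Qed.
Lemma retr_in x : retr x \in Q. Proof. by apply: mem_remgr; rewrite PQ inE. Qed.
Lemma retr_id q : q \in Q -> retr q = q. Proof. exact: remgr_id. Qed.
Lemma retr_P z : z \in P -> retr z = 1%g. Proof. exact: remgr1. Qed.
Lemma retr_Pl z x : z \in P -> retr (z * x)%g = retr x.
Proof. by move=> zP; rewrite retrM retr_P ?mul1g. Qed.
Lemma divgr_in x : (x * (retr x)^-1)%g \in P.
Proof. by apply: (@mem_divgr _ P Q x); rewrite PQ inE. Qed.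
End Retraction.

Section Gauge.
Variables (k : fieldType) (gT : finGroupType) (J K : galg k (gT * gT)%type).
Variable JP : twist_pair J K.
Variables (P Q : {group gT}).
Hypotheses (nP : (P <| [set: gT])%g) (tPQ : (P :&: Q = 1)%g) (PQ : (P * Q = [set: gT])%g).
Let p := retr P Q.
Local Notation A := (twalg JP).
Variable E : A.
Hypotheses (E_ortho : forall z, z \in P -> z != 1%g -> lact z E * E = 0) (E_idem : E * E = E)
  (E_Q : forall q, q \in Q -> lact q E = E) (E_sum : \sum_(z in P) lact z E = 1)
  (E_comm : forall f : A, (forall z, z \in P -> lact z f = f) -> E * f = f * E).

Let J1 := gmap (fun q => (p q.1, p q.2)) J.

(** The restriction of f to the coset zQ, extended to a P-invariant function on G. *)
Definition cosfun (z : gT) (f : gT -> k) : A := [ffun x => f (z * p x)%g].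
Lemma cosfunE z f x : cosfun z f x = f (z * p x)%g. Proof. exact: ffunE. Qed.
Lemma lact_cosfun z0 z f : z0 \in P -> lact z0 (cosfun z f) = cosfun z f.
Proof.
by move=> zP; apply/ffunP=> x; rewrite lactE !cosfunE /p (retr_Pl nP) ?groupV.
Qed.

(* The P-translates of E form a partition of unity, so this is an algebra map from the
   functions twisted by J1 to those twisted by J.  It commutes with left translations, and
   is therefore right translation by an element of kG. *)
Definition gauge_map (f : gT -> k) : A := \sum_(z in P) lact z E * cosfun z f.

Let PJ z x : z \in P -> (z ^ x)%g \in P.
Proof. by move=> zP; rewrite memJ_norm // (subsetP (normal_norm nP)) ?inE. Qed.

Lemma eq_gauge_map f f' : f =1 f' -> gauge_map f = gauge_map f'.
Proof.
move=> ff'; apply: eq_bigr => z _; congr (_ * _).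
by apply/ffunP=> x; rewrite !cosfunE ff'.
Qed.

Lemma gauge_map_P z0 f : z0 \in P ->
  lact z0 (gauge_map f) = gauge_map (fun x => f (z0^-1 * x)%g).
Proof.
move=> zP; rewrite linear_sum /gauge_map [RHS](reindex_inj (mulgI z0)) /=.
apply: eq_big => [z|z _]; first by rewrite groupMl.
rewrite rmorphM /= -lactM lact_cosfun //; congr (_ * _); apply/ffunP=> x.
by rewrite !cosfunE !mulgA mulVg mul1g.
Qed.

Lemma gauge_map_Q q f : q \in Q ->
  lact q (gauge_map f) = gauge_map (fun x => f (q^-1 * x)%g).
Proof.
move=> qQ; rewrite linear_sum /gauge_map [RHS](reindex_inj (conjg_inj q^-1%g)) /=.
apply: eq_big => [z|z zP].
  by apply/idP/idP => [/PJ//|/(PJ q)]; rewrite -conjgM mulVg conjg1.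
rewrite rmorphM /= -lactM conjgE invgK; congr (_ * _).
  by rewrite -[E in RHS](E_Q qQ) -lactM !mulgA mulgKV.
apply/ffunP=> x; rewrite lactE !cosfunE /p (retrM nP tPQ PQ) (retr_id tPQ) ?groupV //.
by rewrite !mulgA mulVg mul1g.
Qed.

Lemma gauge_map_act x f : lact x (gauge_map f) = gauge_map (fun y => f (x^-1 * y)%g).
Proof.
rewrite -(mulgKV (p x) x) lactM gauge_map_Q ?(retr_in PQ) // gauge_map_P ?(divgr_in PQ) //.
by apply: eq_gauge_map => y; rewrite mulgA -invMg mulgKV.
Qed.

Let lact_E_comm z f : z \in P -> (forall y, y \in P -> lact y f = f) ->
  lact z E * f = f * lact z E.
Proof.
by move=> zP fP; rewrite -{1}(fP z zP) -rmorphM /= E_comm // rmorphM /= fP.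
Qed.

Let lact_E_ortho z z' : z \in P -> z' \in P -> z != z' -> lact z E * lact z' E = 0.
Proof.
move=> zP zP' zz'; rewrite -[z](mulKVg z') lactM -rmorphM /= E_ortho ?linear0 //.
  by rewrite groupM ?groupV.
by rewrite -eq_mulVg1 eq_sym.
Qed.

Definition tmul1 (f g : gT -> k) (x : gT) : k := aug (fun q => f (x * q.1)%g * g (x * q.2)%g) J1.

Lemma cosfunM z f g : cosfun z f * cosfun z g = cosfun z (tmul1 f g).
Proof.
apply/ffunP=> x; rewrite twalgM cosfunE /tmul1 aug_gmap; apply: eq_aug => q /=.
by rewrite /pairing !cosfunE /p !(retrM nP tPQ PQ) !mulgA.
Qed.

Lemma gauge_mapM f g : gauge_map f * gauge_map g = gauge_map (tmul1 f g).
Proof.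
rewrite mulr_suml; apply: eq_bigr => z zP.
have cP y : y \in P -> lact y (cosfun z f) = cosfun z f by exact: lact_cosfun.
rewrite mulr_sumr (bigD1 z) //= big1 ?addr0 => [|z' /andP[zP' zz']].
  rewrite -mulrA (mulrA (cosfun z f)) -(lact_E_comm zP cP) -!mulrA mulrA cosfunM.
  by rewrite -rmorphM /= E_idem.
rewrite -mulrA (mulrA (cosfun z f)) -(lact_E_comm zP' cP) !mulrA.
by rewrite lact_E_ortho ?mul0r // eq_sym.
Qed.

(** Multiplying by the translate of E at z0 isolates the coset z0 Q. Translating over P and summing
    the partition of unity then removes E. *)
Lemma gauge_map_inj f : gauge_map f = 0 -> forall x, f x = 0.
Proof.
move=> e x; pose z0 := (x * (p x)^-1)%g; have z0P : z0 \in P by exact: divgr_in PQ x.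
have e0 : lact z0 E * cosfun z0 f = 0.
  have := congr1 (fun h => lact z0 E * h) e; rewrite mulr0 mulr_sumr (bigD1 z0) //=.
  rewrite big1 ?addr0 => [|z /andP[zP zz0]]; last by rewrite mulrA lact_E_ortho ?mul0r // eq_sym.
  by rewrite mulrA -rmorphM /= E_idem.
have ez z : z \in P -> lact z E * cosfun z0 f = 0.
  move=> zP; have := congr1 (lact (z * z0^-1)%g) e0.
  rewrite linear0 rmorphM /= -lactM mulgKV lact_cosfun //.
  by rewrite groupM ?groupV.
have : cosfun z0 f = 0.
  by rewrite -[LHS]mul1r -E_sum mulr_suml big1 // => z /ez.
move/ffunP/(_ x); rewrite cosfunE /z0 mulgKV => ->; exact: ffunE.
Qed.

(** An equivariant map is determined by its values at 1, and these are read on delta functions. *)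
Definition gauge : galg k gT := [ffun a => gauge_map (fun x => (x == a)%:R) 1%g].

Lemma gauge_mapE f x : gauge_map f x = aug (fun a => f (x * a)%g) gauge.
Proof.
suff e1 h : gauge_map h 1%g = aug h gauge.
  rewrite -[x in LHS]mulg1 -[x in LHS]invgK -lactE gauge_map_act e1.
  by apply: eq_aug => a; rewrite invgK.
rewrite twalg_sum augE.
under [RHS]eq_bigr do rewrite ffunE twalg_sum mulr_suml.
rewrite exchange_big /=; apply: eq_bigr => z _.
rewrite twalgM augE /pairing.
under [RHS]eq_bigr do rewrite twalgM augE mulr_suml.
rewrite exchange_big /=; apply: eq_bigr => q _; rewrite /pairing.
under [RHS]eq_bigr do rewrite -mulrA -mulrA.
rewrite -mulr_sumr; congr (_ * _); rewrite -mulr_sumr; congr (_ * _).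
rewrite cosfunE (bigD1 (z * p (1 * q.2))%g) //= big1 ?addr0 => [|a az].
  by rewrite cosfunE eqxx mul1r.
by rewrite cosfunE eq_sym (negPf az) mul0r.
Qed.

(** The coefficient at (r, s) is the multiplicativity of [gauge_map] on the delta functions at r and
    s, evaluated at 1. *)
Lemma gauge_twist : cop gauge * J1 = J * gtens gauge gauge.
Proof.
apply/ffunP=> -[r s].
pose d (r x : gT) : k := (x == r)%:R.
have dE (X : galg k (gT * gT)%type) : X (r, s) = aug (fun q => d r q.1 * d s q.2) X.
  rewrite augE (bigD1 (r, s)) //= big1 ?addr0; first by rewrite /d !eqxx !mulr1.
  move=> [x y]; rewrite /d /= xpair_eqE => /negPf xy.
  by rewrite -natrM mulnb xy mulr0.
rewrite dE [RHS]dE.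
have /ffunP/(_ 1%g) := gauge_mapM (d r) (d s).
rewrite gauge_mapE twalgM => e.
transitivity (aug (fun a => tmul1 (d r) (d s) (1 * a)%g) gauge).
  rewrite augMl aug_gmap; apply: eq_aug => a /=; rewrite mul1g /tmul1.
  by apply: eq_aug => q.
rewrite -e augMl; apply: eq_aug => q; rewrite /pairing !gauge_mapE mul1g mul1g.
rewrite [RHS](@glin_gtens k gT k^o) aug_mulr; apply: eq_aug => x.
by rewrite aug_mull; apply: eq_aug => y.
Qed.

Lemma gauge_unit : exists vi, vi * gauge = 1 /\ gauge * vi = 1.
Proof.
apply: galg_left_cancel_unit => f f0; apply: gauge_map_inj.
by apply/ffunP=> x; rewrite gauge_mapE f0 ffunE.
Qed.

End Gauge.

Section LiftedCharacters.
Variables (k : fieldType) (gT : finGroupType) (P Q : {group gT}).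
Hypotheses (nP : (P <| [set: gT])%g) (tPQ : (P :&: Q = 1)%g) (PQ : (P * Q = [set: gT])%g).

Lemma exists_quotient_char (s t : gT) (r : k) :
  commute s t -> (<[s]> :&: <[t]> = 1)%g -> (<[s]> * <[t]> = Q)%g -> r ^+ #[s]%g = 1 ->
  exists psi : gT -> k, [/\ linear_char psi, (forall z, z \in P -> psi z = 1),
    psi s = r & psi t = 1].
Proof.
move=> st tst stQ rs; have [chi chiE] := exists_dprod_char tst rs.
have sQ : s \in Q by rewrite -stQ (subsetP (mulG_subl _ _)) ?cycle_id.
have tQ : t \in Q by rewrite -stQ (subsetP (mulG_subr _ _)) ?cycle_id.
have chi1 : chi 1%g = 1 by have := chiE 0%N 0%N; rewrite !expg0 mulg1 expr0.
have Qdec x : x \in Q -> exists i j, x = (s ^+ i * t ^+ j)%g.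
  by rewrite -{1}stQ => /mulsgP[y z /cycleP[i ->] /cycleP[j ->] ->]; exists i, j.
exists (fun x => chi (retr P Q x)); split.
- split; first by rewrite retr1.
  move=> x y; rewrite (retrM nP tPQ PQ).
  have [i [j ->]] := Qdec _ (retr_in PQ x); have [i' [j' ->]] := Qdec _ (retr_in PQ y).
  have -> : (s ^+ i * t ^+ j * (s ^+ i' * t ^+ j') = s ^+ (i + i') * t ^+ (j + j'))%g.
    rewrite !expgD !mulgA; congr (_ * _)%g; rewrite -!mulgA; congr (_ * _)%g.
    by apply: commuteX; apply/commute_sym/commuteX.
  by rewrite !chiE exprD.
- by move=> z zP; rewrite retr_P.
- by rewrite (retr_id tPQ) //; have := chiE 1%N 0%N; rewrite expg0 mulg1 expr1.
- by rewrite (retr_id tPQ) //; have := chiE 0%N 1%N; rewrite expg0 mul1g expr0.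
Qed.

(** Nowhere zero, so that F and its pointwise inverse can be fed to [pointwise_product]. *)
Lemma exists_eigenfunction (a b : gT) (r : k) :
  commute a b -> (<[a]> :&: <[b]> = 1)%g -> (<[a]> * <[b]> = P)%g ->
  r ^+ #[a]%g = 1 -> r != 0 ->
  exists F : gT -> k, [/\ forall x, F x != 0, forall x, F (a * x)%g = r * F x
    & forall x, F (b * x)%g = F x].
Proof.
move=> ab tab abP ra r0; have [chi chiE] := exists_dprod_char tab ra.
have aP : a \in P by rewrite -abP (subsetP (mulG_subl _ _)) ?cycle_id.
have bP : b \in P by rewrite -abP (subsetP (mulG_subr _ _)) ?cycle_id.
have Pdec x : x \in P -> exists i j, x = (a ^+ i * b ^+ j)%g.
  by rewrite -{1}abP => /mulsgP[y z /cycleP[i ->] /cycleP[j ->] ->]; exists i, j.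
pose d x := (x * (retr P Q x)^-1)%g.
have dP x : d x \in P by exact: divgr_in PQ x.
have dM z x : z \in P -> d (z * x)%g = (z * d x)%g.
  by move=> zP; rewrite /d (retr_Pl nP) // mulgA.
exists (fun x => chi (d x)); split=> x.
- by have [i [j ->]] := Pdec _ (dP x); rewrite chiE expf_neq0.
- by rewrite dM //; have [i [j ->]] := Pdec _ (dP x); rewrite mulgA -expgS !chiE exprS.
- rewrite dM //; have [i [j ->]] := Pdec _ (dP x).
  have -> : (b * (a ^+ i * b ^+ j) = a ^+ i * b ^+ j.+1)%g.
    by rewrite expgS !mulgA; congr (_ * _)%g; apply/commuteX/commute_sym.
  by rewrite !chiE.
Qed.
End LiftedCharacters.

(** * The twisted function algebra when psi_1 and psi_2 anticommute *)

Section NontrivialKleinTwist.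
Variables (k : closedFieldType) (char0 : [pchar k] =i pred0) (gT : finGroupType).
Variables (J K : galg k (gT * gT)%type) (JP : twist_pair J K).
Variables (P Q : {group gT}).
Hypotheses (nP : (P <| [set: gT])%g) (tPQ : (P :&: Q = 1)%g) (PQ : (P * Q = [set: gT])%g).
Local Notation A := (twalg JP).
Let natr_eq0 n : (n%:R == 0 :> k) = (n == 0%N).
Proof. by move: n; apply/pcharf0P. Qed.
Let two0 : 2%:R != 0 :> k. Proof. by rewrite natr_eq0. Qed.
Let three0 : 3%:R != 0 :> k. Proof. by rewrite natr_eq0. Qed.

Definition charfun (psi : gT -> k) : A := [ffun x => psi x].

Lemma lact_charfun psi g : linear_char psi -> lact g (charfun psi) = (psi g)^-1 *: charfun psi.
Proof.
by move=> pP; apply/ffunP=> x; rewrite lactE twalgZ !ffunE pP.2 charV.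
Qed.
Lemma charfunM psi psi' : linear_char psi -> linear_char psi' ->
  charfun psi * charfun psi' = wJ J psi psi' *: charfun (fun x => psi x * psi' x).
Proof.
move=> pP pP'; apply/ffunP=> x; rewrite twalgM twalgZ ffunE /wJ aug_mulr.
by apply: eq_aug => q; rewrite /pairing !ffunE pP.2 pP'.2; ring.
Qed.

Variables (a1 a2 s1 s2 : gT).
Hypotheses (o1 : #[a1]%g = 3%N) (o2 : #[a2]%g = 3%N) (q1 : #[s1]%g = 2%N) (q2 : #[s2]%g = 2%N)
  (a1s1 : (a1 ^ s1 = a1^-1)%g) (a1s2 : (a1 ^ s2 = a1)%g) (a2s1 : (a2 ^ s1 = a2)%g)
  (a2s2 : (a2 ^ s2 = a2^-1)%g) (ca : commute a1 a2) (cs : commute s1 s2)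
  (aP : (<[a1]> * <[a2]> = P)%g) (sQ : (<[s1]> * <[s2]> = Q)%g)
  (ta : (<[a1]> :&: <[a2]> = 1)%g) (ts : (<[s1]> :&: <[s2]> = 1)%g).
Variables (psi1 psi2 : gT -> k).
Hypotheses (psi1P : linear_char psi1) (psi2P : linear_char psi2)
  (psi1_P : forall z, z \in P -> psi1 z = 1) (psi2_P : forall z, z \in P -> psi2 z = 1)
  (psi1_s1 : psi1 s1 = -1) (psi1_s2 : psi1 s2 = 1) (psi2_s1 : psi2 s1 = 1) (psi2_s2 : psi2 s2 = -1).
Hypothesis wanti : wJ J psi1 psi2 = - wJ J psi2 psi1.

Let a1P : a1 \in P. Proof. by rewrite -aP (subsetP (mulG_subl _ _)) ?cycle_id. Qed.
Let a2P : a2 \in P. Proof. by rewrite -aP (subsetP (mulG_subr _ _)) ?cycle_id. Qed.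

Let Pdec x : x \in P -> exists i j, x = (a1 ^+ i * a2 ^+ j)%g.
Proof. by rewrite -{1}aP => /mulsgP[y z /cycleP[i ->] /cycleP[j ->] ->]; exists i, j. Qed.
Let Qdec x : x \in Q -> exists i j, x = (s1 ^+ i * s2 ^+ j)%g.
Proof. by rewrite -{1}sQ => /mulsgP[y z /cycleP[i ->] /cycleP[j ->] ->]; exists i, j. Qed.

Let expg_odd (s : gT) i : #[s]%g = 2%N -> (s ^+ i = s ^+ odd i)%g.
Proof. by move=> os; rewrite -(expg_mod_order s i) os modn2. Qed.

Lemma Klein_elements x : x \in Q -> [\/ x = 1%g, x = s1, x = s2 | x = (s1 * s2)%g].
Proof.
case/Qdec=> i [j ->]; rewrite (expg_odd i q1) (expg_odd j q2).
case: (odd i); case: (odd j); rewrite ?expg0 ?expg1 ?mulg1 ?mul1g;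
  by [constructor 1 | constructor 2 | constructor 3 | constructor 4].
Qed.

Lemma Klein_value (psi : gT -> k) x : linear_char psi -> (forall z, z \in P -> psi z = 1) ->
  psi x = psi (retr P Q x).
Proof.
move=> pP psi_P; rewrite -{1}(mulgKV (retr P Q x) x) pP.2 psi_P ?mul1r //.
exact: divgr_in PQ x.
Qed.

Lemma psi1_sq x : psi1 x * psi1 x = 1.
Proof.
rewrite (Klein_value _ psi1P psi1_P).
by case: (Klein_elements (retr_in PQ x)) => ->; rewrite ?psi1P.2 ?psi1P.1 ?psi1_s1 ?psi1_s2; ring.
Qed.
Lemma psi2_sq x : psi2 x * psi2 x = 1.
Proof.
rewrite (Klein_value _ psi2P psi2_P).
by case: (Klein_elements (retr_in PQ x)) => ->; rewrite ?psi2P.2 ?psi2P.1 ?psi2_s1 ?psi2_s2; ring.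
Qed.

Lemma exists_uv : exists u v : A, exists r1 r2 : k, [/\ r1 != 0, r2 != 0, u = r1 *: charfun psi1,
  v = r2 *: charfun psi2 & [/\ u * u = 1, v * v = 1 & u * v = - (v * u)]].
Proof.
have w1 := wJ_neq0 JP psi1P psi1P; have w2 := wJ_neq0 JP psi2P psi2P.
(* The twisted square of psi1 is the scalar [wJ J psi1 psi1], which r1 normalizes to 1; r2 does the
   same for psi2. *)
have [r1 e1] := exists_nth_root (wJ J psi1 psi1)^-1 (isT : (0 < 2)%N).
have [r2 e2] := exists_nth_root (wJ J psi2 psi2)^-1 (isT : (0 < 2)%N).
have n1 : r1 != 0.
  apply/eqP=> r0; move/eqP: e1; rewrite r0 expr0n eq_sym invr_eq0; exact/negP.
have n2 : r2 != 0.
  apply/eqP=> r0; move/eqP: e2; rewrite r0 expr0n eq_sym invr_eq0; exact/negP.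
exists (r1 *: charfun psi1), (r2 *: charfun psi2), r1, r2; split=> //; split.
- rewrite -scalerAl -scalerAr !scalerA charfunM // scalerA -expr2 e1 mulVf // scale1r.
  by apply/ffunP=> x; rewrite ffunE psi1_sq twalg1.
- rewrite -scalerAl -scalerAr !scalerA charfunM // scalerA -expr2 e2 mulVf // scale1r.
  by apply/ffunP=> x; rewrite ffunE psi2_sq twalg1.
- rewrite -!scalerAl -!scalerAr !scalerA !charfunM // wanti scaleNr scalerN [r2 * r1]mulrC.
  by congr (- (_ *: (_ *: _))); apply/ffunP=> x; rewrite !ffunE mulrC.
Qed.

Variables (u v : A) (r1 r2 : k).
Hypotheses (r10 : r1 != 0) (r20 : r2 != 0) (uE : u = r1 *: charfun psi1) (vE : v = r2 *: charfun psi2)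
 (uu : u * u = 1) (vv : v * v = 1) (uv : u * v = - (v * u)).

(** A P-invariant function factors through the Klein group Q, whose functions are spanned by its
    four characters. This supplies the hypothesis [fixB] on the quaternion pair. *)
Lemma lact_P_fixed_combination (f : A) : lact a1 f = f -> lact a2 f = f ->
  exists c0 c1 c2 c3 : k, f = c0 *: 1 + c1 *: u + c2 *: v + c3 *: (u * v).
Proof.
move=> fa1 fa2; have fX a n : lact a f = f -> lact (a ^+ n)%g f = f.
  by move=> e; elim: n => [|n IH]; [rewrite expg0 lact1|rewrite expgS lactM IH].
have fr x : f x = f (retr P Q x).
  have [i [j e]] := Pdec (divgr_in PQ x).
  have : lact (x * (retr P Q x)^-1)%g f = f by rewrite e lactM !fX.
  by move/ffunP/(_ x); rewrite lactE invMg invgK mulgKV => <-.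
have w0 := wJ_neq0 JP psi1P psi2P.
pose q := 2%:R^-1 * 2%:R^-1 : k.
(* Fourier coefficients on Q, divided by the factors by which u, v and u * v differ from
   characters. *)
exists (q * (f 1%g + f s1 + f s2 + f (s1 * s2)%g)),
  (q * (f 1%g - f s1 + f s2 - f (s1 * s2)%g) / r1),
  (q * (f 1%g + f s1 - f s2 - f (s1 * s2)%g) / r2),
  (q * (f 1%g - f s1 - f s2 + f (s1 * s2)%g) / (r1 * r2 * wJ J psi1 psi2)).
rewrite uE vE -scalerAl -scalerAr charfunM //.
apply/ffunP=> x; rewrite !twalgD !twalgZ twalg1 !ffunE (fr x).
rewrite (Klein_value x psi1P psi1_P) (Klein_value x psi2P psi2_P).
case: (Klein_elements (retr_in PQ x)) => ->;
  rewrite ?psi1P.2 ?psi1P.1 ?psi2P.2 ?psi2P.1 ?psi1_s1 ?psi1_s2 ?psi2_s1 ?psi2_s2 /q.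
all: by field; rewrite ?r10 ?r20 ?w0 ?two0.
Qed.

Let uPsi g : lact g u = (psi1 g)^-1 *: u.
Proof. by rewrite uE linearZ /= lact_charfun // !scalerA mulrC. Qed.
Let vPsi g : lact g v = (psi2 g)^-1 *: v.
Proof. by rewrite vE linearZ /= lact_charfun // !scalerA mulrC. Qed.

Lemma lact_incent g x : incent u v x -> incent u v (lact g x).
Proof.
move=> [xu xv]; split.
  have -> : u = psi1 g *: lact g u.
    by rewrite uPsi scalerA mulfV ?scale1r ?char_neq0.
  by rewrite -scalerAl -scalerAr -!rmorphM /= xu.
have -> : v = psi2 g *: lact g v.
  by rewrite vPsi scalerA mulfV ?scale1r ?char_neq0.
by rewrite -scalerAl -scalerAr -!rmorphM /= xv.
Qed.

Let u_P z : z \in P -> lact z u = u.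
Proof. by move=> zP; rewrite uPsi psi1_P // invr1 scale1r. Qed.
Let v_P z : z \in P -> lact z v = v.
Proof. by move=> zP; rewrite vPsi psi2_P // invr1 scale1r. Qed.

Lemma exists_cube_root_of_unity : exists ze : k, ze * ze * ze = 1 /\ ze != 1.
Proof.
(* A root of X^2 = -1 - X; the value 1 would give 3 = 0. *)
have [ze e] := @solve_monicpoly k 2 (nth 0 [:: -1; -1]) isT.
move: e; rewrite !big_ord_recl big_ord0 /= expr0 mulr1 addr0 => e.
have e' : ze * ze = - 1 - ze by rewrite -expr2 e; ring.
exists ze; split; first by rewrite e' mulrBl mulN1r e'; ring.
apply: contra_neq three0 => z1; move/eqP: e'; rewrite z1 mulr1 -subr_eq0 => /eqP <-; ring.
Qed.

Let conj_comm (x y z : gT) : (x ^ y = z)%g -> (x * y = y * z)%g.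
Proof. by move=> <-; rewrite conjgE mulKVg. Qed.

Let antilact (a s : gT) f : (a ^ s = a^-1)%g -> lact a (lact s (lact a f)) = lact s f :> A.
Proof. by move=> e; rewrite -!lactM (conj_comm e) mulgKV. Qed.
Let colact (a s : gT) f : (a ^ s = a)%g -> lact a (lact s f) = lact s (lact a f) :> A.
Proof. by move=> e; rewrite -!lactM (conj_comm e). Qed.

Section CubeRoot.
Variable ze : k.
Hypotheses (ze3 : ze * ze * ze = 1) (ze1 : ze != 1).
Let ze0 : ze != 0.
Proof. by apply/eqP=> z0; move/eqP: ze3; rewrite z0 !mulr0 eq_sym oner_eq0. Qed.

Lemma eigenfunction_sums (a b : gT) : commute a b -> (<[a]> :&: <[b]> = 1)%g ->
  (<[a]> * <[b]> = P)%g -> #[a]%g = 3%N ->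
  exists f1 f2 : A, [/\ lact a f1 = ze *: f1, lact b f1 = f1,
    lact a f2 = ze^-1 *: f2, lact b f2 = f2 & forall x, f1 x * f2 x = 1].
Proof.
move=> ab tab abP oa.
have zeo : ze ^+ #[a]%g = 1 by rewrite oa !exprS expr0 mulr1 mulrA.
have [F [F0 Fa Fb]] := exists_eigenfunction nP tPQ PQ ab tab abP zeo ze0.
have FaV x : F (a^-1 * x)%g = ze^-1 * F x.
  by apply: (mulfI ze0); rewrite -Fa mulKVg mulrA mulfV // mul1r.
have FbV x : F (b^-1 * x)%g = F x by rewrite -Fb mulKVg.
(* [lact a] evaluates at a^-1 x, so it is the inverse of F that has eigenvalue [ze]. *)
exists [ffun x => (F x)^-1], [ffun x => F x]; split.
- by apply/ffunP=> x; rewrite lactE twalgZ !ffunE FaV invfM invrK.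
- by apply/ffunP=> x; rewrite lactE !ffunE FbV.
- by apply/ffunP=> x; rewrite lactE twalgZ !ffunE FaV.
- by apply/ffunP=> x; rewrite lactE !ffunE FbV.
- by move=> x; rewrite !ffunE mulVf.
Qed.

Let rtransZ g c (f : A) : rtrans g (c *: f) = c *: rtrans g f.
Proof. by apply/ffunP=> x; rewrite !(rtransE, twalgZ). Qed.

(** Here [lact s1] plays the part of [sg] and [lact s2] that of [ta]: s1 inverts a1 and fixes a2, s2
    does the opposite. *)
Lemma exists_c1 : exists c : A, [/\ incent u v c, lact a1 c = ze *: c, lact a2 c = c
  & [/\ c * c * c = 1, lact s1 c = c * c & lact s2 c = c]].
Proof.
have [f1 [f2 [e1 e2 e3 e4 f12]]] := eigenfunction_sums ca ta aP o1.
have f21 x : f2 x * f1 x = 1 by rewrite mulrC.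
have sum1 := pointwise_product f12; have sum2 := pointwise_product f21.
apply: (char_element two0 uu vv uv (u_P a1P) (v_P a1P) (u_P a2P) (v_P a2P)
  lact_P_fixed_combination ze3 _ _ _ _ _ _ _ sum1 _ _ sum2).
- exact: lact_incent.
- exact: lact_incent.
- by move=> x; exact: antilact.
- by move=> x; exact: colact.
- by move=> x; exact: colact.
- by move=> x; exact: antilact.
- by move=> x; rewrite /= -lactM -[(s2 * s2)%g]/(s2 ^+ 2)%g -q2 expg_order lact1.
- by move=> p; rewrite /= linearZ /= lact_rtrans e1 rtransZ !scalerA mulrC.
- by move=> p; rewrite /= linearZ /= lact_rtrans e2.
- by move=> p; rewrite /= linearZ /= lact_rtrans e3 rtransZ !scalerA mulrC.
- by move=> p; rewrite /= linearZ /= lact_rtrans e4.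
Qed.

Lemma exists_c2 : exists c : A, [/\ incent u v c, lact a2 c = ze *: c, lact a1 c = c
  & [/\ c * c * c = 1, lact s2 c = c * c & lact s1 c = c]].
Proof.
have aP' : (<[a2]> * <[a1]> = P)%g.
  rewrite -aP; apply: normC; apply: cents_norm.
  by rewrite cycle_subG; apply/centP => y /cycleP[n ->]; exact/commuteX/commute_sym.
have ta' : (<[a2]> :&: <[a1]> = 1)%g by rewrite setIC.
have [f1 [f2 [e1 e2 e3 e4 f12]]] := eigenfunction_sums (commute_sym ca) ta' aP' o2.
have f21 x : f2 x * f1 x = 1 by rewrite mulrC.
have sum1 := pointwise_product f12; have sum2 := pointwise_product f21.
apply: (char_element two0 uu vv uv (u_P a2P) (v_P a2P) (u_P a1P) (v_P a1P)
  (fun f h2 h1 => lact_P_fixed_combination h1 h2) ze3 _ _ _ _ _ _ _ sum1 _ _ sum2).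
- exact: lact_incent.
- exact: lact_incent.
- by move=> x; exact: antilact.
- by move=> x; exact: colact.
- by move=> x; exact: colact.
- by move=> x; exact: antilact.
- by move=> x; rewrite /= -lactM -[(s1 * s1)%g]/(s1 ^+ 2)%g -q1 expg_order lact1.
- by move=> p; rewrite /= linearZ /= lact_rtrans e1 rtransZ !scalerA mulrC.
- by move=> p; rewrite /= linearZ /= lact_rtrans e2.
- by move=> p; rewrite /= linearZ /= lact_rtrans e3 rtransZ !scalerA mulrC.
- by move=> p; rewrite /= linearZ /= lact_rtrans e4.
Qed.

Let ze_order i : ze ^+ i = 1 -> (3 %| i)%N.
Proof.
move=> zi; have zi3 : ze ^+ (i %% 3) = 1.
  by rewrite expr_mod // !exprS expr0 mulr1 mulrA.
rewrite /dvdn; case: (i %% 3)%N (ltn_mod i 3) zi3 => [|[|[|//]]] // _.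
  by rewrite expr1 => z1; have := ze1; rewrite z1 eqxx.
by move=> z2; have := ze3; rewrite -expr2 z2 mul1r => z1; have := ze1; rewrite z1 eqxx.
Qed.

Let lactX a w (c : A) i : lact a c = w *: c -> lact (a ^+ i)%g c = w ^+ i *: c.
Proof.
move=> e; elim: i => [|i IH]; first by rewrite expg0 lact1 expr0 scale1r.
by rewrite expgS lactM IH linearZ /= e scalerA exprSr.
Qed.
Let lactX1 a (c : A) i : lact a c = c -> lact (a ^+ i)%g c = c.
Proof.
by move=> e; elim: i => [|i IH]; [rewrite expg0 lact1|rewrite expgS lactM IH].
Qed.

Let lact_idem g w (c : A) : lact g c = w *: c -> lact g (cubic_idem c 1) = cubic_idem c w.
Proof.
move=> e; rewrite /cubic_idem mulr1 !scale1r [LHS]linearZ; congr (_ *: _).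
by rewrite !rmorphD rmorph1 rmorphM /= e -scalerAl -scalerAr scalerA.
Qed.

Let w3 i : ze ^+ i * ze ^+ i * ze ^+ i = 1.
Proof. by rewrite -!exprMn ze3 expr1n. Qed.

Let idem_comm (x c : A) w : x * c = c * x -> x * cubic_idem c w = cubic_idem c w * x.
Proof.
move=> xc; rewrite /cubic_idem -scalerAr -scalerAl; congr (_ *: _).
by rewrite !mulrDr !mulrDl mulr1 mul1r -!scalerAr -!scalerAl (mulrA x) xc -!mulrA xc.
Qed.

Let idem_square g (c : A) : c * c * c = 1 -> lact g c = c * c ->
  lact g (cubic_idem c 1) = cubic_idem c 1.
Proof.
move=> c3 e; rewrite /cubic_idem mulr1 !scale1r [LHS]linearZ; congr (_ *: _).
by rewrite !rmorphD rmorph1 rmorphM /= e mulrA c3 mul1r addrAC.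
Qed.

(** P permutes the nine products of spectral idempotents of c1 and c2 simply transitively. The one
    for the eigenvalues (1, 1) is unchanged when a c_i is replaced by its inverse c_i^2, hence is
    fixed by Q. It commutes with u and v, hence with every P-invariant function. *)
Lemma exists_invariant_idempotent : exists E : A,
  [/\ (forall z, z \in P -> z != 1%g -> lact z E * E = 0), E * E = E,
   (forall q, q \in Q -> lact q E = E), \sum_(z in P) lact z E = 1
 & forall f : A, (forall z, z \in P -> lact z f = f) -> E * f = f * E].
Proof.
have [c1 [in1 a1c1 a2c1 [c13 s1c1 s2c1]]] := exists_c1.
have [c2 [in2 a2c2 a1c2 [c23 s2c2 s1c2]]] := exists_c2.
have c12 : c1 * c2 = c2 * c1.
  apply: (char_elements_commute two0 uu vv uv lact_P_fixed_combination ze3 (sg := lact s1)) => //.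
pose e1 := cubic_idem c1; pose e2 := cubic_idem c2; pose E := e1 1 * e2 1.
have e12 w w' : e1 w * e2 w' = e2 w' * e1 w.
  by apply: idem_comm; apply/esym/idem_comm.
have lactP i j : lact (a1 ^+ i * a2 ^+ j)%g E = e1 (ze ^+ i) * e2 (ze ^+ j).
  rewrite /E rmorphM /=; congr (_ * _); apply: lact_idem.
    by rewrite lactM (lactX1 _ a2c1) (lactX _ a1c1).
  by rewrite lactM (lactX _ a2c2) linearZ /= (lactX1 _ a1c2).
have E_commute (x : A) : x * c1 = c1 * x -> x * c2 = c2 * x -> E * x = x * E.
  move=> x1 x2; rewrite /E -mulrA -(idem_comm 1 x2) mulrA -(idem_comm 1 x1).
  by rewrite mulrA.
have Ein : incent u v E.
  by have [c1u c1v] := in1; have [c2u c2v] := in2; split; apply: E_commute.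
have mul4 w w' : e1 w * e2 w' * E = (e1 w * e1 1) * (e2 w' * e2 1).
  by rewrite /E !mulrA -(mulrA (e1 w)) -e12 mulrA.
have E_idem : E * E = E.
  by rewrite {1}/E mul4 !cubic_idem_idem.
have E_ortho z : z \in P -> z != 1%g -> lact z E * E = 0.
  case/Pdec=> i [j ->] z1; rewrite lactP mul4.
  case: (eqVneq (ze ^+ i) 1) => [zi|zi]; last by rewrite cubic_idem_ortho ?mul0r.
  case: (eqVneq (ze ^+ j) 1) => [zj|zj]; last by rewrite (cubic_idem_ortho c23) ?mulr0.
  have := ze_order zi; have := ze_order zj; rewrite -{1}o2 -{1}o1 !order_dvdn => /eqP ej /eqP ei.
  by rewrite ei ej mulg1 eqxx in z1.
have E_s1 : lact s1 E = E.
  by rewrite rmorphM /= idem_square // (lact_idem (w := 1)) // scale1r.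
have E_s2 : lact s2 E = E.
  by rewrite rmorphM /= (idem_square c23) // (lact_idem (w := 1)) // scale1r.
have E_Q q : q \in Q -> lact q E = E.
  by case/Qdec=> i [j ->]; rewrite lactM !lactX1.
have E0 : E != 0.
  apply/eqP=> E0; have z0 i j : e1 (ze ^+ i) * e2 (ze ^+ j) = 0 by rewrite -lactP E0 linear0.
  have s1' := cubic_idem_sum three0 c1 ze3 ze1; have s2' := cubic_idem_sum three0 c2 ze3 ze1.
  have zi i : e1 (ze ^+ i) = 0.
    rewrite -[LHS]mulr1 -s2' !mulrDr.
    have := z0 i 0%N; have := z0 i 1%N; have := z0 i 2%N.
    by rewrite expr0 expr1 expr2 => -> -> ->; rewrite !addr0.
  have := zi 0%N; have := zi 1%N; have := zi 2%N; rewrite expr0 expr1 expr2 => h2 h1 h0.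
  move: s1'; rewrite -/(e1 1) -/(e1 ze) -/(e1 (ze * ze)) h0 h1 h2 !addr0 => /eqP.
  by rewrite eq_sym oner_eq0.
have Ecomm f : (forall z, z \in P -> lact z f = f) -> E * f = f * E.
  move=> fP; have [d0 [d1 [d2 [d3 ->]]]] := lact_P_fixed_combination (fP _ a1P) (fP _ a2P).
  have cD (x y : A) : E * x = x * E -> E * y = y * E -> E * (x + y) = (x + y) * E.
    by move=> ex ey; rewrite mulrDr mulrDl ex ey.
  have cZ d (x : A) : E * x = x * E -> E * (d *: x) = (d *: x) * E.
    by move=> ex; rewrite -scalerAr -scalerAl ex.
  have [Eu Ev] := Ein.
  apply: (cD _ _ (cD _ _ (cD _ _ (cZ _ _ _) (cZ _ _ Eu)) (cZ _ _ Ev)) (cZ _ _ _)).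
    by rewrite mulr1 mul1r.
  by rewrite (mulrA E u) Eu -(mulrA u E) Ev mulrA.
exists E; split=> //.
(* S is P-invariant and commutes with u and v, hence is a scalar m; S E = E with E nonzero gives m =
   1. *)
pose S := \sum_(z in P) lact z E.
have SP z0 : z0 \in P -> lact z0 S = S.
  move=> zP; rewrite linear_sum [RHS](reindex_inj (mulgI z0)) /=.
  by apply: eq_big => [z|z _]; rewrite ?groupMl // lactM.
have Sin : incent u v S.
  split; rewrite mulr_suml mulr_sumr; apply: eq_bigr => z _; by case: (lact_incent z Ein).
have [m Sm] := fixed_central_scalar two0 uu vv uv lact_P_fixed_combination Sin (SP _ a1P) (SP _ a2P).
have SE : S * E = E.
  rewrite mulr_suml (bigD1 1%g) //= lact1 E_idem big1 ?addr0 // => z /andP[zP z1].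
  exact: E_ortho.
rewrite -/S Sm; move: SE; rewrite Sm -scalerAl mul1r => e.
suff -> : m = 1 by rewrite scale1r.
apply/eqP; rewrite -subr_eq0; have /eqP : (m - 1) *: E = 0 by rewrite scalerBl e scale1r subrr.
by rewrite scaler_eq0 (negPf E0) orbF.
Qed.

End CubeRoot.

End NontrivialKleinTwist.

(** * Non-simple twists *)

Lemma aug_gtwist (k : fieldType) (gT : finGroupType) (al be : gT -> k) (h : galg k gT) :
  aug al (gtwist be h) = aug (fun g => al g * be g) h.
Proof.
rewrite /gtwist linear_glin; apply: (@eq_glin k _ k^o) => g.
by rewrite linearZ /= aug_gb /GRing.scale /= mulrC.
Qed.

Section CocycleIdentities.
Variables (k : fieldType) (gT : finGroupType) (J K : galg k (gT * gT)%type).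
Hypothesis JP : twist_pair J K.

Lemma eq_wJ (al al' be be' : gT -> k) : al =1 al' -> be =1 be' -> wJ J al be = wJ J al' be'.
Proof. by move=> e e'; apply: eq_aug => q; rewrite e e'. Qed.

Lemma wJ_cocycle al be ga : linear_char al -> linear_char be -> linear_char ga ->
  wJ J al be * wJ J (fun x => al x * be x) ga = wJ J be ga * wJ J al (fun x => be x * ga x).
Proof.
move=> aP bP gP; have := congr1 (aug al) (jr_mul JP bP gP).
rewrite augM // [X in _ = X -> _]linearZ /= !aug_jr => e.
rewrite -[RHS]e mulrC; congr (_ * _).
by rewrite aug_gtwist aug_jr.
Qed.

Lemma wJ1l be : linear_char be -> wJ J (fun=> 1) be = 1.
Proof.
by move=> bP; have [_ _ _ c1 _] := JP; rewrite -aug_jl /jl slice1_one c1 aug1.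
Qed.
Lemma wJ1r al : linear_char al -> wJ J al (fun=> 1) = 1.
Proof.
by move=> bP; have [_ _ _ _ c2] := JP; rewrite -aug_jr /jr slice2_one c2 aug1.
Qed.

Lemma aug_tch_sym al be : linear_char al -> linear_char be ->
  aug al (tch J K be) = (aug be (tch J K al))^-1.
Proof.
by move=> aP bP; rewrite !(aug_tch JP) // invf_div.
Qed.

Lemma tch_eq1 psi : linear_char psi -> tch J K psi = 1 -> jl J psi = jr J psi.
Proof.
by move=> pP t1; rewrite -[LHS]mul1r -(jr_jri JP pP) -mulrA [_ * jl J psi]t1 mulr1.
Qed.
End CocycleIdentities.

Section Center.
Variables (k : fieldType) (gT : finGroupType) (cardG : #|gT| = 36%N).
Variables (J K : galg k (gT * gT)%type) (JP : twist_pair J K).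
Lemma simple_center1 : simple_twisted J -> ('Z([set: gT]) = 1)%g.
Proof.
move=> simpJ; apply/eqP/negPn/negP => Z1.
have [p pr_p pZ] : exists2 p, prime p & (p %| #|'Z([set: gT])%g|)%N.
  by exists (pdiv #|'Z([set: gT])%g|); rewrite ?pdiv_dvd ?pdiv_prime // cardG_gt1.
have [x xZ ox] := Cauchy pr_p pZ.
apply: (central_not_simple JP (N := <[x]>%G)) simpJ; rewrite ?cycle_subG //.
  by rewrite trivg_card1 -orderE ox; case: (p) pr_p => [|[]].
apply/eqP=> e; move: pr_p; rewrite -ox orderE e cardsT cardG.
by [].
Qed.
End Center.

Section NotSimple.
Variables (k : closedFieldType) (char0 : [pchar k] =i pred0) (gT : finGroupType).
Variables (J K : galg k (gT * gT)%type) (JP : twist_pair J K).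
Variables (P Q : {group gT}).
Hypotheses (nP : (P <| [set: gT])%g) (cP : #|P| = 9%N) (cQ : #|Q| = 4%N)
  (tPQ : (P :&: Q = 1)%g) (PQ : (P * Q = [set: gT])%g).
Let JK : J * K = 1. Proof. by case: JP. Qed.
Let KJ : K * J = 1. Proof. by case: JP. Qed.
Let natr_eq0 n : (n%:R == 0 :> k) = (n == 0%N).
Proof. by move: n; apply/pcharf0P. Qed.

(** The index of Q is 9, hence odd, so the trace argument gives t_psi = 1. Any nontrivial element of
    P lies in the kernel of psi and witnesses that the fixed points exceed k. *)
Lemma not_simple_of_characters (m : nat) (chars : 'I_m -> gT -> k) psi g0 :
  (forall i, linear_char (chars i)) ->
  (forall g, \sum_i chars i g = if g \in P then 4%:R else 0) ->
  linear_char psi -> (forall g, psi g * psi g = 1) ->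
  (forall z, z \in P -> psi z = 1) -> psi g0 != 1 ->
  (forall i, aug (chars i) (tch J K psi) = 1) -> ~ simple_twisted J.
Proof.
move=> charsP chars_sum pP psq psiP psi0 tchars.
have odd_index : odd (#|gT| %/ #|Q|).
  by rewrite -cardsT -PQ TI_cardMg // cP cQ.
have t1 : tch J K psi = 1.
  apply: (grouplike_involution_trivial char0 JK KJ (P := P) (Q := Q) (chars := chars)) => //.
  - by move=> g; rewrite chars_sum cQ.
  - exact: tch_grouplike.
  - by rewrite -(tch_mul JP pP pP) (eq_tch _ _ psq) (tch_one JP).
have [g1 g1P g1n] : exists2 g1, g1 \in P & g1 != 1%g.
  by apply/trivgPn; rewrite trivg_card1 cP.
apply: (central_character_not_simple _ JP pP psq (tch_eq1 JP pP t1) psi0 (psiP _ g1P) g1n).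
by rewrite natr_eq0.
Qed.

(** An alternating bicharacter on a cyclic group is trivial: every character of G/P is a power of
    one faithful [phi], and phi(t_phi) = 1. The previous criterion applies to phi^2. *)
Lemma cyclic_not_simple : cyclic Q -> ~ simple_twisted J.
Proof.
case/cyclicP=> q Qq.
have oq : #[q]%g = 4%N by rewrite orderE -Qq cQ.
(* A primitive fourth root of unity, the value of [phi] at the generator. *)
have [r r4] := exists_nth_root (-1 : k) (isT : (0 < 2)%N).
have rq : r ^+ #[q]%g = 1 by rewrite oq (exprM r 2 2) r4 sqrrN expr1n.
have [phi [phiP phi_P phi_q _]] : exists phi : gT -> k, [/\ linear_char phi,
    (forall z, z \in P -> phi z = 1), phi q = r & phi 1%g = 1].
  apply: (exists_quotient_char nP tPQ PQ (commute1 q) _ _ rq).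
    by rewrite cycle1 setIC; apply/trivgP; rewrite subsetIl.
  by rewrite cycle1 mulg1 Qq.
pose ph i (g : gT) := phi g ^+ i.
have phP i : linear_char (ph i).
  split; first by rewrite /ph phiP.1 expr1n.
  by move=> x y; rewrite /ph phiP.2 exprMn.
have tph i : tch J K (ph i) = tch J K phi ^+ i.
  elim: i => [|i IH]; first by rewrite expr0 -(tch_one JP); apply: eq_tch => g; rewrite /ph expr0.
  by rewrite exprS -IH -(tch_mul JP phiP (phP i)); apply: eq_tch => g; rewrite /ph exprS.
have aug_phi : aug phi (tch J K phi) = 1.
  by rewrite (aug_tch JP) // divff // (wJ_neq0 JP).
have aug_phi_X i : aug phi (tch J K phi ^+ i) = 1.
  elim: i => [|i IH]; first by rewrite expr0 aug1.
  by rewrite exprS augM // IH aug_phi mulr1.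
have rm1 : (-1 : k) != 1.
  by rewrite -subr_eq0 -opprD oppr_eq0 -[1 + 1]/(2%:R) natr_eq0.
have phi_dec g : exists2 n, retr P Q g = (q ^+ n)%g & phi g = r ^+ n.
  have := retr_in PQ g; rewrite Qq => /cycleP[n en]; exists n => //.
  rewrite (Klein_value PQ g phiP phi_P) en -phi_q.
  by elim: n {en} => [|n IH]; rewrite ?expg0 ?phiP.1 ?expr0 // expgS phiP.2 IH exprS.
have r4' : r ^+ 4 = 1 by rewrite -oq.
have phi4 g : phi g ^+ 4 = 1.
  by have [n _ ->] := phi_dec g; rewrite -exprM mulnC exprM r4' expr1n.
have phi1 g : phi g = 1 -> g \in P.
  have [n en ->] := phi_dec g => rn.
  suff qn : (q ^+ n = 1)%g.
    by have := divgr_in PQ g; rewrite en qn invg1 mulg1.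
  apply/eqP; rewrite -order_dvdn oq /dvdn.
  have : r ^+ (n %% 4) = 1 by rewrite expr_mod.
  case: (n %% 4)%N (ltn_mod n 4) => [|[|[|[|//]]]] // _ e; exfalso.
  - by move/eqP: rm1; apply; rewrite -r4 -[r]expr1 e expr1n.
  - by move/eqP: rm1; apply; rewrite -r4.
  - by move/eqP: rm1; apply; rewrite -r4 (_ : r = 1) ?expr1n // -r4' exprS e mulr1.
apply: (@not_simple_of_characters 4 (fun i => ph i) (ph 2) q) => //.
- move=> g; case: ifP => gP.
    rewrite (eq_bigr (fun=> 1)) ?sumr_const ?card_ord // => i _.
    by rewrite /ph phi_P // expr1n.
  have g1 : phi g - 1 != 0.
    by rewrite subr_eq0; apply/negP => /eqP/phi1; rewrite gP.
  by apply: (mulfI g1); rewrite mulr0 -[phi g - 1]/(phi g - 1) /ph -subrX1 phi4 subrr.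
- by move=> g; rewrite /ph -exprD phi4.
- by move=> z zP; rewrite /ph phi_P // expr1n.
- by rewrite /ph phi_q r4.
- move=> i; rewrite tph expr2 augM // aug_tch_sym // tph aug_phi_X invr1 mulr1 //.
Qed.
(** psi2(t_psi1) squares to 1. If it were 1, all four characters of G/P would be 1 on t_psi1,
    contrary to simplicity; so it is -1. *)
Lemma Klein_not_simple (psi1 psi2 : gT -> k) (s1 : gT) :
  linear_char psi1 -> linear_char psi2 ->
  (forall z, z \in P -> psi1 z = 1) -> (forall z, z \in P -> psi2 z = 1) ->
  (forall x, psi1 x * psi1 x = 1) -> (forall x, psi2 x * psi2 x = 1) ->
  (forall x, psi1 x = 1 -> psi2 x = 1 -> x \in P) -> psi1 s1 = -1 ->
  simple_twisted J -> wJ J psi1 psi2 = - wJ J psi2 psi1.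
Proof.
move=> p1 p2 P1 P2 sq1 sq2 P12 ps1 simpJ.
have rm1 : (-1 : k) != 1.
  by rewrite -subr_eq0 -opprD oppr_eq0 -[1 + 1]/(2%:R) natr_eq0.
have sgn (x : k) : x * x = 1 -> x = 1 \/ x = -1.
  by move=> /eqP; rewrite -expr2 sqrf_eq1 => /orP[]/eqP; [left|right].
have aug11 : aug psi1 (tch J K psi1) = 1.
  by rewrite (aug_tch JP) // divff // (wJ_neq0 JP).
have tt : tch J K psi1 * tch J K psi1 = 1.
  by rewrite -(tch_mul JP p1 p1) (eq_tch _ _ sq1) (tch_one JP).
have w0 := wJ_neq0 JP p2 p1.
have /sgn[] : aug psi2 (tch J K psi1) * aug psi2 (tch J K psi1) = 1.
- by rewrite -augM // tt aug1.
(* The two binary digits of i are the exponents of psi1 and psi2. *)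
- move=> aug21; case: (@not_simple_of_characters 4
    (fun i x => (if odd i then psi1 x else 1) * (if (1 < i)%N then psi2 x else 1)) psi1 s1) => //.
  + move=> i; apply: linear_charM; [case: (odd i)|case: (1 < i)%N] => //; exact: linear_char1.
  + move=> g; rewrite !big_ord_recl big_ord0 /= !mulr1 mul1r addr0.
    case: ifP => gP; first by rewrite P1 // P2 //; ring.
    case: (sgn _ (sq1 g)) => e1; case: (sgn _ (sq2 g)) => e2; rewrite e1 e2; try by ring.
    by rewrite P12 in gP.
  + by rewrite ps1.
  + move=> i; have p12 := linear_charM p1 p2.
    case: i => -[|[|[|[|//]]]] i4 /=.
    * rewrite (_ : aug _ _ = aug (fun=> 1) (tch J K psi1)).
        by rewrite (aug_tch_sym JP) ?(tch_one JP) ?aug1 ?invr1 //; exact: linear_char1.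
      by apply: eq_aug => x; rewrite mulr1.
    * by rewrite -[RHS]aug11; apply: eq_aug => x; rewrite mulr1.
    * by rewrite -[RHS]aug21; apply: eq_aug => x; rewrite mul1r.
    * rewrite (aug_tch_sym JP) // (tch_mul JP) // augM // aug11 mul1r.
      by rewrite (aug_tch_sym JP) // aug21 !invr1.
- move=> aug21; move: aug21; rewrite (aug_tch JP) // => e.
  by rewrite -[LHS](mulfVK w0) e mulN1r.
Qed.
End NotSimple.

(** * Lifted twists of Klein groups *)

Section GaugeIsomorphism.
Variables (k : fieldType) (gT hT : finGroupType) (f : gT -> hT) (fi : hT -> gT).
Hypotheses (f1 : f 1%g = 1%g) (fM : {morph f : x y / (x * y)%g})
  (fK : cancel f fi) (fiK : cancel fi f).
Variables (J K J1 K1 : galg k (gT * gT)%type) (v vi : galg k gT).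
Hypotheses (JK : J * K = 1) (KJ : K * J = 1) (JK1 : J1 * K1 = 1) (KJ1 : K1 * J1 = 1)
  (vvi : v * vi = 1) (viv : vi * v = 1) (gauged : cop v * J1 = J * gtens v v).

Definition map2 (q : gT * gT) : hT * hT := (f q.1, f q.2).
Let map2M : {morph map2 : x y / (x * y)%g}.
Proof. by move=> x y; rewrite /map2 !fM. Qed.

Definition gauge_iso (a : galg k gT) : galg k hT := gmap f (vi * a * v).

Lemma gauge_iso_linear : linear gauge_iso.
Proof.
by move=> c a b; rewrite /gauge_iso mulrDr mulrDl -scalerAr -scalerAl linearP.
Qed.
HB.instance Definition _ :=
  GRing.isLinear.Build k (galg k gT) (galg k hT) _ gauge_iso gauge_iso_linear.

Lemma gauge_isoM a b : gauge_iso (a * b) = gauge_iso a * gauge_iso b.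
Proof.
rewrite /gauge_iso -gmapM //; congr gmap.
by rewrite !mulrA -(mulrA (vi * a) v) vvi mulr1.
Qed.

Lemma gauge_iso_bij : bijective (gauge_iso : {ffun gT -> k} -> {ffun hT -> k}).
Proof.
exists (fun b : galg k hT => v * gmap fi b * vi) => a.
  rewrite /gauge_iso gmap_comp (eq_gmap (f' := id)); last by move=> x; exact: fK.
  by rewrite [gmap id _]glin_id !mulrA vvi mul1r -mulrA vvi mulr1.
rewrite /gauge_iso !mulrA viv mul1r -mulrA viv mulr1 gmap_comp.
by rewrite (eq_gmap (f' := id)) => [|x]; [exact: glin_id|exact: fiK].
Qed.

Lemma gmap_gtens (a b : galg k gT) : gmap map2 (gtens a b) = gtens (gmap f a) (gmap f b).
Proof.
rewrite gtensE (gmapM map2M) [RHS]gtensE /inl1 /inr1 !gmap_comp.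
by congr (_ * _); apply: eq_gmap => x; rewrite /map2 /= f1.
Qed.

Lemma gmap_cop (a : galg k gT) : gmap map2 (cop a) = cop (gmap f a).
Proof. by rewrite /cop !gmap_comp; apply: eq_gmap. Qed.

(** J_1 = Delta(v)^-1 J (v (x) v), so Delta^{J_1}(v^-1 a v) is Delta^J(a) conjugated by v (x) v;
    then everything is carried along f. *)
Lemma gauge_iso_hopf : hopf_iso J (gmap map2 J1) gauge_iso.
Proof.
have JK2 : gmap map2 J1 * gmap map2 K1 = 1.
  by rewrite -(gmapM map2M) JK1 gmap1 // /map2 f1.
have KJ2 : gmap map2 K1 * gmap map2 J1 = 1.
  by rewrite -(gmapM map2M) KJ1 gmap1 // /map2 f1.
split; split.
- exact: gauge_iso_linear.
- exact: gauge_iso_bij.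
- suff e : gauge_iso 1 = 1 by exact: e.
  by rewrite /gauge_iso mulr1 viv gmap1.
- exact: gauge_isoM.
- move=> a; have augE1 (T : finGroupType) (b : galg k T) : gcounit b = aug (fun=> 1) b.
    by apply: eq_bigr => g _; rewrite /GRing.scale /= mulr1.
  rewrite !augE1 /gauge_iso aug_gmap -[LHS]/(aug (fun=> 1) _).
  have o1 := linear_char1 k gT.
  by rewrite !augM // mulrAC -augM // viv aug1 // mul1r.
- move=> a; rewrite (tcomulE JK2 KJ2) (tcomulE JK KJ).
  pose gv : galg k (gT * gT)%type := gtens v v.
  pose gvi : galg k (gT * gT)%type := gtens vi vi.
  have vvE : gvi * gv = 1.
    by rewrite /gv /gvi gtensM viv gtensE /inl1 /inr1 !gmap1 ?mulr1.
  have e1 : gvi * K = K1 * cop vi.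
    have l : gvi * K * (J * gv) = 1.
      by rewrite !mulrA -(mulrA _ K) KJ mulr1.
    rewrite -[LHS]mulr1 -(_ : J * gv * (K1 * cop vi) = 1).
      by rewrite (mulrA (gvi * K)) l mul1r.
    rewrite -[J * gv]gauged !mulrA -(mulrA _ J1) JK1 mulr1 -copM vvi; exact: gmap1.
  transitivity (gmap map2 (gvi * tco J K a * gv)).
    rewrite /tco !mulrA e1 -!mulrA -[J * gv]gauged !mulrA -(mulrA K1) -copM -(mulrA K1) -copM.
    by rewrite !(gmapM map2M) gmap_cop.
  transitivity (glin (fun p => gtens (gauge_iso (gb k p.1)) (gauge_iso (gb k p.2)) : galg k (hT * hT)%type)
     (tco J K a)); last by [].
  move: (tco J K a) => X.
  transitivity (glin (fun p => gmap map2 (gvi * gb k p * gv)) X).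
    rewrite -(linear_glin (gmap map2)) (glin_mulr (fun p => gvi * gb k p)) glin_mull.
    by rewrite glin_id.
  apply: eq_bigr => -[x y] _ /=; rewrite gb_pair !gtensM gmap_gtens.
  by [].
Qed.
End GaugeIsomorphism.

Section KleinLift.
Variables (k : closedFieldType) (char0 : [pchar k] =i pred0) (gT hT : finGroupType).
Variables (J K : galg k (gT * gT)%type) (JP : twist_pair J K).
Variables (P Q : {group gT}).
Hypotheses (nP : (P <| [set: gT])%g) (tPQ : (P :&: Q = 1)%g) (PQ : (P * Q = [set: gT])%g).
Variables (f : gT -> hT) (fi : hT -> gT) (H : {group hT}).
Hypotheses (f1 : f 1%g = 1%g) (fM : {morph f : x y / (x * y)%g})
  (fK : cancel f fi) (fiK : cancel fi f) (fQ : forall x, (f x \in H) = (x \in Q)).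
Variables (s1 s2 : gT) (psi1 psi2 : gT -> k).
Hypotheses (psi1P : linear_char psi1) (psi2P : linear_char psi2)
  (psi1_P : forall z, z \in P -> psi1 z = 1) (psi2_P : forall z, z \in P -> psi2 z = 1)
  (psi1_s1 : psi1 s1 = -1) (psi1_s2 : psi1 s2 = 1) (psi2_s1 : psi2 s1 = 1) (psi2_s2 : psi2 s2 = -1)
  (Qel : forall x, x \in Q -> [\/ x = 1%g, x = s1, x = s2 | x = (s1 * s2)%g])
  (s1Q : s1 \in Q) (s2Q : s2 \in Q) (s11 : (s1 * s1 = 1)%g) (s22 : (s2 * s2 = 1)%g)
  (cardH : #|H| = 4%N)
  (wanti : wJ J psi1 psi2 = - wJ J psi2 psi1).
Let p := retr P Q.

(** The value 0 off H is the convention of [is_char]. *)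
Definition restr_char (psi : gT -> k) : {ffun hT -> k} := [ffun h => if h \in H then psi (fi h) else 0].
Definition infl_char (al : {ffun hT -> k}) (x : gT) : k := al (f (p x)).
Definition klein_chars : seq {ffun hT -> k} :=
  map restr_char [:: fun=> 1; psi1; psi2; fun x => psi1 x * psi2 x].
Definition klein_om (al be : {ffun hT -> k}) : k := wJ J (infl_char al) (infl_char be).

Lemma restr_is_char psi : linear_char psi -> is_char H (restr_char psi).
Proof.
move=> pP; have fi1 : fi 1%g = 1%g by rewrite -f1 fK.
have fiM x y : fi (x * y)%g = (fi x * fi y)%g by rewrite -[x in LHS]fiK -[y in LHS]fiK -fM fK.
split.
- by rewrite ffunE group1 fi1 pP.1.
- by move=> x y xH yH; rewrite !ffunE groupM // xH yH fiM pP.2.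
- by move=> x; rewrite ffunE => /negPf ->.
Qed.

Let fpH x : f (p x) \in H. Proof. by rewrite fQ (retr_in PQ). Qed.

Lemma infl_linear al : is_char H al -> linear_char (infl_char al).
Proof.
case=> a1 aM _; split; first by rewrite /infl_char /p retr1 f1.
by move=> x y; rewrite /infl_char /p (retrM nP tPQ PQ) fM aM.
Qed.

Lemma infl_restr psi : linear_char psi -> (forall z, z \in P -> psi z = 1) ->
  infl_char (restr_char psi) =1 psi.
Proof.
move=> pP pz x; rewrite /infl_char ffunE fpH fK.
by rewrite [RHS](Klein_value PQ x pP pz).
Qed.

Lemma restr_infl al : is_char H al -> restr_char (infl_char al) = al.
Proof.
case=> _ _ a0; apply/ffunP=> h; rewrite ffunE; case: ifP => [hH|/negbT/a0 //].
by rewrite /infl_char /p (retr_id tPQ) ?fiK // -fQ fiK.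
Qed.

Let natr_eq0 n : (n%:R == 0 :> k) = (n == 0%N).
Proof. by move: n; apply/pcharf0P. Qed.
Let oneN1 : (1 : k) == -1 = false.
Proof. by rewrite -subr_eq0 opprK -[1 + 1]/(2%:R) natr_eq0. Qed.
Let N1one : (-1 : k) == 1 = false. Proof. by rewrite eq_sym. Qed.

Lemma eq_restr psi psi' : psi =1 psi' -> restr_char psi = restr_char psi'.
Proof. by move=> e; apply/ffunP=> h; rewrite !ffunE e. Qed.

Lemma restr_neq psi psi' x : x \in Q -> psi x != psi' x -> restr_char psi != restr_char psi'.
Proof.
move=> xQ; apply: contra_neq => /ffunP/(_ (f x)).
by rewrite !ffunE fQ xQ fK.
Qed.

(** A character of H inflates to G through P and is then determined by its signs at s1 and s2. *)
Lemma klein_char_enum : char_enum H klein_chars.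
Proof.
split.
  have ne1 := restr_neq s1Q; have ne2 := restr_neq s2Q.
  rewrite /= !inE !negb_or !andbT; apply/and3P; split; first (apply/and3P; split); first last.
  - by apply: ne1; rewrite psi2_s1 psi1_s1 mulr1 oneN1.
  - apply/andP; split; first by apply: ne1; rewrite psi1_s1 psi2_s1 N1one.
    by apply: ne2; rewrite psi1_s2 psi2_s2 mul1r oneN1.
  - by apply: ne1; rewrite psi1_s1 psi2_s1 mulr1 oneN1.
  - by apply: ne2; rewrite psi2_s2 oneN1.
  - by apply: ne1; rewrite psi1_s1 oneN1.
move=> al; split.
  rewrite !inE => /or4P[] /eqP ->; apply: restr_is_char => //; first exact: linear_char1.
  exact: linear_charM.
move=> alP; rewrite -(restr_infl alP); have psiP := infl_linear alP.
set psi := infl_char al in psiP *.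
have psi_P z : z \in P -> psi z = 1.
  by move=> zP; rewrite /psi /infl_char /p retr_P // f1; case: alP.
have sgn x : (x * x = 1)%g -> psi x = 1 \/ psi x = -1.
  move=> xx; have /eqP : psi x * psi x = 1 by rewrite -psiP.2 xx psiP.1.
  by rewrite -expr2 sqrf_eq1 => /orP[]/eqP; [left|right].
have eq4 psi' : linear_char psi' -> (forall z, z \in P -> psi' z = 1) ->
    psi s1 = psi' s1 -> psi s2 = psi' s2 -> restr_char psi = restr_char psi'.
  move=> pP' p'P e1 e2; apply: eq_restr => x.
  rewrite (Klein_value PQ x psiP psi_P) (Klein_value PQ x pP' p'P).
  by case: (Qel (retr_in PQ x)) => ->; rewrite ?psiP.2 ?pP'.2 ?psiP.1 ?pP'.1 ?e1 ?e2.
have p12 := linear_charM psi1P psi2P.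
rewrite !inE; apply/or4P.
case: (sgn s1 s11) => e1; case: (sgn s2 s22) => e2.
- by constructor 1; apply/eqP/eq4 => //; exact: linear_char1.
- by constructor 3; apply/eqP/eq4 => //; rewrite ?e1 ?e2.
- by constructor 2; apply/eqP/eq4 => //; rewrite ?e1 ?e2.
- constructor 4; apply/eqP/eq4 => //; first by move=> z zP; rewrite psi1_P // psi2_P // mulr1.
    by rewrite e1 psi1_s1 psi2_s1 mulr1.
  by rewrite e2 psi1_s2 psi2_s2 mul1r.
Qed.

Lemma klein_2cocycle : is_2cocycle H klein_chars klein_om.
Proof.
have [_ enum] := klein_char_enum; have lin al : al \in klein_chars -> linear_char (infl_char al).
  by move=> /enum/infl_linear.
have c1 : infl_char (Defs.char1 k H) =1 fun=> 1 by move=> x; rewrite /infl_char ffunE fpH.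
have cM al be : infl_char (cmul al be) =1 fun x => infl_char al x * infl_char be x.
  by move=> x; rewrite /infl_char ffunE.
split.
- by move=> al be /lin aP /lin bP; exact: (wJ_neq0 JP aP bP).
- move=> al be ga /lin aP /lin bP /lin gP; rewrite /klein_om (eq_wJ _ (cM _ _) (frefl _)).
  by rewrite (wJ_cocycle JP) // (eq_wJ _ (frefl (infl_char al)) (cM _ _)).
- by move=> be /lin bP; rewrite /klein_om (eq_wJ _ c1 (frefl _)) (wJ1l JP bP).
- by move=> al /lin aP; rewrite /klein_om (eq_wJ _ (frefl _) c1) (wJ1r JP aP).
Qed.

(** A coboundary on an abelian group is symmetric, whereas [wanti] makes this cocycle change sign at
    the pair psi1, psi2, where it is nonzero. *)
Lemma klein_not_coboundary : ~ is_2coboundary klein_chars klein_om.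
Proof.
case=> mu [mu0 muE].
have in1 : restr_char psi1 \in klein_chars by rewrite !inE eqxx ?orbT.
have in2 : restr_char psi2 \in klein_chars by rewrite !inE eqxx ?orbT.
have cC : cmul (restr_char psi1) (restr_char psi2) = cmul (restr_char psi2) (restr_char psi1).
  by apply/ffunP=> x; rewrite !ffunE mulrC.
have := muE _ _ in1 in2; rewrite cC [mu _ * mu _]mulrC -muE //.
rewrite /klein_om (eq_wJ _ (infl_restr psi1P psi1_P) (infl_restr psi2P psi2_P)).
rewrite (eq_wJ _ (infl_restr psi2P psi2_P) (infl_restr psi1P psi1_P)) wanti.
move/eqP; rewrite eq_sym -addr_eq0 -mulr2n -mulr_natl mulf_eq0 (negPf (wJ_neq0 JP psi2P psi1P)).
by rewrite orbF; move/pcharf0P: char0 => ->.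
Qed.

Lemma klein_chars_ortho a h : a \in H ->
  \sum_(al <- klein_chars) al a * idem H al h = (a == h)%:R.
Proof.
move=> aH; have fi1 : fi 1%g = 1%g by rewrite -f1 fK.
have fiM x y : fi (x * y)%g = (fi x * fi y)%g by rewrite -[x in LHS]fiK -[y in LHS]fiK -fM fK.
rewrite big_map !big_cons big_nil !ffunE aH groupV cardH.
case: ifP => hH; last first.
  by rewrite !mulr0 !addr0; case: eqP => // ah; rewrite -ah aH in hH.
pose y := fi (a * h^-1)%g.
have yQ : y \in Q by rewrite -fQ fiK groupM ?groupV.
have yE psi : linear_char psi -> psi (fi a) * psi (fi h^-1%g) = psi y.
  by move=> pP; rewrite /y fiM pP.2.
have -> : (a == h) = (y == 1%g).
  by rewrite eq_mulgV1 -fi1 (inj_eq (can_inj fiK)).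
(* The sum of the four characters at y factors, and a factor vanishes unless both signs are 1. *)
have -> : 1 * (4%:R^-1 * 1) + (psi1 (fi a) * (4%:R^-1 * psi1 (fi h^-1%g)) +
    (psi2 (fi a) * (4%:R^-1 * psi2 (fi h^-1%g)) +
    (psi1 (fi a) * psi2 (fi a) * (4%:R^-1 * (psi1 (fi h^-1%g) * psi2 (fi h^-1%g))) + 0))) =
    4%:R^-1 * (1 + psi1 y) * (1 + psi2 y).
  by rewrite -!yE //; ring.
have four : 4%:R != 0 :> k by rewrite natr_eq0.
have s1n : (s1 == 1)%g = false.
  by apply/negP => /eqP e; move/eqP: psi1_s1; rewrite e psi1P.1 oneN1.
have s2n : (s2 == 1)%g = false.
  by apply/negP => /eqP e; move/eqP: psi2_s2; rewrite e psi2P.1 oneN1.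
have s12n : (s1 * s2 == 1)%g = false.
  apply/negP => /eqP e; have := psi1P.2 s1 s2; rewrite e psi1P.1 psi1_s1 psi1_s2 mulr1.
  by move/eqP; rewrite oneN1.
case: (Qel yQ) => ->; rewrite ?psi1P.2 ?psi2P.2 ?psi1P.1 ?psi2P.1 ?psi1_s1 ?psi1_s2 ?psi2_s1 ?psi2_s2.
- by rewrite eqxx -mulrA (_ : (1 + 1) * (1 + 1) = 4%:R) ?mulVf //; ring.
- by rewrite s1n subrr mulr0 mul0r.
- by rewrite s2n subrr mulr0.
- by rewrite s12n mulr1 mul1r subrr mulr0.
Qed.

(** Each element h of H is the sum of al(h) e_al. Expanding both legs of the push-forward of J in
    these idempotents produces the coefficients [klein_om]. *)
Lemma klein_lifted : lifted_twist H klein_chars klein_om =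
  gmap (fun q => (f (p q.1), f (p q.2))) J.
Proof.
apply/ffunP=> -[h h']; rewrite gmapE sum_ffunE.
transitivity (\sum_q J q * ((\sum_(al <- klein_chars) al (f (p q.1)) * idem H al h) *
    (\sum_(be <- klein_chars) be (f (p q.2)) * idem H be h'))); last first.
  rewrite [RHS]big_mkcond; apply: eq_bigr => q _; rewrite !klein_chars_ortho // xpair_eqE.
  by case: eqP; case: eqP; rewrite /= ?(mulr0, mul0r, mulr1).
under [RHS]eq_bigr do rewrite big_distrlr mulr_sumr.
rewrite exchange_big; apply: eq_bigr => al _; rewrite sum_ffunE.
under [RHS]eq_bigr do rewrite mulr_sumr.
rewrite exchange_big; apply: eq_bigr => be _; rewrite !ffunE /klein_om /wJ augE mulr_suml.
by apply: eq_bigr => q _; rewrite /infl_char /=; ring.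
Qed.

End KleinLift.

Lemma Z2xZ2_abelem : (2.-abelem [set: ('Z_2 * 'Z_2)%type])%g.
Proof.
apply/abelemP => //; split.
  by apply/centsP=> -[x1 y1] _ [x2 y2] _; congr (_, _); exact: addrC.
by move=> [[[|[|//]] i] [[|[|//]] j]] _; congr (_, _); apply/val_inj.
Qed.

Lemma gauge_retraction_pair (k : fieldType) (gT : finGroupType) (J K : galg k (gT * gT)%type)
    (p : gT -> gT) : p 1%g = 1%g -> {morph p : x y / (x * y)%g} ->
  J * K = 1 -> gmap (fun q => (p q.1, p q.2)) J * gmap (fun q => (p q.1, p q.2)) K = 1.
Proof.
move=> p1 pM JK; rewrite -gmapM ?JK ?gmap1 ?p1 //.
by move=> x y; rewrite /= !pM.
Qed.

Theorem theorem4p9 (k : closedFieldType) (k_char0 : [pchar k] =i pred0)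
    (gT : finGroupType) (cardG : #|gT| = 36%N)
    (J : {ffun (gT * gT)%type -> k})
    (twJ : is_twist J) (simpJ : simple_twisted J) :
  ([set: gT] \isog [set: ('D_6 * 'D_6)%type])%g /\
  exists (H1 : {group ('D_6 * 'D_6)%type})
         (chs : seq {ffun ('D_6 * 'D_6)%type -> k})
         (om : {ffun ('D_6 * 'D_6)%type -> k} -> {ffun ('D_6 * 'D_6)%type -> k} -> k),
    [/\ (H1 \isog [set: ('Z_2 * 'Z_2)%type])%g,
        char_enum H1 chs,
        is_2cocycle H1 chs om,
        ~ is_2coboundary chs om
      & exists f, hopf_iso J (lifted_twist H1 chs om) f].
Proof.
have [K JP] := is_twistP twJ; have [JK KJ _ _ _] := JP.
have Z1 := simple_center1 cardG JP simpJ.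
have [P [Q [nP cP cQ tPQ PQ]]] := exists_sdprod_Syl cardG Z1.
have ncQ : ~~ cyclic Q.
  by apply/negP => cyQ; apply: (cyclic_not_simple k_char0 JP nP cP cQ tPQ PQ cyQ simpJ).
have [a1 [a2 [s1 [s2 [[o1 o2 q1 q2] [a1s1 a1s2 a2s1 a2s2] [ca cs] aP sQ]]]]] :=
  Klein_generators Z1 nP cP cQ PQ ncQ.
have gen : (<[a1]> * <[a2]> * (<[s1]> * <[s2]>) = [set: gT])%g by rewrite aP sQ.
have isoG := isog_D6D6 cardG o1 o2 q1 q2 a1s1 a1s2 a2s1 a2s2 ca cs gen.
split=> //.
have ta : (<[a1]> :&: <[a2]> = 1)%g.
  by apply/eqP; rewrite trivg_card1 -(eqn_pmul2l (isT : (0 < 9)%N)) -{1}cP -aP -mul_cardG -!orderE o1 o2.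
have ts : (<[s1]> :&: <[s2]> = 1)%g.
  by apply/eqP; rewrite trivg_card1 -(eqn_pmul2l (isT : (0 < 4)%N)) -{1}cQ -sQ -mul_cardG -!orderE q1 q2.
have ts' : (<[s2]> :&: <[s1]> = 1)%g by rewrite setIC.
have sQ' : (<[s2]> * <[s1]> = Q)%g.
  rewrite -sQ; apply: normC; apply: cents_norm.
  by rewrite cycle_subG; apply/centP => y /cycleP[n ->]; exact/commuteX/commute_sym.
have m1 : (-1 : k) ^+ 2 = 1 by rewrite sqrrN expr1n.
have [psi1 [psi1P psi1_P psi1_s1 psi1_s2]] := exists_quotient_char nP tPQ PQ cs ts sQ
  (etrans (congr1 (fun n => (-1) ^+ n) q1) m1).
have [psi2 [psi2P psi2_P psi2_s2 psi2_s1]] := exists_quotient_char nP tPQ PQ (commute_sym cs) ts' sQ'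
  (etrans (congr1 (fun n => (-1) ^+ n) q2) m1).
have Qel := Klein_elements q1 q2 sQ.
have sq1 := psi1_sq PQ q1 q2 sQ psi1P psi1_P psi1_s1 psi1_s2.
have sq2 := psi2_sq PQ q1 q2 sQ psi2P psi2_P psi2_s1 psi2_s2.
have two0 : (1 : k) == -1 = false.
  by rewrite -subr_eq0 opprK -[1 + 1]/(2%:R); move/pcharf0P: k_char0 => ->.
have ker12 x : psi1 x = 1 -> psi2 x = 1 -> x \in P.
  rewrite (Klein_value PQ x psi1P psi1_P) (Klein_value PQ x psi2P psi2_P) => e1 e2.
  suff p1 : retr P Q x = 1%g by have := divgr_in PQ x; rewrite p1 invg1 mulg1.
  case: (Qel _ (retr_in PQ x)) e1 e2 => -> //; rewrite ?psi1P.2 ?psi1_s1 ?psi1_s2 ?psi2_s2 ?mulr1.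
  - by move/eqP; rewrite eq_sym two0.
  - by move=> _ /eqP; rewrite eq_sym two0.
  - by move/eqP; rewrite eq_sym two0.
have wanti := Klein_not_simple k_char0 JP nP cP cQ tPQ PQ psi1P psi2P psi1_P psi2_P sq1 sq2
  ker12 psi1_s1 simpJ.
have [u [v [r1 [r2 [r10 r20 uE vE [uu vv uv]]]]]] :=
  exists_uv JP PQ q1 q2 sQ psi1P psi2P psi1_P psi2_P psi1_s1 psi1_s2 psi2_s1 psi2_s2 wanti.
have [ze [ze3 ze1]] := exists_cube_root_of_unity k_char0.
have [E [E_ortho E_idem E_Q E_sum E_comm]] := exists_invariant_idempotent k_char0 nP tPQ PQ o1 o2 q1 q2
  a1s1 a1s2 a2s1 a2s2 ca aP sQ ta psi1P psi2P psi1_P psi2_P psi1_s1 psi1_s2 psi2_s1 psi2_s2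
  r10 r20 uE vE uu vv uv ze3 ze1.
have gauged := gauge_twist nP tPQ PQ E_ortho E_idem E_Q E_comm.
have [gi [gig ggi]] := gauge_unit nP tPQ PQ E_ortho E_idem E_Q E_sum.
have pM := retrM nP tPQ PQ; have p1 := retr1 P Q.
have JK1 := gauge_retraction_pair p1 pM JK; have KJ1 := gauge_retraction_pair p1 pM KJ.
have /isogP[f injf fG] := isoG.
have f1 : f 1%g = 1%g := morph1 f.
have fM : {morph f : x y / (x * y)%g} by move=> x y; apply: morphM; rewrite inE.
have finj : injective f by move=> x y; apply: (injmP injf); rewrite inE.
have [fi fK fiK] : bijective f by apply: (inj_card_bij finj); rewrite -cardsT -(card_isog isoG) cardsT.
have fQ x : (f x \in f @* Q)%g = (x \in Q).
  apply/morphimP/idP => [[y _ yQ /finj ->] //|xQ]; by exists x; rewrite ?inE.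
have s1Q : s1 \in Q by rewrite -sQ (subsetP (mulG_subl _ _)) ?cycle_id.
have s2Q : s2 \in Q by rewrite -sQ (subsetP (mulG_subr _ _)) ?cycle_id.
have s11 : (s1 * s1 = 1)%g by rewrite -[(s1 * s1)%g]/(s1 ^+ 2)%g -q1 expg_order.
have s22 : (s2 * s2 = 1)%g by rewrite -[(s2 * s2)%g]/(s2 ^+ 2)%g -q2 expg_order.
have cH : #|(f @* Q)%G| = 4%N by rewrite card_injm ?subsetT.
have aH : (2.-abelem (f @* Q))%g.
  apply/abelemP => //; split.
    by apply: morphim_abelian; apply: (@p2group_abelian _ 2); rewrite /pgroup cQ.
  move=> y /morphimP[x _ xQ ->]; rewrite -morphX ?inE //.
  case: (Qel _ xQ) => ->; rewrite ?expg1n ?morph1 // expgS expg1 ?s11 ?s22 ?morph1 //.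
  by rewrite -mulgA (mulgA s2) -cs -mulgA s22 mulg1 s11 morph1.
exists (f @* Q)%G, (klein_chars fi (f @* Q)%G psi1 psi2), (klein_om J P Q f); split.
- by rewrite (isog_abelem_card _ aH) Z2xZ2_abelem cardsT card_prod card_ord cH.
- exact: (klein_char_enum k_char0 nP tPQ PQ f1 fM fK fiK fQ psi1P psi2P psi1_P psi2_P
    psi1_s1 psi1_s2 psi2_s1 psi2_s2 Qel s1Q s2Q s11 s22).
- exact: (klein_2cocycle k_char0 JP nP tPQ PQ f1 fM fK fiK fQ psi1P psi2P psi1_P psi2_P
    psi1_s1 psi1_s2 psi2_s1 psi2_s2 Qel s1Q s2Q s11 s22).
- exact: (klein_not_coboundary k_char0 JP PQ fK fQ psi1P psi2P psi1_P psi2_P wanti).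
exists (gauge_iso f (gauge P Q E) gi).
rewrite (klein_lifted k_char0 J PQ f1 fM fK fiK fQ psi1P psi2P psi1_s1 psi1_s2 psi2_s1 psi2_s2 Qel cH).
have := gauge_iso_hopf f1 fM fK fiK JK KJ JK1 KJ1 ggi gig gauged.
by rewrite gmap_comp.
Qed.
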